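(* For every positive integer $n$ there exists a real number $\delta_n>0$ such that for every $\epsilon>0$ there is a constant $c_{n,\epsilon}>0$ with the following property: for every number field $K$ of degree $n$ over $\mathbb{Q}$, $$h_2(K)\le c_{n,\epsilon}\,|\mathrm{Disc}(K)|^{1/2-\delta_n+\epsilon}.$$
   Context: For a number field $K$, $\mathrm{Disc}(K)$ denotes its absolute discriminant and $h_2(K)=|\mathrm{Cl}(K)[2]|$ is the size of the $2$-torsion subgroup of the ideal class group of the ring of integers of $K$. *)

(* Defs.v *)
From HB Require Import structures.
From mathcomp Require Import all_boot all_order all_algebra all_field.
From mathcomp Require Import all_classical reals ereal counting_measure exp.

Set Implicit Arguments.
Unset Strict Implicit.
Unset Printing Implicit Defensive.

Import Order.TTheory GRing.Theory Num.Theory.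
Local Open Scope classical_set_scope.
Local Open Scope ring_scope.

(* Number fields are the K : fieldExtType rat; their degree is \dim {:K}. *)

Section Discriminant.
Variable K : fieldExtType rat.
Local Notation n := (\dim {:K}).

Definition ring_of_integers : set K :=
  [set x | integralOver (intr : int -> K) x].

Definition field_trace (x : K) : rat :=
  \tr (passmx.mxof (vbasis {:K}) (vbasis {:K}) (amulr x)).

Definition family_disc (b : 'I_n -> K) : rat :=
  \det (\matrix_(i, j) field_trace (b i * b j)).

Definition integral_basis (b : 'I_n -> K) : Prop :=
  (forall z : 'I_n -> int, \sum_i b i *~ z i = 0 -> forall i, z i = 0) /\
  (forall x, ring_of_integers x <->
     exists z : 'I_n -> int, x = \sum_i b i *~ z i).

(* The default value 0 is never reached: see disc_spec and discE. *)
Definition disc : int :=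
  xget 0 [set d : int | exists2 b, integral_basis b & family_disc b = d%:~R].

End Discriminant.

Arguments ring_of_integers : clear implicits.

Section ClassGroup.
Variable K : fieldExtType rat.
Local Notation OK := (ring_of_integers K).

Definition fractional_ideal (I : set K) : Prop :=
  [/\ exists2 x, I x & x != 0,
      forall x y, I x -> I y -> I (x + y),
      forall a x, OK a -> I x -> I (a * x) &
      exists2 d, OK d /\ d != 0 & forall x, I x -> OK (d * x)].

Definition ideal_mul (I J : set K) : set K :=
  [set x | exists2 s : seq (K * K),
     (forall p, p \in s -> I p.1 /\ J p.2) & x = \sum_(p <- s) p.1 * p.2].

Definition ideal_class (I : set K) : set (set K) :=
  [set J | exists2 x : K, x != 0 & J = [set x * y | y in I]].

Definition class_group : set (set (set K)) :=
  [set ideal_class I | I in fractional_ideal].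

(* The elementwise product of two classes is again a class: see class_mulE. *)
Definition class_mul (C D : set (set K)) : set (set K) :=
  [set ideal_mul I J | I in C & J in D].

Lemma OK1 : OK 1. Proof. exact: (integral1 (@intmul K 1)). Qed.

Lemma OK_mul x y : OK x -> OK y -> OK (x * y).
Proof. exact: (@integral_mul _ _ (intr : {rmorphism int -> K})). Qed.

Lemma OK_add x y : OK x -> OK y -> OK (x + y).
Proof. exact: (@integral_add _ _ (intr : {rmorphism int -> K})). Qed.

Lemma fractional_OK : fractional_ideal OK.
Proof.
split; first by exists 1; [exact: OK1 | rewrite oner_neq0].
- exact: OK_add.
- exact: OK_mul.
- by exists 1; [split; [exact: OK1 | exact: oner_neq0] | move=> x; rewrite mul1r].
Qed.

Lemma fractional0 (I : set K) : fractional_ideal I -> I 0.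
Proof.
move=> [[a Ia _] _ IM _]; rewrite -(mul0r a); apply: IM Ia.
exact: (integral0 (intr : {rmorphism int -> K})).
Qed.

Lemma fractional_mul (I J : set K) :
  fractional_ideal I -> fractional_ideal J -> fractional_ideal (ideal_mul I J).
Proof.
move=> fI fJ; have J0 := fractional0 fJ.
move: fI fJ => [[x Ix nx] ID IM [d [Od nd] Id]] [[y Jy ny] JD JM [e [Oe ne] Je]].
split.
- exists (x * y); last by rewrite mulf_neq0.
  by exists [:: (x, y)]; [move=> p; rewrite inE => /eqP-> | rewrite big_seq1].
- move=> _ _ [s Hs ->] [t Ht ->]; exists (s ++ t); last by rewrite big_cat.
  by move=> p; rewrite mem_cat => /orP[/Hs|/Ht].
- move=> a _ Oa [s Hs ->]; exists [seq (a * p.1, p.2) | p <- s].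
    by move=> _ /mapP[p /Hs[Ip Jp] ->]; split=> //; exact: IM.
  by rewrite big_map mulr_sumr; apply: eq_bigr => p _; rewrite mulrA.
- exists (d * e); first by split; [exact: OK_mul | exact: mulf_neq0].
  move=> _ [s Hs ->]; rewrite mulr_sumr big_seq.
  elim/big_ind: _ => [||p /Hs[Ip Jp]]; [| exact: OK_add |].
    exact: (integral0 (intr : {rmorphism int -> K})).
  by rewrite mulrACA; apply: OK_mul; [exact: Id | exact: Je].
Qed.

Lemma ideal_mul_scale (x y : K) (I J : set K) :
  ideal_mul [set x * u | u in I] [set y * v | v in J] =
  [set x * y * w | w in ideal_mul I J].
Proof.
apply/seteqP; split=> [_ [s Hs ->] | _ [_ [s Hs ->] <-]].
  elim: s Hs => [_ | [? ?] s IHs Hs].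
    by rewrite big_nil; exists 0; [exists [::]; rewrite ?big_nil | rewrite mulr0].
  have [|_ [t Ht ->] Es] := IHs.
    by move=> p sp; apply: Hs; rewrite inE sp orbT.
  have [[a Ia /= Ea] [b Jb /= Eb]] := Hs _ (mem_head _ _).
  exists (a * b + \sum_(p <- t) p.1 * p.2); last first.
    by rewrite big_cons -Es -Ea -Eb mulrDr /= [x * a * _]mulrACA.
  exists ((a, b) :: t); last by rewrite big_cons.
  by move=> p; rewrite inE => /predU1P[->|/Ht].
exists [seq (x * p.1, y * p.2) | p <- s]; last first.
  by rewrite big_map mulr_sumr; apply: eq_bigr => p _; rewrite mulrACA.
by move=> _ /mapP[p /Hs[Ip Jp] ->]; split; [exists p.1 | exists p.2].
Qed.

Lemma image_mul1 (I : set K) : [set 1 * u | u in I] = I.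
Proof. by rewrite -[RHS]image_id; congr image; apply/funext => u; rewrite mul1r. Qed.

Lemma class_mulE (I J : set K) :
  class_mul (ideal_class I) (ideal_class J) = ideal_class (ideal_mul I J).
Proof.
apply/seteqP; split=> [_ [_ [x nx ->] [_ [y ny ->] <-]] | _ [x nx ->]].
  by exists (x * y); [rewrite mulf_neq0 | rewrite ideal_mul_scale].
exists [set x * u | u in I]; first by exists x.
exists [set 1 * u | u in J]; first by exists 1 => //; exact: oner_neq0.
by rewrite ideal_mul_scale mulr1.
Qed.

Lemma ideal_mul1 (I : set K) : fractional_ideal I -> ideal_mul OK I = I.
Proof.
move=> fI; have I0 := fractional0 fI; case: fI => _ ID IM _.
apply/seteqP; split=> [_ [s Hs ->] | x Ix].
  rewrite big_seq; elim/big_ind: _ => // p /Hs[Op Ip]; exact: IM.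
by exists [:: (1, x)]; [move=> p; rewrite inE => /eqP->; split=> //; exact: OK1
                       | rewrite big_seq1 mul1r].
Qed.

Definition class_group2 : set (set (set K)) :=
  [set C | class_group C /\ class_mul C C = ideal_class OK].

End ClassGroup.

Arguments class_group : clear implicits.
Arguments class_group2 : clear implicits.

(* counting is +oo on infinite sets, so that an upper bound on h2 includes the
   finiteness of the 2-torsion. *)
Definition h2 (R : realType) (K : fieldExtType rat) : \bar R :=
  counting (class_group2 K).

Lemma char_poly_trmx (R : comNzRingType) m (A : 'M[R]_m) :
  char_poly A^T = char_poly A.
Proof.
rewrite /char_poly -[LHS]det_tr; congr (\det _).
by rewrite /char_poly_mx linearB /= tr_scalar_mx map_trmx trmxK.
Qed.

Section DiscriminantTheory.
Import passmx.
Variable K : fieldExtType rat.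
Local Notation n := (\dim {:K}).
Local Notation OK := (ring_of_integers K).
Local Notation e := (vbasis {:K}).
Implicit Types b : 'I_n -> K.

Fact field_trace_is_linear : linear_for *%R (@field_trace K).
Proof.
move=> a x y; rewrite /field_trace.
have -> : amulr (a *: x + y) = a *: amulr x + amulr y by exact: linearP.
rewrite (passmx.mxof_linear e e).
by rewrite mxtraceD mxtraceZ.
Qed.

HB.instance Definition _ := GRing.isLinear.Build rat K rat *%R (@field_trace K)
  field_trace_is_linear.

Lemma field_trace1 : field_trace (1 : K) = n%:R.
Proof.
rewrite /field_trace; have -> : amulr (1 : K) = \1%VF by apply/lfunP => y; rewrite !lfunE /= mulr1.
by rewrite passmx.mxof1 ?mxtrace1 // (basis_free (vbasisP _)).
Qed.

Lemma field_trace_int (x : K) : OK x -> field_trace x \is a Num.int.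
Proof.
move=> [p mon_p /rootP px0]; pose A := passmx.mxof e e (amulr x).
pose AC : 'M[algC]_n := map_mx ratr A.
have Aroot r : root (char_poly AC) r -> r \in Aint.
  rewrite -char_poly_trmx -eigenvalue_root_char.
  move=> /eigenvalueP[w wA nz_w].
  pose phi (y : K) := (map_mx ratr (passmx.rVof e y) *m w^T) 0 0 : algC.
  have phiD y z : phi (y + z) = phi y + phi z.
    by rewrite /phi linearD map_mxD mulmxDl mxE.
  have phi0 : phi 0 = 0 by rewrite /phi linear0 map_mx0 mul0mx mxE.
  have phiZ y (k : int) : phi (k%:~R * y) = k%:~R * phi y.
    have -> : k%:~R * y = (k%:~R : rat) *: y. by rewrite scaler_int mulrzl.
    by rewrite /phi linearZ map_mxZ -scalemxAl mxE /= ratr_int.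
  have phix y : phi (y * x) = r * phi y.
    have -> : y * x = amulr x y by rewrite lfunE.
    rewrite /phi (@rVof_app _ _ _ e e (vbasisP _)) map_mxM -mulmxA.
    have -> : map_mx ratr A *m w^T = (w *m AC^T)^T by rewrite trmx_mul trmxK.
    by rewrite wA linearZ /= -scalemxAr mxE.
  have phiXn y k : phi (y * x ^+ k) = r ^+ k * phi y.
    elim: k => [|k IHk]; first by rewrite mulr1 mul1r.
    by rewrite exprSr mulrA phix IHk mulrA -exprS.
  have phip y : (map_poly intr p).[r] * phi y = 0.
    transitivity (phi (y * (map_poly intr p).[x])); last by rewrite px0 mulr0.
    rewrite !horner_coef !size_map_poly_id0;
      try by rewrite (monicP mon_p) oner_neq0.
    rewrite mulr_suml mulr_sumr (big_morph phi phiD phi0).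
    apply: eq_bigr => k _.
    by rewrite !coef_map /= mulrCA phiZ phiXn mulrA.
  have [y nz_y] : exists y, phi y != 0.
    have [i nz_i] : exists i, w 0 i != 0 by apply/rV0Pn.
    exists e`_i; rewrite /phi passmx.rVofE ?vbasisP // map_delta_mx -rowE.
    by rewrite !mxE.
  have /eqP := phip y; rewrite mulf_eq0 (negPf nz_y) orbF => pr0.
  apply: (root_monic_Aint pr0); first exact: monic_map.
  by apply/polyOverP => i; rewrite coef_map /= rpred_int.
have [r Dr] := closed_field_poly_normal (char_poly AC).
rewrite (monicP (char_poly_monic _)) scale1r in Dr.
have rA z : z \in r -> z \in Aint.
  by move=> rz; apply: Aroot; rewrite Dr root_prod_XsubC.
have szr : size r = n.
  by apply: succn_inj; rewrite -(size_prod_XsubC r id) -Dr size_char_poly.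
have n_gt0 : (0 < n)%N by rewrite adim_gt0.
have trE : ratr (field_trace x) = \sum_(z <- r) z.
  apply: oppr_inj; rewrite -coefPn_prod_XsubC; last by rewrite szr -lt0n.
  by rewrite -Dr szr char_poly_trace // trace_map_mx.
have : ratr (field_trace x) \in (Num.int : {pred algC}).
  apply: Cint_rat_Aint; first exact: Crat_rat.
  by rewrite trE big_seq rpred_sum.
move=> /intrP[m Dm]; apply/intrP; exists m.
by apply: (fmorph_inj (ratr : {rmorphism rat -> algC})); rewrite /= ratr_int.
Qed.

Lemma OK_scale (x : K) : exists2 d : int, d != 0 & OK (x *~ d).
Proof.
pose A := mxof e e (amulr x).
pose d := \prod_(ij : 'I_n * 'I_n) denq (A ij.1 ij.2).
have nz_d : d != 0 by apply/prodf_neq0 => ij _; exact: denq_neq0.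
have dA i j : d%:~R * A i j \is a Num.int.
  rewrite /d (bigD1 (i, j)) //= rmorphM /= mulrAC.
  have -> : (denq (A i j))%:~R * A i j = (numq (A i j))%:~R.
    by rewrite mulrC numqE.
  by rewrite -rmorphM rpred_int.
exists d => //; pose B : 'M[int]_n := \matrix_(i, j) Num.floor (d%:~R * A i j).
exists (char_poly B); first exact: char_poly_monic.
rewrite (map_char_poly (intr : {rmorphism int -> K})) -char_poly_trmx.
rewrite -eigenvalue_root_char; apply/eigenvalueP.
exists (\row_i e`_i); last first.
  apply: contraNneq (oner_neq0 K) => /rowP z.
  rewrite [1](coord_vbasis (memvf 1)) big1 // => i _.
  by have := z i; rewrite !mxE => ->; rewrite scaler0.
apply/rowP => i; rewrite !mxE.
have -> : x *~ d * e`_i = (d%:~R : rat) *: amulr x e`_i.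
  by rewrite lfunE /= scaler_int mulrzAl mulrC.
rewrite -[amulr x _](rVofK (vbasisP {:K})) (@rVof_app _ _ _ e e (vbasisP _)).
rewrite rVofE ?vbasisP // -rowE /vecof scaler_sumr; apply: eq_bigr => j _.
rewrite [in RHS]mxE scalerA -/A -(floorK (dA i j)) scaler_int.
by rewrite [\row_k _]lock !mxE -lock mxE mulrzr.
Qed.

Lemma family_disc_change b b' (A : 'M[rat]_n) :
  (forall i, b' i = \sum_j A i j *: b j) ->
  family_disc b' = (\det A) ^+ 2 * family_disc b.
Proof.
move=> Db'; rewrite expr2 mulrAC -{2}(det_tr A) -!det_mulmx; congr (\det _).
apply/matrixP => i j; rewrite !mxE !Db' mulr_suml linear_sum.
under eq_bigr => k _ do
  rewrite mulr_sumr linear_sum.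
rewrite exchange_big /=; apply: eq_bigr => k _; rewrite !mxE mulr_suml.
apply: eq_bigr => l _; rewrite -scalerAl -scalerAr !linearZ !mxE /=.
by rewrite mulrA mulrAC.
Qed.

Lemma family_disc_vbasis : family_disc (fun i => e`_i) != 0.
Proof.
apply/negP => /det0P[v nz_v vM0].
have tr0 y : field_trace (vecof e v * y) = 0.
  rewrite (coord_vbasis (memvf y)) mulr_sumr linear_sum big1 // => j _.
  rewrite -scalerAr linearZ /= /vecof mulr_suml linear_sum /=.
  have /rowP/(_ j) := vM0; rewrite !mxE => vM0j.
  apply/eqP; rewrite mulf_eq0; apply/orP; right; apply/eqP.
  rewrite -[RHS]vM0j; apply: eq_bigr => i _.
  by rewrite !mxE -scalerAl linearZ.
have nz_x : vecof e v != 0 by rewrite vecof_eq0 ?vbasisP.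
have := field_trace1; rewrite -(mulfV nz_x) tr0 => /eqP.
by rewrite eq_sym pnatr_eq0 -leqn0 leqNgt adim_gt0.
Qed.

Lemma family_disc_int b : (forall i, OK (b i)) -> family_disc b \is a Num.int.
Proof.
move=> Ob; rewrite rpred_sum // => s _; rewrite rpredMsign rpred_prod // => i _.
by rewrite mxE field_trace_int //; exact: OK_mul.
Qed.

Lemma OK0 : OK 0.
Proof. exact: (integral0 (intr : {rmorphism int -> K})). Qed.

Lemma OK_mulrz x (k : int) : OK x -> OK (x *~ k).
Proof.
move=> Ox; rewrite -mulrzr; apply: OK_mul => //.
exact: (integral_id (intr : {rmorphism int -> K})).
Qed.

Lemma OK_sum (z : 'I_n -> int) b :
  (forall i, OK (b i)) -> OK (\sum_i b i *~ z i).
Proof.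
move=> Ob; apply: (big_ind OK); [exact: OK0 | exact: OK_add |].
by move=> i _; apply: OK_mulrz.
Qed.

Lemma integral_vbasis : exists2 d : 'I_n -> int,
  forall i : 'I_n, OK (e`_i *~ d i) &
  family_disc (fun i : 'I_n => e`_i *~ d i) != 0.
Proof.
have /choice[d dP] (i : 'I_n) : exists d : int, d != 0 /\ OK (e`_i *~ d).
  by have [d] := OK_scale e`_i; exists d.
exists d => [i|]; first by have [] := dP i.
pose D := diag_mx (\row_i (d i)%:~R : 'rV[rat]_n).
rewrite (@family_disc_change (fun i => e`_i) _ D) => [|i].
  rewrite mulf_neq0 ?family_disc_vbasis // expf_neq0 // det_diag.
  by apply/prodf_neq0 => i _; rewrite mxE intr_eq0; have [] := dP i.
rewrite (bigD1 i) //= big1 ?addr0 => [|j ne_ji].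
  by rewrite !mxE eqxx mulr1n scaler_int.
by rewrite !mxE eq_sym (negPf ne_ji) mulr0n scale0r.
Qed.

Lemma integral_basis_OK b : integral_basis b -> forall i, OK (b i).
Proof.
move=> [_ bP] i; apply/bP; exists (fun j => (j == i)%:R).
rewrite (bigD1 i) //= eqxx mulr1z big1 ?addr0 // => j /negPf->.
by rewrite mulr0z.
Qed.

Lemma integral_basis_change b b' : integral_basis b -> (forall i, OK (b' i)) ->
  exists A : 'M[int]_n,
    family_disc b' = ((\det A) ^+ 2)%:~R * family_disc b.
Proof.
move=> [_ bP] Ob'.
have /choice[z zP] (i : 'I_n) : exists z : 'I_n -> int, b' i = \sum_j b j *~ z j.
  exact/bP.
exists (\matrix_(i, j) z i j); rewrite rmorphXn /= -det_map_mx.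
apply: family_disc_change => i; rewrite zP.
by apply: eq_bigr => j _; rewrite !mxE scaler_int.
Qed.

Lemma integral_basis_disc_neq0 b : integral_basis b -> family_disc b != 0.
Proof.
move=> bP; have [d Od nz_d] := integral_vbasis.
have [A DA] := integral_basis_change bP Od.
by apply: contraNneq nz_d => b0; rewrite DA b0 mulr0.
Qed.

Lemma integral_basis_disc_unique b b' :
  integral_basis b -> integral_basis b' -> family_disc b = family_disc b'.
Proof.
move=> bP b'P.
have [A DA] := integral_basis_change bP (integral_basis_OK b'P).
have [B DB] := integral_basis_change b'P (integral_basis_OK bP).
have nz := integral_basis_disc_neq0 bP.
have /eqP AB : ((\det B) ^+ 2 * (\det A) ^+ 2)%:~R = 1 :> rat.
  by apply: (mulIf nz); rewrite mul1r rmorphM /= -mulrA -DA -DB.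
rewrite -[1]/(1%:~R) eqr_int in AB.
suff -> : family_disc b' = family_disc b by [].
rewrite DA; suff -> : (\det A) ^+ 2 = 1 by rewrite mul1r.
move: AB (sqr_ge0 (\det A)) (sqr_ge0 (\det B)).
case: (_ ^+ 2) => // y; case: (_ ^+ 2) => // x.
by rewrite -PoszM eqz_nat muln_eq1 => /andP[/eqP-> /eqP->].
Qed.

Lemma family_disc_basis b :
  family_disc b != 0 -> basis_of {:K} [tuple b i | i < n].
Proof.
move=> nz_b; rewrite basisEfree size_tuple leqnn subvf !andbT.
apply/freeP => c c0 i.
have c0' : \sum_i c i *: b i = 0.
  by rewrite -[RHS]c0; apply: eq_bigr => j _; rewrite nth_mktuple.
apply/eqP; apply: contraNT nz_b => nz_ci; apply/det0P.
exists (\row_i c i).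
  by apply: contraNneq nz_ci => /rowP/(_ i); rewrite !mxE => ->.
apply/rowP => j; rewrite !mxE.
transitivity (field_trace ((\sum_i c i *: b i) * b j)).
  rewrite mulr_suml linear_sum; apply: eq_bigr => k _.
  by rewrite !mxE -scalerAl linearZ.
by rewrite c0' mul0r linear0.
Qed.

Lemma integral_basis_ex : exists b : 'I_n -> K, integral_basis b.
Proof.
pose P m := `[< exists b, [/\ forall i, OK (b i), family_disc b != 0 &
                             `|family_disc b| = m%:R] >].
have exP b : (forall i, OK (b i)) -> family_disc b != 0 ->
    exists2 m, P m & `|family_disc b| = m%:R.
  move=> Ob nz_b; have /natrP[m Dm] := natr_norm_int (family_disc_int Ob).
  by exists m => //; apply/asboolP; exists b.
have exPm : exists m, P m.
  by have [d Od nz_d] := integral_vbasis; have [m] := exP _ Od nz_d; exists m.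
case: (ex_minnP exPm) => m /asboolP[b [Ob nz_b Dm]] minP.
have bB := family_disc_basis nz_b; exists b.
set B := [tuple b i | i < n] in bB.
have BE (i : 'I_n) : B`_i = b i by rewrite nth_mktuple.
split=> [z z0 i | x].
  have /freeP/(_ (fun i => (z i)%:~R)) := basis_free bB.
  move=> /(_ _ i)/eqP; rewrite intr_eq0 => zi; apply/eqP; apply: zi.
  by rewrite -[RHS]z0; apply: eq_bigr => j _; rewrite BE scaler_int.
split=> [Ox | [z ->]]; last exact: OK_sum.
pose c i := coord B i x.
have Dx : x = \sum_i c i *: b i.
  rewrite {1}(coord_basis bB (memvf x)).
  by apply: eq_bigr => i _; rewrite BE.
exists (fun i => Num.floor (c i)).
rewrite {1}Dx; apply: eq_bigr => k _; rewrite -scaler_int floorK //.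
pose t i := c i - (Num.floor (c i))%:~R.
have [t0 | nz_t] := eqVneq (t k) 0.
  by rewrite -(subrK (Num.floor (c k))%:~R (c k)) -/(t k) t0 add0r rpred_int.
have t_ge0 : 0 <= t k by rewrite subr_ge0 floor_le.
have t_lt1 : t k < 1.
  by rewrite ltrBlDl -[X in _ + X]/(1%:~R) -intrD floorD1_gt.
pose y := \sum_i t i *: b i.
have Oy : OK y.
  have -> : y = x + \sum_i b i *~ - Num.floor (c i).
    rewrite Dx -big_split; apply: eq_bigr => i _.
    by rewrite /= -scaler_int -scalerDl rmorphN.
  by apply: OK_add => //; exact: OK_sum.
pose b' i := if i == k then y else b i.
have Ob' i : OK (b' i) by rewrite /b'; case: eqP.
pose A : 'M[rat]_n := \matrix_(i, j) if i == k then t j else (i == j)%:R.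
have detA : \det A = t k.
  rewrite (expand_det_col _ k) (bigD1 k) //= big1 => [|i /negPf ne_ik].
    rewrite addr0 mxE eqxx /cofactor addnn -signr_odd odd_double mul1r.
    suff -> : row' k (col' k A) = 1%:M by rewrite det1 mulr1.
    apply/matrixP => i j; rewrite !mxE eq_sym (negPf (neq_lift _ _)).
    by rewrite (inj_eq (@lift_inj _ k)).
  by rewrite mxE ne_ik mul0r.
have Db' : family_disc b' = t k ^+ 2 * family_disc b.
  rewrite -detA; apply: family_disc_change => i; rewrite /b'.
  have [-> | ne_ik] := eqVneq i k.
    by apply: eq_bigr => j _; rewrite mxE eqxx.
  rewrite (bigD1 i) //= big1 => [|j ne_ji].
    by rewrite mxE (negPf ne_ik) eqxx scale1r addr0.
  by rewrite mxE (negPf ne_ik) eq_sym (negPf ne_ji) scale0r.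
have nz_b' : family_disc b' != 0 by rewrite Db' mulf_neq0 // expf_neq0.
have [m' /minP le_mm' Dm'] := exP _ Ob' nz_b'.
have : m'%:R < m%:R :> rat.
  rewrite -Dm' -Dm Db' normrM gtr_pMl ?normr_gt0 //.
  by rewrite ger0_norm ?sqr_ge0 // expr_lt1.
by rewrite ltr_nat ltnNge le_mm'.
Qed.

Lemma disc_spec : exists2 b : 'I_n -> K, integral_basis b & family_disc b = (disc K)%:~R.
Proof.
have [b bP] := integral_basis_ex.
have /intrP[d Dd] := family_disc_int (integral_basis_OK bP).
apply: (@xgetPex _ 0 [set d : int | exists2 b : 'I_n -> K,
  integral_basis b & family_disc b = d%:~R]).
by exists d; exists b.
Qed.

Lemma discE b : integral_basis b -> (disc K)%:~R = family_disc b.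
Proof.
by move=> bP; have [b' b'P <-] := disc_spec; exact: integral_basis_disc_unique.
Qed.

Lemma disc_neq0 : disc K != 0.
Proof.
have [b bP Db] := disc_spec.
by have := integral_basis_disc_neq0 bP; rewrite Db intr_eq0.
Qed.

End DiscriminantTheory.

(* Main.v *)
From HB Require Import structures.
Require Import Defs.
From mathcomp Require Import all_boot all_order all_algebra all_field.
From mathcomp Require Import fingroup perm complex.
From mathcomp Require Import all_classical reals ereal counting_measure exp.
From mathcomp Require Import ring lra zify.

Set Implicit Arguments.
Unset Strict Implicit.
Unset Printing Implicit Defensive.

Import Order.TTheory GRing.Theory Num.Theory.
Local Open Scope ring_scope.

(** Let D be the absolute discriminant and n the degree of K.  A 2-torsion class
    contains an integral ideal I with I^2 = (beta).  For g in I the integer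
    alpha = g^2 / beta has norm plus or minus a square, and it determines the
    class, since (g / beta) I is the only ideal with square (alpha).  The lattice
    I with the form sum_j |sigma_j g|^2 / |sigma_j beta| = sum_j |sigma_j alpha|
    has determinant D.  By Hermite reduction, either some alpha has conjugates at
    most D^(1/n - tau), or all vectors of a reduced basis are small and a bounded
    combination of them gives an alpha with distinct conjugates of size
    O(D^(1/n + (n-1) tau)).  For T >= D^(1/n) there are O(T^n / sqrt D) integers
    of K with conjugates at most T, so it is enough to save a power of D in each
    coset alpha + Z.  In the first case the coset is short.  In the second one
    has to count the t for which |N(alpha + t)| is a square.  Here the polynomial
    N(alpha + t) is separable; on a short interval away from its roots the square
    root of its absolute value is so close to a polynomial of degree n that the
    points (t, y) lie on the graph of an interpolating polynomial, which leaves
    boundedly many of them. *)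

(** * Reduction of positive definite forms *)

(** The lattice count needs T at least D^(1/n), because the vectors of a reduced basis of the ring
    of integers are only known to be O(D^(1/n)). At that T it gives O(sqrt D), the trivial bound to
    be beaten. All constants may depend on n only, whereas the coefficients of N(alpha + t) grow
    with D. The count of square values therefore sees the polynomial only through the distances from
    t to its roots: recentred and rescaled by such a distance, it has coefficients at most 2^n.
    Separability excludes a real obstruction. If alpha lies in a subfield over which K has even
    degree, N(alpha + t) is the square of a polynomial and every t counts. A single short vector of
    I may give such an alpha, so distinct conjugates are produced from a whole basis. When some
    alpha is very small, the shortness of its coset suffices and nothing is asked of its conjugates.
    The relation I^2 = (beta) takes the place of factorization of ideals: it provides the inverse of
    I, its index by way of local generators and, with integral closedness, the uniqueness of square
    roots. *)

Section QuadraticForms.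
Variable R : archiRealFieldType.

Definition qform n (G : 'M[R]_n) (v : 'rV_n) : R := (v *m G *m v^T) 0 0.

Definition posdef n (G : 'M[R]_n) :=
  G^T = G /\ forall v : 'rV_n, v != 0 -> 0 < qform G v.

Lemma qform_congr m n (G : 'M[R]_n) (U : 'M_(m, n)) v :
  qform (U *m G *m U^T) v = qform G (v *m U).
Proof. by rewrite /qform trmx_mul !mulmxA. Qed.

Lemma qform_delta n (G : 'M[R]_n) i : qform G (delta_mx 0 i) = G i i.
Proof. by rewrite /qform -rowE trmx_delta -colE !mxE. Qed.

Lemma congr_diag m n (G : 'M[R]_n) (U : 'M_(m, n)) i :
  (U *m G *m U^T) i i = qform G (row i U).
Proof. by rewrite -qform_delta qform_congr -rowE. Qed.

Lemma posdef_congr n (G : 'M[R]_n) (U : 'M_n) :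
  posdef G -> U \in unitmx -> posdef (U *m G *m U^T).
Proof.
move=> [Gs Gp] uU; split; first by rewrite !trmx_mul trmxK Gs mulmxA.
move=> v nzv; rewrite qform_congr; apply: Gp.
by apply: contraNneq nzv => vU; rewrite -(mulmxK uU v) vU mul0mx.
Qed.

Lemma posdef_diag n (G : 'M[R]_n) i : posdef G -> 0 < G i i.
Proof.
move=> [_ Gp]; rewrite -qform_delta; apply: Gp.
by apply/eqP => /rowP/(_ i); rewrite !mxE !eqxx; apply/eqP; rewrite oner_neq0.
Qed.

(** Completing the square in the first variable: [c] is the rest of the first column divided by the
    corner [a], and [S] is the Schur complement, the form on the projection orthogonal to the first
    basis vector. Both inductions below rest on it. *)
Lemma posdef_schur n (G : 'M[R]_(1 + n)) : posdef G ->
  exists a (c : 'cV_n) S, [/\ 0 < a, posdef S, \det G = a * \det S &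
    G = block_mx a%:M (a *: c^T) (a *: c) (a *: (c *m c^T) + S)].
Proof.
move=> pG; have [Gs Gp] := pG; pose a := G 0 0.
have a0 : 0 < a by exact: posdef_diag.
pose c := a^-1 *: dlsubmx G.
pose S := drsubmx G - a *: (c *m c^T).
have Ga : ulsubmx G = a%:M.
  rewrite [LHS]mx11_scalar !mxE; congr (G _ _)%:M; exact: val_inj.
have Gc : dlsubmx G = a *: c by rewrite scalerA mulfV ?scale1r ?gt_eqF.
have DG : G = block_mx a%:M (a *: c^T) (a *: c) (a *: (c *m c^T) + S).
  rewrite -{1}(submxK G) Ga Gc addrC subrK; congr block_mx.
  by rewrite -linearZ /= -Gc trmx_dlsub Gs.
pose L : 'M[R]_(1 + n) := block_mx 1%:M 0 c 1%:M.
have DG2 : G = L *m block_mx a%:M 0 0 S *m L^T.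
  rewrite DG tr_block_mx !mulmx_block !trmx1 trmx0.
  rewrite ?(mulmx0, mul0mx, mulmx1, mul1mx, addr0, add0r).
  by rewrite mul_scalar_mx mul_mx_scalar scalemxAl.
have dL : \det L = 1 by rewrite det_lblock !det1 mulr1.
have uL : L \in unitmx by rewrite unitmxE dL unitr1.
have pD : posdef (block_mx (a%:M : 'M_1) 0 0 S).
  have := posdef_congr pG (_ : invmx L \in unitmx).
  rewrite unitmx_inv => /(_ uL).
  by rewrite trmx_inv DG2 !mulmxA mulVmx // mul1mx -mulmxA mulmxV ?unitmx_tr // mulmx1.
exists a, c, S; split=> //; last first.
  by rewrite DG2 !det_mulmx det_tr dL mul1r mulr1 det_ublock det_scalar1.
have [] := pD; rewrite tr_block_mx => /eq_block_mx[_ _ _ St] Sp.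
split=> // v nzv; have := Sp (row_mx 0 v); rewrite /qform tr_row_mx mul_row_block.
rewrite ?(mulmx0, mul0mx, add0r) mul_row_col mul0mx add0r; apply.
by rewrite row_mx_eq0 eqxx.
Qed.

(** Hadamard's inequality. Passing to the Schur complement divides the determinant by the corner and
    does not increase the other diagonal entries. *)
Lemma det_posdef n (G : 'M[R]_n) : posdef G -> 0 < \det G <= \prod_i G i i.
Proof.
elim: n G => [|n IHn] G pG; first by rewrite det_mx00 big_ord0 ltr01 lexx.
have [a [c [S [a0 pS -> DG]]]] := @posdef_schur n G pG.
have /andP[dS0 dS] := IHn S pS; rewrite mulr_gt0 //=.
rewrite big_ord_recl.
have -> : G ord0 ord0 = a.
  transitivity (G (@lshift 1 n 0) (@lshift 1 n 0)).
    by congr (G _ _); apply: val_inj.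
  by rewrite DG; apply: etrans (block_mxEul _ _ _ _ _ _) _; rewrite mxE.
rewrite ler_pM2l //; apply: le_trans dS _; apply: ler_prod => i _.
rewrite ltW ?posdef_diag //=.
have -> : G (lift ord0 i) (lift ord0 i) = (a *: (c *m c^T) + S) i i.
  transitivity (G (@rshift 1 n i) (@rshift 1 n i)).
    by congr (G _ _); apply: val_inj.
  by rewrite DG; exact: (block_mxEdr _ _ _ _ i i).
by rewrite !mxE big_ord1 !mxE lerDr mulr_ge0 ?(ltW a0) // -expr2 sqr_ge0.
Qed.

Lemma det_row_replace n (v : 'rV[R]_n) i :
  \det (\matrix_(k, j) if k == i then v 0 j else (k == j)%:R) = v 0 i.
Proof.
set A := \matrix_(_, _) _.
rewrite (expand_det_col _ i) (bigD1 i) //= big1 => [|k /negPf ne_ki].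
  rewrite addr0 mxE eqxx /cofactor addnn -signr_odd odd_double mul1r.
  suff -> : row' i (col' i A) = 1%:M by rewrite det1 mulr1.
  apply/matrixP => k j; rewrite !mxE eq_sym (negPf (neq_lift _ _)).
  by rewrite (inj_eq (@lift_inj _ i)).
by rewrite mxE ne_ki mul0r.
Qed.

(** Hadamard's inequality for the basis whose [i]-th vector is replaced by [v]; this change of basis
    has determinant [v 0 i]. It bounds the coordinates of short vectors, and sharply so on a reduced
    basis. *)
Lemma posdef_coord n (G : 'M[R]_n) (v : 'rV_n) i : posdef G ->
  v 0 i ^+ 2 * \det G * G i i <= qform G v * \prod_j G j j.
Proof.
move=> pG; have [d0 _] := andP (det_posdef pG).
have qv0 : 0 <= qform G v.
  have [->|nzv] := eqVneq v 0; first by rewrite /qform mul0mx mul0mx mxE.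
  by rewrite ltW //; case: pG => _; apply.
have P0 (P : pred 'I_n) : 0 <= \prod_(j | P j) G j j.
  by apply: prodr_ge0 => j _; rewrite ltW ?posdef_diag.
have [->|nzvi] := eqVneq (v 0 i) 0; first by rewrite expr0n !mul0r mulr_ge0.
pose U := \matrix_(k, j) if k == i then v 0 j else (k == j)%:R : R.
have dU : \det U = v 0 i by exact: det_row_replace.
have uU : U \in unitmx by rewrite unitmxE dU unitfE.
have /andP[_] := det_posdef (posdef_congr pG uU).
rewrite !det_mulmx det_tr dU mulrAC -expr2 (bigD1 i) //= congr_diag.
have -> : row i U = v by apply/rowP => j; rewrite !mxE eqxx.
rewrite (eq_bigr (fun j => G j j)) => [le1|j ne_ji].
  rewrite [\prod_j G j j](bigD1 i) //= [G i i * _]mulrC mulrA.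
  by rewrite ler_pM2r ?posdef_diag.
rewrite congr_diag -qform_delta; congr qform.
by apply/rowP => k; rewrite !mxE (negPf ne_ji) eqxx /= eq_sym.
Qed.

Local Notation intmx := (map_mx (intr : int -> R)).

Lemma intmx_eq0 m n (A : 'M[int]_(m, n)) : (intmx A == 0) = (A == 0).
Proof.
apply/eqP/eqP => [/matrixP E|->]; last by rewrite map_mx0.
apply/matrixP => i j; have /eqP := E i j.
by rewrite !mxE -[X in _ == X]/(0%:~R) eqr_int => /eqP.
Qed.

(** Integral vectors no longer than a fixed basis vector have bounded coordinates by [posdef_coord],
    so the minimum is taken over a finite box. *)
Lemma finite_qform_min n (G : 'M[R]_n.+1) : posdef G ->
  exists2 v : 'rV[int]_n.+1, v != 0 &
    forall w : 'rV[int]_n.+1, w != 0 -> qform G (intmx v) <= qform G (intmx w).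
Proof.
move=> pG; have [d0 _] := andP (det_posdef pG).
pose e : 'rV[int]_n.+1 := delta_mx 0 0.
pose M := \sum_i qform G (intmx e) * (\prod_j G j j) / (\det G * G i i).
have nze : e != 0.
  by apply/eqP => /rowP/(_ 0); rewrite !mxE !eqxx.
have q0 (w : 'rV[int]_n.+1) : w != 0 -> 0 < qform G (intmx w).
  by move=> nzw; case: pG => _; apply; rewrite intmx_eq0.
have P0 : 0 < \prod_j G j j by apply: prodr_gt0 => j _; rewrite posdef_diag.
have dG i : 0 < \det G * G i i by rewrite mulr_gt0 ?posdef_diag.
have M0 : 0 <= M.
  apply: sumr_ge0 => i _; rewrite divr_ge0 ?ltW ?dG //.
  by rewrite mulr_gt0 // q0.
have [N MN] : exists N : nat, M < N%:R.
  by exists (Num.bound M); rewrite archi_boundP.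
pose dec (f : {ffun 'I_n.+1 -> 'I_(N + N).+1}) : 'rV[int]_n.+1 :=
  \row_i ((f i)%:Z - N%:Z).
have box w : qform G (intmx w) <= qform G (intmx e) -> exists f, w = dec f.
  move=> le_we.
  have wi i : (`|w 0%R i| <= N)%N.
    have := posdef_coord (intmx w) i pG; rewrite mxE -mulrA => H.
    have {}H : ((w 0 i)%:~R ^+ 2 : R) <= M.
      rewrite -ler_pdivlMr // in H; apply: le_trans H _.
      apply: (@le_trans _ _ (qform G (intmx e) * (\prod_j G j j) / (\det G * G i i))).
        by rewrite ler_pM2r ?invr_gt0 // ler_pM2r.
      rewrite /M [leRHS](bigD1 i) //= lerDl sumr_ge0 // => k _.
      by rewrite divr_ge0 ?ltW ?dG // mulr_gt0 // q0.
    have {H}H := le_lt_trans H MN.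
    rewrite -rmorphXn -[N%:R]/((N%:Z)%:~R) ltr_int in H.
    have := sqr_ge0 (w 0 i); rewrite expr2 in H *; nia.
  have wb i : (`|(w 0 i + N%:Z)%R| < (N + N).+1)%N.
    by have := wi i; lia.
  exists [ffun i => Ordinal (wb i)]; apply/rowP => i; rewrite !mxE ffunE /=.
  by have := wi i; lia.
have [f0 Df0] := box e (lexx _).
have Pf0 : dec f0 != 0 by rewrite -Df0.
case: (@Order.TotalTheory.arg_minP _ _ _ f0 (fun f => dec f != 0) (fun f => qform G (intmx (dec f))) Pf0).
move=> f nzf fmin; exists (dec f) => // w nzw.
have [le_we | lt_ew] := leP (qform G (intmx w)) (qform G (intmx e)).
  by have [g Dg] := box _ le_we; rewrite Dg fmin // -Dg.
by apply: le_trans (ltW lt_ew); rewrite Df0 fmin.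
Qed.
  
(** In the Smith normal form of a single row only the first entry can be nonzero. *)
Lemma unimodular_complete n (v : 'rV[int]_n.+1) :
  v != 0 -> exists d (U : 'M[int]_n.+1), U \in unitmx /\ v = d *: row 0 U.
Proof.
move=> nzv; have [L uL [U uU [s _ Dv]]] := int_Smith_normal_form v.
exists (L 0 0 * s`_0), U; split=> //.
rewrite {1}Dv; apply/rowP => j; rewrite !mxE (bigD1 0) //= big1 ?addr0.
  by rewrite !mxE big_ord1 !mxE /=.
move=> k nz_k; rewrite !mxE big_ord1 !mxE /=.
have /negPf := nz_k; rewrite eq_sym -val_eqE /= => ->.
by rewrite mulr0n mulr0 mul0r.
Qed.

Lemma qform_schur n a (c : 'cV[R]_n) S (x : 'rV_1) y :
  qform (block_mx a%:M (a *: c^T) (a *: c) (a *: (c *m c^T) + S)) (row_mx x y) =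
  a * (x 0 0 + (y *m c) 0 0) ^+ 2 + qform S y.
Proof.
rewrite /qform mul_row_block tr_row_mx mul_row_col !mulmxDl !mulmxDr.
rewrite !mul_mx_scalar -!scalemxAr -!scalemxAl !mulmxDl !mulmxA.
have Dc : c^T *m y^T = (y *m c)^T by rewrite trmx_mul.
rewrite -[a *: _ *m y^T]scalemxAl -[y *m c *m c^T *m _]mulmxA.
rewrite -[x *m c^T *m _]mulmxA Dc.
set b := y *m c; set q := y *m S *m y^T.
rewrite [x]mx11_scalar [b]mx11_scalar !tr_scalar_mx -?scalemxAl -!scalar_mxM.
rewrite !mxE /= !mulr1n; ring.
Qed.

Lemma nearest_int (x : R) : exists m : int, (m%:~R + x) ^+ 2 <= 4^-1.
Proof.
exists (- Num.floor (x + 2^-1)).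
have /andP[] := floor_itv (x + 2^-1); set f := Num.floor _.
rewrite intrD mulrNz => H1 H2; nra.
Qed.

(** Start with a shortest vector, of value a, reduce the projected form [S], and lift each vector of
    its basis so that the component along the shortest vector is at most 1/2. If the projection has
    value s, the lift has value at most a/4 + s. By minimality a is at most that value, which is
    therefore at most 4s/3. Each of the n stages costs at most (4/3)^n. *)
Lemma hermite_reduction n (G : 'M[R]_n) : posdef G ->
  exists2 U : 'M[int]_n, U \in unitmx &
    \prod_i (intmx U *m G *m (intmx U)^T) i i <= (4 / 3) ^+ (n * n) * \det G.
Proof.
elim: n G => [|n IHn] G pG.
  by exists 1%:M; rewrite ?unitmx1 // big_ord0 det_mx00 mulr1.
have [v nzv vmin] := finite_qform_min pG.
have [d [U0 [uU0 Dv]]] := unimodular_complete nzv.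
have nzd : d != 0 by apply: contraNneq nzv => d0; rewrite Dv d0 scale0r.
have uintmx m (A : 'M[int]_m) : A \in unitmx -> intmx A \in unitmx.
  by rewrite !unitmxE det_map_mx; exact: rmorph_unit.
pose G0 := intmx U0 *m G *m (intmx U0)^T.
have pG0 : posdef G0 by apply: posdef_congr (uintmx _ _ uU0).
have dG0 : \det G0 = \det G.
  rewrite !det_mulmx det_tr mulrAC -expr2 det_map_mx -rmorphXn /=.
  suff -> : \det U0 ^+ 2 = 1 by rewrite mul1r.
  by move: uU0; rewrite unitmxE qualifE /= => /orP[]/eqP->.
(* [v] is [d] times the first row of [U0] and [d] is a nonzero integer, so this row is no longer
   than [v]. *)
have G0min (w : 'rV[int]_n.+1) : w != 0 -> G0 0 0 <= qform G0 (intmx w).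
  move=> nzw; rewrite qform_congr -map_mxM.
  apply: le_trans (vmin _ _); last first.
    by apply: contraNneq nzw => w0; rewrite -(mulmxK uU0 w) w0 mul0mx.
  rewrite congr_diag -map_row Dv map_mxZ /qform linearZ /= -!scalemxAl -scalemxAr.
  rewrite scalerA [leRHS]mxE ler_peMl //.
    rewrite -/(qform _ _) ltW //; case: pG => _; apply; rewrite intmx_eq0.
    by apply: contraNneq nzv => r0; rewrite Dv r0 scaler0.
  rewrite -rmorphM /= -[1]/(1%:~R) ler_int; nia.
have [a [c [S [a0 pS dGS DG]]]] := @posdef_schur n G0 pG0.
have [V uV leV] := IHn S pS.
have /fin_all_exists[m mP] (i : 'I_n) := nearest_int ((intmx V *m c) i 0).
pose U1 : 'M[int]_(1 + n) := block_mx 1%:M 0 (\col_i m i) V.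
have uU1 : U1 \in unitmx by rewrite unitmxE det_lblock det1 mul1r.
exists (U1 *m U0); first by rewrite unitmx_mul uU1.
have -> : intmx (U1 *m U0) *m G *m (intmx (U1 *m U0))^T =
          intmx U1 *m G0 *m (intmx U1)^T.
  by rewrite map_mxM trmx_mul !mulmxA.
pose s i := (intmx V *m S *m (intmx V)^T) i i.
have s0 i : 0 < s i by apply: posdef_diag; apply: posdef_congr (uintmx _ _ uV).
have G00 : G0 0 0 = a.
  transitivity (G0 (@lshift 1 n 0) (@lshift 1 n 0)).
    by congr (G0 _ _); apply: val_inj.
  by rewrite DG; apply: etrans (block_mxEul _ _ _ _ _ _) _; rewrite mxE.
rewrite big_ord_recl -dG0 dGS.
have -> : (intmx U1 *m G0 *m (intmx U1)^T) ord0 ord0 = a.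
  rewrite congr_diag -G00 -qform_delta; congr qform; rewrite -map_row.
  have -> : row ord0 U1 = row (@lshift 1 n 0) U1.
    by congr row; apply: val_inj.
  rewrite rowKu; apply/rowP => j; rewrite !mxE.
  have -> : (j == 0) = (val j == 0%N) by rewrite -val_eqE.
  by case: splitP => k /= ->; rewrite !mxE ?ord1.
rewrite mulrCA ler_pM2l //.
have qs i : (intmx U1 *m G0 *m (intmx U1)^T) (lift ord0 i) (lift ord0 i) <= 4 / 3 * s i.
  have Dr : row (lift ord0 i) U1 = row_mx (m i)%:M (row i V).
    have -> : row (lift ord0 i) U1 = row (@rshift 1 n i) U1.
      by congr row; apply: val_inj.
    rewrite rowKd row_row_mx; congr row_mx.
    by apply/rowP => j; rewrite !mxE !ord1.
  rewrite congr_diag -map_row Dr.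
  have le_a : a <= qform G0 (intmx (row_mx (m i)%:M (row i V))).
    rewrite -G00; apply: G0min; rewrite -Dr.
    apply/eqP => /(congr1 (mulmxr (invmx U1))) /=; rewrite mul0mx rowE.
    rewrite mulmxK // => /rowP/(_ (lift ord0 i)); rewrite !mxE !eqxx.
    by apply/eqP; rewrite oner_neq0.
  move: le_a; rewrite map_row_mx /= DG qform_schur.
  rewrite map_row -congr_diag -/(s i).
  have -> : (map_mx intr (m i)%:M : 'M[R]_1) 0 0 = (m i)%:~R by rewrite !mxE.
  have -> : (row i (intmx V) *m c) 0 0 = (intmx V *m c) i 0 by rewrite -row_mul mxE.
  by have := mP i; nra.
apply: le_trans (_ : \prod_i (4 / 3 * s i) <= _).
  apply: ler_prod => i _; rewrite qs andbT ; apply/ltW/posdef_diag.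
  exact: posdef_congr (uintmx _ _ uU1).
rewrite big_split /= prodr_const card_ord.
apply: le_trans (_ : (4 / 3) ^+ n * ((4 / 3) ^+ (n * n) * \det S) <= _).
  by rewrite ler_pM2l ?exprn_gt0 //; lra.
rewrite mulrA -exprD ler_wpM2r //; last by apply: ler_weXn2l; [lra | lia].
by have /andP[/ltW] := det_posdef pS.
Qed.
End QuadraticForms.

(** * Square values of integral polynomials *)

Section ComplexAbs.
Variable R : rcfType.
Implicit Types z w : R[i].

(** The norm on [R[i]] takes its values in [R[i]]; this is the same modulus with values in [R]. *)
Definition cabs z : R := complex.Re `|z|.

Lemma cabsE z : (cabs z)%:C%C = `|z|.
Proof. by rewrite /cabs RRe_real // normr_real. Qed.

Lemma cabsM z w : cabs (z * w) = cabs z * cabs w.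
Proof. by apply: complexI; rewrite rmorphM /= !cabsE normrM. Qed.

Lemma cabsD z w : cabs (z + w) <= cabs z + cabs w.
Proof. by rewrite -lecR rmorphD /= !cabsE ler_normD. Qed.

Lemma cabs_ge0 z : 0 <= cabs z.
Proof. by rewrite -lecR cabsE normr_ge0. Qed.

Lemma cabs_real x : cabs x%:C%C = `|x|.
Proof. by apply: complexI; rewrite cabsE normc_def /= expr0n addr0 sqrtr_sqr. Qed.

Lemma cabs1 : cabs 1 = 1.
Proof. by apply: complexI; rewrite cabsE normr1. Qed.

Lemma cabs0 : cabs 0 = 0.
Proof. by apply: complexI; rewrite cabsE normr0. Qed.

Lemma cabs_eq0 z : (cabs z == 0) = (z == 0).
Proof. by rewrite -[RHS]normr_eq0 -cabsE (inj_eq (@complexI R)). Qed.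

Lemma cabs_gt0 z : (0 < cabs z) = (z != 0).
Proof. by rewrite lt_def cabs_eq0 cabs_ge0 andbT. Qed.

Lemma cabsV z : cabs z^-1 = (cabs z)^-1.
Proof. by apply: complexI; rewrite fmorphV /= !cabsE normfV. Qed.

Lemma cabsX z k : cabs (z ^+ k) = cabs z ^+ k.
Proof. by apply: complexI; rewrite rmorphXn /= !cabsE normrX. Qed.

Lemma cabsJ z : cabs z^*%C = cabs z.
Proof. by apply: complexI; rewrite !cabsE normcJ. Qed.

Lemma cabs_prod (I : Type) (r : seq I) (P : pred I) (F : I -> R[i]) :
  cabs (\prod_(i <- r | P i) F i) = \prod_(i <- r | P i) cabs (F i).
Proof. exact: (big_morph cabs cabsM cabs1). Qed.

Lemma cabs_sum (I : Type) (r : seq I) (P : pred I) (F : I -> R[i]) :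
  cabs (\sum_(i <- r | P i) F i) <= \sum_(i <- r | P i) cabs (F i).
Proof.
elim/big_rec2: _ => [|i x y _ le]; first by rewrite cabs0.
by apply: le_trans (cabsD _ _) _; rewrite lerD2l.
Qed.

Lemma sqr_cabs z : (cabs z ^+ 2)%:C%C = z * z^*%C.
Proof. by rewrite rmorphXn /= cabsE sqr_normc. Qed.

Lemma ler_cabs_Re z : `|complex.Re z| <= cabs z.
Proof. by rewrite -lecR cabsE normc_ge_Re. Qed.

End ComplexAbs.

(** * Polynomial approximation of square roots *)

Section SquareRootApproximation.
Variable R : archiRcfType.

(** A factor 1 + wX with |w| at most 1 at most doubles the largest coefficient. *)
Lemma coef_prod_bound (I : Type) (r : seq I) (w : I -> R[i]) :
  (forall i, cabs (w i) <= 1) ->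
  forall j, cabs (\prod_(i <- r) (1 + (w i) *: 'X))`_j <= 2 ^+ size r.
Proof.
move=> w1; elim: r => [|i r IHr] j.
  rewrite big_nil coef1; case: j => [|j] /=; rewrite ?cabs1 ?cabs0; lra.
rewrite big_cons mulrDl mul1r coefD -scalerAl coefZ coefXM /= exprS.
apply: le_trans (cabsD _ _) _; rewrite cabsM.
have := IHr j; have wi := w1 i; have w0 := cabs_ge0 (w i).
set P := \prod_(_ <- _) _.
have P0 k := cabs_ge0 P`_k.
case: j => [|j] /=; first by rewrite cabs0 mulr0 => H; have := P0 0%N; lra.
move=> H1; have H2 := IHr j; rewrite -/P in H2.
have := P0 j; nra.
Qed.

Lemma horner_bound (p : {poly R}) k N (A x : R) : (size p <= N)%N ->
  (forall j, `|p`_j| <= A) -> (forall j, (j < k)%N -> p`_j = 0) -> `|x| <= 1 ->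
  `|p.[x]| <= N%:R * A * `|x| ^+ k.
Proof.
move=> sp pA p0 x1; rewrite (horner_coef_wide _ sp).
apply: le_trans (ler_norm_sum _ _ _) _.
have A0 : 0 <= A by apply: le_trans (pA 0%N).
apply: le_trans (_ : \sum_(i < N) A * `|x| ^+ k <= _).
  apply: ler_sum => i _; rewrite normrM normrX.
  have [lt_ik|le_ki] := ltnP i k.
    by rewrite p0 // normr0 mul0r mulr_ge0 ?exprn_ge0.
  by apply: ler_pM; rewrite ?exprn_ge0 // ler_wiXn2l.
by rewrite sumr_const card_ord -mulrA mulr_natl.
Qed.

(* Taylor polynomials of the square root, with coefficients bounded in terms
   of those of the radicand. *)
Lemma sqrt_poly k (B : R) : exists A : R, forall G : {poly R},
  G`_0 = 1 -> (forall i, `|G`_i| <= B) ->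
  exists Q : {poly R}, [/\ (size Q <= k.+1)%N, Q`_0 = 1, (forall i, `|Q`_i| <= A) &
    forall j, (j <= k)%N -> (Q ^+ 2 - G)`_j = 0].
Proof.
elim: k => [|k [A IHk]].
  exists 1 => G G0 GB; exists 1; split.
  - by rewrite size_poly1.
  - by rewrite coef1.
  - by move=> i; rewrite coef1; case: (i == _); rewrite ?normr1 ?normr0 //; lra.
  - by case=> // _; rewrite expr1n coefB coef1 G0 subrr.
pose A' := k.+2%:R * `|A| ^+ 2 + `|B|.
exists (`|A| + A') => G G0 GB; have [Q [sQ Q0 QA HQ]] := IHk G G0 GB.
(* The next coefficient to cancel. Subtracting (c/2) X^(k+1) from [Q] does so because the constant
   term of [Q] is 1, and lower degrees are untouched. *)
pose c := (Q ^+ 2 - G)`_k.+1.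
have cA' : `|c| <= A'.
  rewrite /c coefB; apply: le_trans (ler_normB _ _) _; apply: lerD; last first.
    by apply: le_trans (GB _) (ler_norm _).
  rewrite expr2 coefM; apply: le_trans (ler_norm_sum _ _ _) _.
  apply: le_trans (_ : \sum_(i < k.+2) `|A| ^+ 2 <= _); last first.
    by rewrite sumr_const card_ord mulr_natl.
  apply: ler_sum => i _; rewrite normrM expr2.
  by apply: ler_pM => //; apply: le_trans (QA _) (ler_norm _).
have A'0 : 0 <= A' by apply: le_trans cA'.
exists (Q - (c / 2) *: 'X^(k.+1)); split.
- rewrite (leq_trans (size_polyD _ _)) // geq_max size_polyN.
  rewrite (leq_trans (size_scale_leq _ _)) ?size_polyXn // andbT.
  by rewrite ltnW.
- by rewrite coefB coefZ coefXn mulr0 subr0.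
- move=> i; rewrite coefB coefZ coefXn.
  apply: le_trans (ler_normB _ _) _; apply: lerD.
    by apply: le_trans (QA _) (ler_norm _).
  by case: (i == _); rewrite ?mulr1 ?mulr0 ?normr0 // normrM [`|2^-1|]gtr0_norm; lra.
move=> j le_jk; have Dc : c = (c / 2) * 2 by rewrite mulfVK ?pnatr_eq0.
set a := c / 2 in Dc *; clearbody a.
have -> : (Q - a *: 'X^(k.+1)) ^+ 2 - G =
  (Q ^+ 2 - G) - c *: (Q * 'X^(k.+1)) + (a ^+ 2) *: ('X^(k.+1) * 'X^(k.+1)).
  by rewrite Dc -!mul_polyC polyCM expr2 polyCM; ring.
rewrite coefD coefB !coefZ !coefMXn coefXn.
case: ltngtP le_jk => // [lt_jk _|-> _]; first by rewrite !mulr0 subr0 addr0 HQ.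
by rewrite subnn Q0 mulr1 -/c subrr add0r ltn_eqF ?mulr0.
Qed.
(** Near 0 both [Q] and [G] are at least 1/2, and s - Q(x) is (G(x) - Q(x)^2) / (s + Q(x)), whose
    numerator vanishes to order [k.+1] at 0. The constant is chosen before [G]. *)
Lemma sqrt_approx n k (B : R) : exists2 C : R, 1 <= C & forall G : {poly R},
  (size G <= n.+1)%N -> G`_0 = 1 -> (forall i, `|G`_i| <= B) ->
  exists2 Q : {poly R}, (size Q <= k.+1)%N &
    forall x s, `|x| <= C^-1 -> 0 <= s -> s ^+ 2 = `|G.[x]| ->
      `|s - Q.[x]| <= C * `|x| ^+ k.+1.
Proof.
have [A AP] := sqrt_poly k B.
(* [N] is at least the sizes of [G], [Q] and [Q ^+ 2]; [A1] bounds the coefficients of [Q] and [G],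
   and [A2] those of [Q ^+ 2 - G]. *)
pose N := (k + k + n).+2.
have nN : (n.+1 <= N)%N by rewrite /N; lia.
have kN : (k.+1 <= N)%N by rewrite /N; lia.
have kkN a : (a <= k.+1 -> (a + a).-1 <= N)%N by rewrite /N; lia.
pose A1 := 1 + `|A| + `|B|.
pose A2 := N%:R * A1 ^+ 2 + `|B|.
have A1ge : 1 <= A1 by rewrite /A1 -addrA lerDl addr_ge0.
have N1 : 1 <= N%:R :> R by rewrite ler1n.
have A2ge : 1 <= A2.
  by rewrite /A2 -[leLHS]addr0 lerD // -[leLHS]mulr1 ler_pM // ?ler01 // exprn_ege1.
exists (2 * N%:R * A1 + 2 * N%:R * A2); first by nra.
set C := 2 * _ * _ + _ => G sG G0 GB; have [Q [sQ Q0 QA HQ]] := AP G G0 GB.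
exists Q => // x s xC s0 Ds.
have C1 : 1 <= C by rewrite /C; nra.
have Cx : C * `|x| <= 1 by rewrite mulrC -ler_pdivlMr ?div1r //; lra.
have x0 : 0 <= `|x| by [].
have x1 : `|x| <= 1 by nra.
have near1 (p : {poly R}) : (size p <= N)%N -> p`_0 = 1 -> (forall i, `|p`_i| <= A1) ->
    2^-1 <= p.[x].
  move=> sp p0 pA.
  have : `|(p - 1).[x]| <= N%:R * A1 * `|x| ^+ 1.
    apply: horner_bound => //.
    - by rewrite (leq_trans (size_polyD _ _)) // size_polyN size_poly1 geq_max sp.
    - move=> [|j]; rewrite coefB coef1 ?p0 ?subrr ?normr0 ?subr0 //; lra.
    - by case=> // _; rewrite coefB coef1 p0 subrr.
  rewrite expr1 hornerD hornerN hornerC => H.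
  have : N%:R * A1 * `|x| <= 2^-1 by rewrite /C in Cx; nra.
  by move: H; rewrite ler_norml => /andP[]; lra.
have Qx : 2^-1 <= Q.[x].
  apply: near1 => // [|i]; first exact: leq_trans kN.
  by apply: le_trans (QA i) _; rewrite /A1; have := ler_norm A; have := normr_ge0 B; lra.
have Gx : 2^-1 <= G.[x].
  apply: near1 => // [|i]; first exact: leq_trans nN.
  by apply: le_trans (GB i) _; rewrite /A1; have := ler_norm B; have := normr_ge0 A; lra.
have HE : `|(Q ^+ 2 - G).[x]| <= N%:R * A2 * `|x| ^+ k.+1.
  apply: horner_bound => // [|j].
    rewrite (leq_trans (size_polyD _ _)) // size_polyN geq_max.
    rewrite (leq_trans sG nN) andbT expr2.
    exact: leq_trans (size_polyMleq _ _) (kkN _ sQ).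
  rewrite coefB; apply: le_trans (ler_normB _ _) _; apply: lerD; last first.
    by apply: le_trans (GB _) (ler_norm _).
  have A10 : 0 <= A1 by lra.
  have [le_Nj|lt_jN] := leqP N j.
    rewrite nth_default ?normr0 ?mulr_ge0 ?sqr_ge0 //.
    rewrite expr2; apply: leq_trans (size_polyMleq _ _) _; apply: leq_trans le_Nj.
    exact: kkN sQ.
  rewrite expr2 coefM; apply: le_trans (ler_norm_sum _ _ _) _.
  apply: le_trans (_ : \sum_(i < j.+1) A1 ^+ 2 <= _).
    apply: ler_sum => i _; rewrite normrM expr2.
    have QA1 m : `|Q`_m| <= A1.
      by apply: le_trans (QA m) _; rewrite /A1; have := ler_norm A; have := normr_ge0 B; lra.
    by apply: ler_pM.
  rewrite sumr_const card_ord -[leLHS]mulr_natl ler_wpM2r ?sqr_ge0 //.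
  by rewrite ler_nat.
move: HE; rewrite hornerD hornerN horner_exp.
rewrite gtr0_norm in Ds; last by lra.
rewrite -Ds -[_ - s ^+ 2]opprB normrN subr_sqr normrM => HE.
have sQ2 : 2^-1 <= `|s + Q.[x]| by rewrite ger0_norm; lra.
have d0 : 0 <= `|s - Q.[x]| by [].
have t0 : 0 <= `|x| ^+ k.+1 by rewrite exprn_ge0.
have : `|s - Q.[x]| / 2 <= N%:R * A2 * `|x| ^+ k.+1 by nra.
have : 0 <= N%:R * A1 * `|x| ^+ k.+1 by rewrite !mulr_ge0 //; lra.
by rewrite /C; nra.
Qed.

(** * Lagrange interpolation at integers *)

Definition interpolant k (p y : 'I_k -> R) : {poly R} :=
  \sum_i y i *: \prod_(j | j != i) ((p i - p j)^-1 *: ('X - (p j)%:P)).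

Lemma size_interpolant k (p y : 'I_k -> R) : (size (interpolant p y) <= k)%N.
Proof.
apply: leq_trans (size_sum _ _ _) _; apply/bigmax_leqP => i _.
apply: leq_trans (size_scale_leq _ _) _.
apply: leq_trans (size_prod_leq _ _) _ => /=.
set m := #|_|; have Dm : (m = k.-1)%N.
  by have := cardC1 i; rewrite card_ord => <-; apply: eq_card => j; rewrite !inE.
have k0 : (0 < k)%N by case: k i {p y m Dm} => // -[].
rewrite leq_subLR; apply: (@leq_ltn_trans (\sum_(j | j != i) 2)); last first.
  by rewrite sum_nat_const -/m Dm; move: k0; clear; lia.
apply: leq_sum => j _; apply: leq_trans (size_scale_leq _ _) _.
by rewrite size_XsubC.
Qed.

Lemma horner_interpolant k (p y : 'I_k -> R) x : (interpolant p y).[x] =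
  \sum_i y i * \prod_(j | j != i) ((p i - p j)^-1 * (x - p j)).
Proof.
rewrite horner_sum; apply: eq_bigr => i _; rewrite hornerZ horner_prod.
by congr (_ * _); apply: eq_bigr => j _; rewrite hornerZ hornerXsubC.
Qed.

Lemma interpolant_node k (p y : 'I_k -> R) i : injective p ->
  (interpolant p y).[p i] = y i.
Proof.
move=> injp; rewrite horner_interpolant (bigD1 i) //= big1 ?mulr1.
  rewrite big1 ?addr0 // => l ne_li.
  by rewrite (bigD1 i) 1?eq_sym //= subrr mulr0 mul0r mulr0.
by move=> j ne_ji; rewrite mulVf // subr_eq0 (inj_eq injp) eq_sym.
Qed.

Lemma interpolant_exact k (p : 'I_k -> R) (Q : {poly R}) : injective p ->
  (size Q <= k)%N -> interpolant p (fun i => Q.[p i]) = Q.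
Proof.
move=> injp sQ; apply/eqP; rewrite -subr_eq0; apply/eqP.
apply: (@roots_geq_poly_eq0 _ _ [seq p i | i <- enum 'I_k]).
- apply/allP => _ /mapP[i _ ->].
  by rewrite rootE hornerD hornerN interpolant_node ?subrr.
- by rewrite map_inj_uniq ?enum_uniq.
rewrite size_map size_enum_ord (leq_trans (size_polyD _ _)) // size_polyN geq_max sQ andbT.
exact: size_interpolant.
Qed.

(* The interpolant takes values with bounded denominators at integers, so it
   cannot approximate an integer without being equal to it. *)
Lemma interpolant_rigid k (p : 'I_k.+1 -> int) (y : int -> int) (Q : {poly R}) (E H : R) t :
  injective p -> (size Q <= k.+1)%N -> 1 <= H -> 0 <= E ->
  (forall i j, `|(p i)%:~R - (p j)%:~R| <= H) ->
  (forall i, `|t%:~R - (p i)%:~R| <= H) ->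
  (forall i, `|(y (p i))%:~R - Q.[(p i)%:~R]| <= E) ->
  `|(y t)%:~R - Q.[t%:~R]| <= E ->
  k.+2%:R * H ^+ (k.+1 * k.+1) * E < 1 ->
  (interpolant (fun i => (p i)%:~R) (fun i => (y (p i))%:~R)).[t%:~R] = (y t)%:~R.
Proof.
move=> injp sQ H1 E0 Hp Ht Ep Et small.
set P := interpolant _ _.
have injpR : injective (fun i => (p i)%:~R : R).
  by move=> i j /eqP; rewrite eqr_int (inj_eq injp) => /eqP.
(* A common denominator: the [i]-th inner product is the denominator of the [i]-th Lagrange
   polynomial. *)
pose d : int := \prod_i \prod_(j | j != i) (p i - p j).
have nzd : d != 0.
  apply/prodf_neq0 => i _; apply/prodf_neq0 => j ne_ji.
  by rewrite subr_eq0 (inj_eq injp) eq_sym.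
have card1 (i : 'I_k.+1) : (#|[pred j | j != i]| = k)%N.
  by have := cardC1 i; rewrite card_ord /= => E1; rewrite -[RHS]E1; apply: eq_card => j; rewrite !inE.
have prodle (i : 'I_k.+1) (f : 'I_k.+1 -> R) :
    (forall j, j != i -> 0 <= f j <= H) -> \prod_(j | j != i) f j <= H ^+ k.
  move=> fH; apply: le_trans (_ : \prod_(j | j != i) H <= _).
    exact: ler_prod.
  by rewrite prodr_const card1.
have dH : `|d%:~R| <= H ^+ (k.+1 * k) :> R.
  rewrite /d rmorph_prod normr_prod /= mulnC exprM.
  apply: le_trans (_ : \prod_(i < k.+1) H ^+ k <= _); last first.
    by rewrite prodr_const card_ord.
  apply: ler_prod => i _; rewrite normr_ge0 /= rmorph_prod normr_prod /=.
  by apply: prodle => j _; rewrite normr_ge0 /= rmorphB /=.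
have [z Dz] : exists z : int, d%:~R * P.[t%:~R] = z%:~R.
  rewrite horner_interpolant mulr_sumr.
  exists (\sum_i (y (p i) * ((\prod_(l | l != i) \prod_(j | j != l) (p l - p j)) *
      \prod_(j | j != i) (t - p j)))).
  rewrite rmorph_sum; apply: eq_bigr => i _; rewrite !rmorphM /= mulrCA; congr (_ * _).
  have -> : \prod_(j | j != i) (((p i)%:~R - (p j)%:~R)^-1 * (t%:~R - (p j)%:~R)) =
      ((\prod_(j | j != i) (p i - p j))%:~R)^-1 * (\prod_(j | j != i) (t - p j))%:~R :> R.
    rewrite big_split /= prodfV !rmorph_prod.
    by congr (_^-1 * _); apply: eq_bigr => j _; rewrite rmorphB.
  rewrite /d (bigD1 i) //= rmorphM /=; set a := \prod_(j | _) (p i - p j).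
  have nza : a%:~R != 0 :> R.
    by rewrite intr_eq0; apply: contraNneq nzd => a0; rewrite /d (bigD1 i) //= -/a a0 mul0r.
  by rewrite mulrACA divff // mul1r.
have LE i : `|\prod_(j | j != i) (((p i)%:~R - (p j)%:~R)^-1 * (t%:~R - (p j)%:~R))| <= H ^+ k :> R.
  rewrite normr_prod; apply: prodle => j ne_ji.
  rewrite normr_ge0 /= normrM normfV -[leRHS]mul1r ler_pM // ?invr_ge0 // invf_le1.
    have : p i - p j != 0 by rewrite subr_eq0 (inj_eq injp) eq_sym.
    rewrite -rmorphB -intr_norm /= -[1]/(1%:~R) ler_int => nz; lia.
  rewrite normr_gt0 subr_eq0 eqr_int (inj_eq injp) eq_sym //.
(* [Q] is its own interpolant, so P - Q interpolates errors of size at most [E]: its [k.+1] terms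
   are at most H^k E each, and the error at [t] adds one more. Multiplication by [d], at most
   H^(k(k+1)), keeps the total below 1. *)
have PE : `|P.[t%:~R] - (y t)%:~R| <= k.+2%:R * H ^+ k * E.
  rewrite -{1}(subrK Q.[t%:~R] P.[t%:~R]) -addrA.
  apply: le_trans (ler_normD _ _) _.
  rewrite -{1}(interpolant_exact injpR sQ) !horner_interpolant -sumrB.
  have Hk : 1 <= H ^+ k by apply: exprn_ege1.
  have -> : k.+2%:R * H ^+ k * E = k.+1%:R * (E * H ^+ k) + H ^+ k * E.
    by rewrite -[k.+2%:R]natr1; ring.
  apply: lerD; last by rewrite distrC (le_trans Et) // ler_peMl.
  apply: le_trans (ler_norm_sum _ _ _) _.
  apply: le_trans (_ : \sum_(i < k.+1) E * H ^+ k <= _); last first.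
    by rewrite sumr_const card_ord mulr_natl.
  apply: ler_sum => i _.
  by rewrite -mulrBl normrM; apply: ler_pM.
apply/eqP; rewrite -subr_eq0.
have : `|d%:~R * (P.[t%:~R] - (y t)%:~R)| < 1.
  rewrite normrM; apply: le_lt_trans small.
  apply: le_trans (ler_pM _ _ dH PE) _ => //.
  by rewrite mulrA mulrCA -exprD ler_wpM2r // ler_wpM2l // ler_weXn2l //; lia.
rewrite mulrBr Dz -rmorphM -rmorphB /= -intr_norm -[1]/(1%:~R) ltr_int.
move=> z0; have {z0} z0 : z - d * y t = 0 by lia.
have /eqP := congr1 (intr : int -> R) z0.
rewrite rmorphB rmorphM /= -Dz -mulrBr mulf_eq0 => /orP[]//.
by rewrite intr_eq0 (negPf nzd).
Qed.

End SquareRootApproximation.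

Lemma size_fibers (T1 T2 : eqType) (f : T1 -> T2) (s : seq T1) (u : seq T2) M :
  (forall t, t \in s -> f t \in u) ->
  (forall b, (size [seq t <- s | f t == b] <= M)%N) -> (size s <= M * size u)%N.
Proof.
elim: u s => [|b u IHu] s su fM.
  by case: s su {fM} => // t s /(_ t); rewrite mem_head => /(_ isT).
rewrite -(count_predC (fun t => f t == b) s) /= mulnS leq_add //.
  by rewrite -size_filter.
rewrite -size_filter; apply: IHu => [t | c].
  rewrite mem_filter /= => /andP[nb st].
  by have := su t st; rewrite inE (negPf nb).
apply: leq_trans (fM c); rewrite !size_filter count_filter.
by apply: sub_count => t /= /andP[].
Qed.

(** * Integers at which a separable polynomial is a square up to sign *)

Section IntegerSquareValues.
Variable R : archiRcfType.

Lemma size_int_interval (s : seq int) (c L : R) : uniq s -> 0 <= L ->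
  (forall t, t \in s -> `|t%:~R - c| <= L) -> (size s)%:R <= 2 * L + 2.
Proof.
move=> us L0 sL; pose a := Num.floor (c - L).
have /andP[a1 a2] := floor_itv (c - L); rewrite -/a intrD in a1 a2.
pose K := Num.truncn (2 * L + 1).
have K0 : 0 <= 2 * L + 1 by lra.
have /andP[K1 K2] := truncn_itv K0; rewrite -/K in K1 K2.
have sub : {subset [seq `|t - a|%N | t <- s] <= iota 0 K.+1}.
  move=> _ /mapP[t st ->]; rewrite mem_iota add0n /=.
  have := sL t st; rewrite ler_norml => /andP[t1 t2].
  have le_at : a <= t by rewrite -(ler_int R) (le_trans a1) //; lra.
  rewrite -(ltr_nat R); apply: le_lt_trans K2.
  rewrite natr_absz ger0_norm ?subr_ge0 // rmorphB /=; lra.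
have um : uniq [seq `|t - a|%N | t <- s].
  rewrite map_inj_in_uniq // => t t' st st'.
  have P u : u \in s -> a <= u.
    by move=> /sL; rewrite ler_norml -(ler_int R) => /andP[u1 _]; apply: le_trans a1 _; lra.
  by have := P _ st; have := P _ st'; lia.
have := uniq_leq_size um sub; rewrite size_map size_iota -(ler_nat R) => H.
by apply: le_trans H _; rewrite -natr1; lra.
Qed.

(** By rigidity all points (t, y) lie on the graph of the polynomial [P] through [n.+1] of them, so
    every t is a root of (P^2 - F)(P^2 + F). This product is nonzero, since a separable polynomial
    of positive degree is not a scalar multiple of a square, and its degree is at most 4n. *)
Lemma square_values_block n (F Q : {poly R}) (s : seq int) (y : int -> int) (E H : R) :
  (0 < n)%N -> size F = n.+1 -> separable_poly F -> uniq s ->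
  (forall t, t \in s -> (y t)%:~R ^+ 2 = `|F.[t%:~R]|) ->
  1 <= H -> 0 <= E -> (forall t t', t \in s -> t' \in s -> `|t%:~R - t'%:~R| <= H) ->
  (size Q <= n.+1)%N ->
  (forall t, t \in s -> `|(y t)%:~R - Q.[t%:~R]| <= E) ->
  n.+2%:R * H ^+ (n.+1 * n.+1) * E < 1 -> (size s <= 4 * n.+1)%N.
Proof.
move=> n0 sF sepF us sqy H1 E0 sH sQ sE small.
have [|lt_ns] := leqP (size s) n.+1; first lia.
pose p (i : 'I_n.+1) := nth 0 s i.
have sp i : p i \in s by rewrite mem_nth // (leq_trans (ltn_ord i)) // ltnW.
have injp : injective p.
  move=> i j /eqP; rewrite nth_uniq //; last 2 first.
  - by rewrite (leq_trans (ltn_ord i)) // ltnW.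
  - by rewrite (leq_trans (ltn_ord j)) // ltnW.
  by move/eqP/val_inj.
pose P := interpolant (fun i => (p i)%:~R : R) (fun i => (y (p i))%:~R).
have sP : (size P <= n.+1)%N by exact: size_interpolant.
have PE t : t \in s -> P.[t%:~R] = (y t)%:~R.
  move=> st; apply: (interpolant_rigid injp sQ H1 E0 _ _ _ _ small).
  - by move=> i j; apply: sH.
  - by move=> i; apply: sH.
  - by move=> i; apply: sE.
  - exact: sE.
have P2F (c : R) : c != 0 -> P ^+ 2 != c *: F.
  move=> nzc; apply/eqP => E2.
  have : separable_poly (P * P).
    by rewrite -expr2 E2 (eqp_separable (eqp_scale F nzc)).
  rewrite separable_mul coprimepp => /and3P[_ _ /eqP s1].
  have := congr1 (fun q : {poly R} => size q) (esym E2); rewrite size_scale // sF expr2.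
  by have := size_polyMleq P P; rewrite s1; lia.
pose W := (P ^+ 2 - F) * (P ^+ 2 + F).
have nzW : W != 0.
  rewrite mulf_neq0 //; first by rewrite subr_eq0 -[F]scale1r P2F ?oner_neq0.
  by rewrite -[F]opprK subr_eq0 -scaleN1r P2F ?oppr_eq0 ?oner_neq0.
have rootsW : all (root W) [seq t%:~R | t <- s].
  apply/allP => _ /mapP[t st ->]; rewrite rootE hornerM !hornerD hornerN horner_exp.
  rewrite PE // sqy // mulf_eq0 subr_eq0 addr_eq0.
  by have [F0|F0] := ger0P F.[t%:~R]; rewrite ?eqxx ?orbT.
have uW : uniq [seq t%:~R : R | t <- s].
  by rewrite map_inj_uniq // => t t' /eqP; rewrite eqr_int => /eqP.
have := max_poly_roots nzW rootsW uW; rewrite size_map => lt_sW.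
suff : (size W <= (4 * n.+1).+1)%N by move=> /(leq_trans lt_sW).
have sP2 (c : {poly R}) : (size c <= n.+1 -> size (P ^+ 2 + c)%R <= n + n.+1)%N.
  move=> sc; apply: leq_trans (size_polyD _ _) _; rewrite geq_max expr2.
  rewrite (leq_trans sc) ?leq_addl // andbT.
  apply: leq_trans (size_polyMleq _ _) _; move: (size P) sP => k; lia.
apply: leq_trans (size_polyMleq _ _) _.
have h1 : (size (P ^+ 2 - F)%R <= n + n.+1)%N by apply: sP2; rewrite size_polyN sF.
have h2 : (size (P ^+ 2 + F)%R <= n + n.+1)%N by apply: sP2; rewrite sF.
by apply: leq_trans (leq_pred _) _; apply: leq_trans (leq_add h1 h2) _; lia.
Qed.

(** [G] is F(t + rX) / F(t), the product of the factors 1 + rX / (t + rho_i). The roots -rho_i are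
    at distance at least r from t, so each factor has a linear coefficient of modulus at most 1, and
    the bound on [G] does not involve [F]. *)
Lemma taylor_scaled n (F : {poly R}) (rho : 'I_n -> R[i]) (t r : R) :
  map_poly (real_complex R) F = \prod_i ('X + (rho i)%:P) -> 0 < r ->
  (forall i, r <= cabs (t%:C%C + rho i)) ->
  exists G : {poly R}, [/\ (size G <= n.+1)%N, G`_0 = 1, 
     forall j, `|G`_j| <= 2 ^+ n &
     forall u, F.[t + r * u] = F.[t] * G.[u]].
Proof.
move=> DF r0 far; pose a i := t%:C%C + rho i.
have nza i : a i != 0 by rewrite -cabs_gt0; exact: lt_le_trans r0 (far i).
pose w i := r%:C%C / a i.
have w1 i : cabs (w i) <= 1.
  rewrite cabsM cabsV cabs_real gtr0_norm // ler_pdivrMr ?mul1r ?far //.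
  by rewrite cabs_gt0.
have Ft : (F.[t])%:C%C = \prod_i a i.
  rewrite -horner_map /= DF horner_prod; apply: eq_bigr => i _.
  by rewrite hornerD hornerX hornerC.
have nzF : F.[t] != 0.
  by rewrite -(inj_eq (@complexI R)) Ft; apply/prodf_neq0 => i _; exact: nza.
pose G := F.[t]^-1 *: (F \Po (r *: 'X + t%:P)).
have DG : map_poly (real_complex R) G = \prod_i (1 + w i *: 'X).
  rewrite /G map_polyZ map_comp_poly DF rmorphD /= map_polyZ map_polyX map_polyC /=.
  rewrite rmorph_prod /= fmorphV /= Ft -mul_polyC -prodfV rmorph_prod /= -big_split /=.
  apply: eq_bigr => i _; rewrite rmorphD /= comp_polyX comp_polyC -addrA -polyCD -/(a i).
  rewrite mulrDr mul_polyC scalerA -polyCM mulVf ?nza // addrC; congr (_ + _ *: _).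
  exact: mulrC.
have nGj j : cabs (map_poly (real_complex R) G)`_j = `|G`_j|.
  by rewrite coef_map cabs_real.
exists G; split.
- rewrite -(size_map_poly (real_complex R)) DG.
  apply: leq_trans (size_prod_leq _ _) _ => /=.
  rewrite cardT size_enum_ord leq_subLR addnS ltnS.
  apply: (@leq_trans (\sum_(i < n) 2)); last by rewrite sum_nat_const card_ord; lia.
  apply: leq_sum => i _; apply: leq_trans (size_polyD _ _) _.
  by rewrite size_poly1 geq_max /= (leq_trans (size_scale_leq _ _)) ?size_polyX.
- apply: complexI; rewrite -[LHS]coef_map DG.
  rewrite -horner_coef0 horner_prod big1 // => i _.
  by rewrite hornerD hornerZ hornerX mulr0 addr0 hornerC.
- move=> j; rewrite -nGj DG -[X in _ ^+ X](size_enum_ord n) -big_enum.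
  exact: coef_prod_bound.
move=> u; rewrite hornerZ mulVKf // horner_comp !hornerE; congr _.[_]; lra.
Qed.

(** Put r = x^(3(n+2)) and let Y be the square root of |F(t0)|, at most x^(2n(n+2)). On a block of
    length x the approximation error is at most C Y (x/r)^(n+1). Rigidity asks that (n+2)
    x^((n+1)^2) times this error be less than 1; the exponents leave a margin x^(2(n+2)), which
    absorbs the constants once x is at least [X]. *)
Lemma far_block_bound n : (0 < n)%N -> exists2 X : R, 1 <= X &
  forall (F : {poly R}) (rho : 'I_n -> R[i]) (x : R) (s : seq int),
  map_poly (real_complex R) F = \prod_i ('X + (rho i)%:P) -> size F = n.+1 ->
  separable_poly F -> X <= x -> uniq s ->
  (forall t, t \in s -> exists y : int, y%:~R ^+ 2 = `|F.[t%:~R]|) ->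
  (forall t i, t \in s -> x ^+ (3 * n.+2) <= cabs (t%:~R%:C%C + rho i) <= x ^+ (4 * n.+2)) ->
  (forall t t', t \in s -> t' \in s -> `|t%:~R - t'%:~R| <= x) ->
  (size s <= 4 * n.+1)%N.
Proof.
move=> n0; have [C C1 CP] := sqrt_approx n n (2 ^+ n : R).
exists (n.+2%:R * C + 1).
  by rewrite lerDr mulr_ge0 // (le_trans ler01).
move=> F rho x s DF sF sepF Xx us sqF farF sx.
have n2 : 1 <= n.+2%:R :> R by rewrite ler1n.
have Cx : n.+2%:R * C < x by apply: lt_le_trans Xx; rewrite ltrDl ltr01.
have C0 : 0 < C by lra.
have x1 : 1 <= x by nra.
have x0 : 0 < x by lra.
have CCx : C <= x by nra.
case: s us sqF farF sx => [|t0 s'] // us sqF farF sx.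
set s := t0 :: s' in us sqF farF sx *.
have st0 : t0 \in s by rewrite mem_head.
pose r := x ^+ (3 * n.+2).
have r0 : 0 < r by rewrite exprn_gt0.
have [i|G [sG G0 GB GF]] := taylor_scaled DF r0 (t := t0%:~R).
  by have /andP[] := farF t0 i st0.
have [Q sQ QP] := CP G sG G0 GB.
(* Only the nonnegative square root is close to [Q], so the sign of [y] is fixed. *)
have sqy t : exists y : int, t \in s -> 0 <= y /\ y%:~R ^+ 2 = `|F.[t%:~R]|.
  case: (boolP (t \in s)) => [st|]; last by exists 0.
  have [y Dy] := sqF t st; exists `|y| => _; split=> //.
  by rewrite intr_norm real_normK ?num_real.
have [y yP] := boolp.choice sqy.
have y0 t : t \in s -> 0 <= (y t)%:~R :> R by move=> /yP[]; rewrite ler0z.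
have yE t st := (yP t st).2.
have nzy0 : 0 < (y t0)%:~R :> R.
  rewrite lt_def y0 // andbT -sqrf_eq0 yE // normr_eq0.
  rewrite -(inj_eq (@complexI R)) -horner_map /= DF horner_prod.
  apply/prodf_neq0 => i _; rewrite hornerD hornerX hornerC -cabs_gt0.
  by have /andP[+ _] := farF t0 i st0; exact: lt_le_trans.
pose Y := (y t0)%:~R : R.
have YB : Y <= x ^+ (2 * n.+2 * n).
  rewrite -(@ler_pXn2r _ 2) ?nnegrE ?exprn_ge0 ?(ltW nzy0) ?(ltW x0) //.
  rewrite yE // -cabs_real -horner_map /= DF horner_prod cabs_prod.
  have -> : (x ^+ (2 * n.+2 * n)) ^+ 2 = (x ^+ (4 * n.+2)) ^+ n.
    by rewrite -!exprM; congr (_ ^+ _); clear; lia.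
  apply: le_trans (_ : \prod_(i < n) x ^+ (4 * n.+2) <= _); last first.
    by rewrite prodr_const card_ord.
  apply: ler_prod => i _; rewrite hornerD hornerX hornerC cabs_ge0.
  by have /andP[] := farF t0 i st0.
pose Q1 := Y *: (Q \Po (r^-1 *: ('X - (t0%:~R)%:P))).
have Q1E t : Q1.[t] = Y * Q.[(t - t0%:~R) / r].
  by rewrite hornerZ horner_comp hornerZ hornerXsubC [_^-1 * _]mulrC.
have sQ1 : (size Q1 <= n.+1)%N.
  apply: leq_trans (size_scale_leq _ _) _.
  apply: leq_trans (size_comp_poly_leq _ _) _.
  have -> : (size (r^-1 *: ('X - (t0%:~R)%:P)) = 2)%N.
    by rewrite size_scale ?invr_eq0 ?gt_eqF // size_XsubC.
  by rewrite [_.-1]/= muln1; case: (size Q) sQ.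
pose E := Y * (C * (x / r) ^+ n.+1).
have E0 : 0 <= E by rewrite !mulr_ge0 ?(ltW nzy0) ?(ltW C0) ?exprn_ge0 ?divr_ge0 // ltW.
have rx : x * x <= r by rewrite -expr2; apply: ler_weXn2l => //; lia.
have small : n.+2%:R * x ^+ (n.+1 * n.+1) * E < 1.
  rewrite /E /r expr_div_n -exprM.
  apply: le_lt_trans (_ : n.+2%:R * C * (x ^+ (n.+1 * n.+1) * x ^+ (2 * n.+2 * n) *
     x ^+ n.+1) / x ^+ (3 * n.+2 * n.+1) < 1).
    have a0 : 0 < x ^+ (n.+1 * n.+1) by rewrite exprn_gt0.
    have b0 : 0 < x ^+ n.+1 by rewrite exprn_gt0.
    have c0 : 0 < (x ^+ (3 * n.+2 * n.+1))^-1 by rewrite invr_gt0 exprn_gt0.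
    move: a0 b0 c0 YB.
    move: (x ^+ (n.+1 * n.+1)) (x ^+ n.+1) (_^-1) (x ^+ (2 * n.+2 * n)) => a b c z a0 b0 c0 Yz.
    have -> : n.+2%:R * a * (Y * (C * (b * c))) = Y * (n.+2%:R * a * C * b * c) by ring.
    have -> : n.+2%:R * C * (a * z * b) * c = z * (n.+2%:R * a * C * b * c) by ring.
    by rewrite ler_wpM2r // !mulr_ge0 // ltW.
  rewrite ltr_pdivrMr ?exprn_gt0 // mul1r -!exprD.
  have -> : (3 * n.+2 * n.+1)%N =
      (n.+1 * n.+1 + 2 * n.+2 * n + n.+1 + 2 * n.+2)%N by clear; lia.
  rewrite [ltRHS]exprD mulrC ltr_pM2l ?exprn_gt0 //; apply: lt_le_trans Cx _.
  by apply: ler_eXnr.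
apply: (square_values_block n0 sF sepF us yE x1 E0 sx sQ1 _ small).
move=> t st; rewrite Q1E.
pose u := (t%:~R - t0%:~R) / r.
have ux : `|u| <= x / r.
  by rewrite normrM normfV [`|r|]gtr0_norm // ler_pM2r ?invr_gt0 // sx.
have uC : `|u| <= C^-1.
  apply: le_trans ux _; rewrite ler_pdivrMr // mulrC ler_pdivlMr //; nra.
have := QP u ((y t)%:~R / Y) uC.
have -> : 0 <= (y t)%:~R / Y by rewrite divr_ge0 ?y0 // ltW.
have nzY : Y != 0 by rewrite gt_eqF.
have FE : F.[t%:~R] = F.[t0%:~R] * G.[u].
  by rewrite -GF /u mulrCA divff ?gt_eqF // mulr1 subrKC.
have -> : ((y t)%:~R / Y) ^+ 2 = `|G.[u]|.
  rewrite expr_div_n !yE // FE normrM mulrC mulKf // -yE // expf_neq0 //.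
move=> /(_ isT erefl) H.
have -> : (y t)%:~R - Y * Q.[u] = Y * ((y t)%:~R / Y - Q.[u]).
  by rewrite mulrBr mulrCA divff // mulr1.
rewrite normrM [`|Y|]gtr0_norm // /E ler_pM2l //; apply: le_trans H _.
rewrite ler_pM2l //; apply: lerXn2r => //; rewrite nnegrE //.
by rewrite divr_ge0 // ltW.
Qed.
Lemma size_filter_all (T : Type) n (P : 'I_n -> pred T) (s : seq T) :
  (size s <= size [seq t <- s | [forall i, P i t]] +
             \sum_i size [seq t <- s | ~~ P i t])%N.
Proof.
elim: s => [|t s IHs] //=.
have [allP|/forallPn[i Pi]] := boolP [forall i, P i t].
  rewrite /= addSn ltnS (leq_trans IHs) // leq_add2l; apply: leq_sum => i _.
  by case: (~~ _) => /=.
rewrite (bigD1 i) //= Pi /= addSn addnS ltnS (leq_trans IHs) // leq_add2l.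
rewrite (bigD1 i) //= leq_add2l; apply: leq_sum => j _.
by case: (~~ _) => /=.
Qed.

(** With T = x^(4(n+2)) the bound reads C T^(1 - 1/(4(n+2))); the parameter x keeps all exponents
    integral. The constant does not depend on [F], whose roots are the -rho_i. *)
Definition square_values_bound n (C : R) := forall (F : {poly R}) (rho : 'I_n -> R[i])
    (x : R) (s : seq int),
  map_poly (real_complex R) F = \prod_i ('X + (rho i)%:P) -> size F = n.+1 ->
  separable_poly F -> 1 <= x -> uniq s ->
  (forall t, t \in s -> exists y : int, y%:~R ^+ 2 = `|F.[t%:~R]|) ->
  (forall t i, t \in s -> cabs (t%:~R%:C%C + rho i) <= x ^+ (4 * n.+2)) ->
  (size s)%:R <= C * x ^+ (4 * n.+2).-1.

(** For x below the threshold [X] the trivial count is enough. Otherwise, points within x^(3(n+2))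
    of some root are counted trivially, as 3(n+2) is less than 4(n+2), and the remaining ones fall
    into O(T/x) blocks of length x with at most 4(n+1) points each. *)
Lemma square_values n : (0 < n)%N -> exists2 C : R, 0 <= C & square_values_bound n C.
Proof.
move=> n0; have [X X1 HX] := far_block_bound n0.
exists (4 * X + n%:R * 4 + (4 * n.+1)%:R * 6); first by rewrite !addr_ge0 ?mulr_ge0 //; lra.
move=> F rho x s DF sF sepF x1 us sqF sT.
have x0 : 0 < x by lra.
pose m := (4 * n.+2)%N; pose W := x ^+ m.-1.
have W1 : 1 <= W by exact: exprn_ege1.
have xm : x ^+ m = x * W by rewrite -exprS.
have near i (s' : seq int) L : uniq s' -> 0 <= L ->
    (forall t, t \in s' -> cabs (t%:~R%:C%C + rho i) <= L) -> (size s')%:R <= 2 * L + 2.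
  move=> us' L0 sL; apply: (@size_int_interval s' (- complex.Re (rho i))) => // t st.
  rewrite opprK; apply: le_trans (sL t st).
  by move: (ler_cabs_Re (t%:~R%:C%C + rho i)); case: (rho i).
pose i0 : 'I_n := Ordinal n0.
have n40 : 0 <= n%:R * 4 * W :> R by rewrite !mulr_ge0 //; lra.
have n60 : 0 <= (4 * n.+1)%:R * 6 * W :> R by rewrite !mulr_ge0 //; lra.
have [lt_xX|le_Xx] := ltP x X.
  have := near i0 s (x ^+ m) us (exprn_ge0 _ (ltW x0)) (fun t st => sT t i0 st).
  rewrite xm -/m -/W => H; apply: le_trans H _.
  rewrite !mulrDl; nra.
pose P i (t : int) := x ^+ (3 * n.+2) <= cabs (t%:~R%:C%C + rho i).
have := size_filter_all P s; set s1 := [seq t <- s | _].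
rewrite -(ler_nat R) natrD natr_sum => le_s; apply: le_trans le_s _.
have us1 : uniq s1 by rewrite filter_uniq.
have nearB : \sum_i (size [seq t <- s | ~~ P i t])%:R <= n%:R * 4 * W.
  apply: le_trans (_ : \sum_(i < n) 4 * W <= _); last first.
    by rewrite sumr_const card_ord -[leLHS]mulr_natl mulrA.
  apply: ler_sum => i _.
  have h : x ^+ (3 * n.+2) <= W by apply: ler_weXn2l => //; rewrite /m; clear; lia.
  have : (size [seq t <- s | ~~ P i t])%:R <= 2 * x ^+ (3 * n.+2) + 2.
    apply: (near i); rewrite ?filter_uniq ?exprn_ge0 ?(ltW x0) // => t.
    by rewrite mem_filter /P -ltNge => /andP[/ltW].
  lra.
pose b (t : int) := Num.floor (t%:~R / x).
have bP t : (b t)%:~R <= t%:~R / x < (b t)%:~R + 1 by have := floor_itv (t%:~R / x); rewrite intrD.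
have farB : (size s1 <= 4 * n.+1 * size (undup [seq b t | t <- s1]))%N.
  apply: (@size_fibers _ _ b) => [t st|c]; first by rewrite mem_undup map_f.
  apply: (HX F rho x) => //; first by rewrite filter_uniq.
  - by move=> t; rewrite !mem_filter => /and3P[_ _]; exact: sqF.
  - move=> t i; rewrite !mem_filter => /and3P[_ /forallP/(_ i) h st].
    by rewrite [X in X && _]h /= sT.
  move=> t t'; rewrite !mem_filter => /andP[/eqP bt _] /andP[/eqP bt' _].
  have /andP[t1 t2] := bP t; have /andP[t3 t4] := bP t'.
  rewrite bt in t1 t2; rewrite bt' in t3 t4.
  rewrite ler_pdivlMr // in t1; rewrite ler_pdivlMr // in t3.
  rewrite ltr_pdivrMr // in t2; rewrite ltr_pdivrMr // in t4.
  by rewrite ler_norml; nra.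
have blocks : (size (undup [seq b t | t <- s1]))%:R <= 6 * W.
  apply: le_trans (_ : 2 * (W + 1) + 2 <= _); last by lra.
  apply: (@size_int_interval _ (- complex.Re (rho i0) / x)); rewrite ?undup_uniq //; first by lra.
  move=> u; rewrite mem_undup => /mapP[t + ->]; rewrite mem_filter => /andP[_ st].
  have /andP[t1 t2] := bP t.
  have : `|t%:~R + complex.Re (rho i0)| <= x * W.
    rewrite -xm; apply: le_trans (sT t i0 st).
    by move: (ler_cabs_Re (t%:~R%:C%C + rho i0)); case: (rho i0).
  rewrite -ler_pdivrMl // => h.
  have {}h : `|t%:~R / x + complex.Re (rho i0) / x| <= W.
    by rewrite -mulrDl normrM normfV [`|x|]gtr0_norm // mulrC.
  by move: h; rewrite mulNr opprK !ler_norml; lra.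
have : (size s1)%:R <= (4 * n.+1)%:R * (size (undup [seq b t | t <- s1]))%:R :> R.
  by rewrite -natrM ler_nat.
have : (4 * n.+1)%:R * (size (undup [seq b t | t <- s1]))%:R <= (4 * n.+1)%:R * (6 * W).
  by rewrite ler_wpM2l.
rewrite -/m -/W; have : 0 <= X * W by rewrite mulr_ge0 //; lra.
by rewrite !mulrDl; lra.
Qed.
End IntegerSquareValues.

(** * Complex embeddings and Gram matrices *)

Lemma rmorphism_of (A B : pzRingType) (f : A -> B) :
  f 1 = 1 -> {morph f : x y / x - y} -> {morph f : x y / x * y} ->
  exists g : {rmorphism A -> B}, g =1 f.
Proof.
move=> f1 fB fM.
pose h1 := GRing.isZmodMorphism.Build A B f fB.
pose h2 := GRing.isMonoidMorphism.Build A B f (f1, fM).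
pose g : {rmorphism A -> B} := HB.pack f h1 h2.
by exists g.
Qed.

Section Embeddings.
Variable R : realType.
Variable K : fieldExtType rat.
Local Notation C := R[i].
Local Notation n := (\dim {:K}).

(** An element with distinct images yields a nonzero Vandermonde determinant; stability under
    complex conjugation makes the Gram matrices below real. *)
Definition is_embeddings (sigma : 'I_n -> {rmorphism K -> C}) :=
  (exists th, injective (fun i => sigma i th)) /\
  forall i, exists j, forall x, (sigma i x)^*%C = sigma j x.

Lemma primitive_element : exists th : K, <<1; th>>%VS = {:K}%VS.
Proof.
exists (separable_generator 1 {:K}).
rewrite -eq_adjoin_separable_generator //; last exact: sub1v.
apply/separableP => y _; apply: pcharf0_separable => p.
by rewrite pchar_lalg pchar_num.
Qed.

(** A primitive element is sent to each complex root of its minimal polynomial. The roots are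
    distinct by separability, and conjugation permutes them because the coefficients are
    rational. *)
Lemma embeddings_exist : exists sigma, is_embeddings sigma.
Proof.
have [th Kth] := primitive_element.
have /polyOver1P[mu Dmu] := minPolyOver 1 th.
have smu : size mu = n.+1.
  rewrite -(size_map_poly (in_alg K)) -Dmu size_minPoly.
  by have := dim_Fadjoin 1 th; rewrite dimv1 muln1 Kth => ->.
have sepmu : separable_poly mu.
  rewrite -(separable_map (in_alg K)) -Dmu.
  have : separable_element 1 th.
    by apply: pcharf0_separable => p; rewrite pchar_lalg pchar_num.
  by [].
have mumon : mu \is monic.
  by rewrite -(map_monic (in_alg K)) -Dmu monic_minPoly.
pose muC := map_poly (ratr : rat -> C) mu.
have [rs Drs] := closed_field_poly_normal muC.
rewrite lead_coef_map (monicP mumon) rmorph1 scale1r in Drs.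
have srs : size rs = n.
  by apply: succn_inj; rewrite -(size_prod_XsubC rs id) -Drs size_map_poly.
have urs : uniq rs by rewrite -separable_prod_XsubC -Drs separable_map.
have lift0 r (q : {poly rat}) : r \in rs ->
    (map_poly (in_alg K) q).[th] = 0 -> (map_poly (ratr : rat -> C) q).[r] = 0.
  move=> rsr q0; have : mu %| q.
    rewrite -(dvdp_map (in_alg K)) -Dmu; apply: minPoly_dvdp; last exact/rootP.
    by apply/polyOver1P; exists q.
  rewrite -(dvdp_map (ratr : {rmorphism rat -> C})) => /dvdpP[u ->].
  rewrite hornerM -/muC Drs horner_prod.
  have -> : \prod_(z <- rs) ('X - z%:P).[r] = 0; last by rewrite mulr0.
  by rewrite (big_rem r) //= hornerXsubC subrr mul0r.
have Kp x : exists p : {poly rat}, x = (map_poly (in_alg K) p).[th].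
  have /Fadjoin_polyP[p /polyOver1P[q ->] ->] : x \in <<1; th>>%VS by rewrite Kth memvf.
  by exists q.
have [p pP] := choice Kp.
have ext i : exists g : {rmorphism K -> C}, g th = nth 0 rs (i : 'I_n).
  have rsi : nth 0 rs i \in rs by rewrite mem_nth ?srs.
  pose f x := (map_poly (ratr : rat -> C) (p x)).[nth 0 rs i].
  have fE x q : (map_poly (in_alg K) q).[th] = x ->
     f x = (map_poly (ratr : rat -> C) q).[nth 0 rs i].
    move=> Dx; apply/eqP; rewrite -subr_eq0 -hornerN -hornerD -rmorphN -rmorphD /=.
    by rewrite lift0 // rmorphB hornerD hornerN -pP Dx subrr.
  have [|||g Dg] := @rmorphism_of K C f.
  - by rewrite (fE 1 1) ?rmorph1 ?hornerC.
  - move=> x y; rewrite (fE _ (p x - p y)).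
      by rewrite rmorphB hornerD hornerN.
    by rewrite rmorphB hornerD hornerN -!pP.
  - move=> x y; rewrite (fE _ (p x * p y)).
      by rewrite rmorphM hornerM.
    by rewrite rmorphM hornerM -!pP.
  by exists g; rewrite Dg (fE _ 'X) map_polyX hornerX.
have [sigma Dsigma] := fin_all_exists ext.
exists sigma; split.
  exists th => i j /=; rewrite !Dsigma => /eqP.
  by rewrite nth_uniq ?srs // => /eqP/val_inj.
move=> i; pose r := (sigma i th)^*%C.
have rr : r \in rs.
  rewrite -root_prod_XsubC -Drs rootE.
  have -> : muC = map_poly conjc muC.
    rewrite /muC -map_poly_comp; apply: eq_map_poly => q /=.
    by rewrite [RHS](_ : _ = conjc (ratr q)) // fmorph_div /= !rmorph_int.
  rewrite horner_map /= fmorph_eq0 Drs; apply/eqP/rootP.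
  by rewrite root_prod_XsubC Dsigma mem_nth ?srs.
have lt_r : (index r rs < n)%N by rewrite -srs index_mem.
exists (Ordinal lt_r) => x; rewrite (pP x).
have sE (g : {rmorphism K -> C}) q : g (map_poly (in_alg K) q).[th] =
    (map_poly (ratr : rat -> C) q).[g th].
  rewrite -horner_map -map_poly_comp; congr _.[_].
  by apply: eq_map_poly => u; exact: (fmorph_eq_rat (g \o in_alg K)).
pose g := (conjc : {rmorphism C -> C}) \o sigma i.
rewrite -[LHS]/(g _) !sE Dsigma /= nth_index //; exact: (sE g).
Qed.
End Embeddings.

Section EmbeddingTheory.
Variable R : realType.
Variable K : fieldExtType rat.
Local Notation C := R[i].
Local Notation n := (\dim {:K}).
Variable sigma : 'I_n -> {rmorphism K -> C}.
Hypothesis sigmaP : is_embeddings sigma.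
Implicit Types (b : 'I_n -> K) (x : K) (w : 'I_n -> R).
Local Notation ratC := (ratr : rat -> C).

Definition emx b : 'M[C]_n := \matrix_(i, j) sigma j (b i).

Lemma sigma_rat j (a : rat) x : sigma j (a *: x) = ratC a * sigma j x.
Proof.
rewrite -mulr_algl rmorphM; congr (_ * _).
exact: (fmorph_eq_rat (sigma j \o in_alg K)).
Qed.

Lemma emx_change b b' (A : 'M[rat]_n) :
  (forall i, b' i = \sum_j A i j *: b j) -> emx b' = map_mx ratC A *m emx b.
Proof.
move=> Db'; apply/matrixP => i j; rewrite !mxE Db' rmorph_sum.
by apply: eq_bigr => k _; rewrite sigma_rat !mxE.
Qed.

(** The matrix of conjugates diagonalizes multiplication by [x]. The expressions of trace, norm and
    characteristic polynomial through conjugates all come from this. *)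
Lemma emx_mul b x (A : 'M[rat]_n) :
  (forall i, b i * x = \sum_j A i j *: b j) ->
  map_mx ratC A *m emx b = emx b *m diag_mx (\row_j sigma j x).
Proof.
move=> DA; rewrite -(emx_change DA); apply/matrixP => i j.
by rewrite !mxE (bigD1 j) //= big1 => [|k /negPf nk];
   rewrite !mxE ?eqxx ?nk ?mulr0n ?mulr0 // mulr1n addr0 rmorphM.
Qed.

Lemma coord_change b : exists A : 'M[rat]_n, forall i, b i = \sum_j A i j *: (vbasis {:K})`_j.
Proof.
exists (\matrix_(i, j) coord (vbasis {:K}) j (b i)) => i.
by rewrite {1}(coord_vbasis (memvf (b i))); apply: eq_bigr => j _; rewrite mxE.
Qed.

(** For the powers of an element with distinct conjugates the matrix is a Vandermonde matrix, and it
    factors through the matrix of the basis. *)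
Lemma emx_vbasis_unit : emx (fun i => (vbasis {:K})`_i) \in unitmx.
Proof.
have [[th inj_th] _] := sigmaP.
have [A DA] := coord_change (fun i : 'I_n => th ^+ i).
have : \det (emx (fun i : 'I_n => th ^+ i)) != 0.
  have -> : emx (fun i : 'I_n => th ^+ i) = Vandermonde n (\row_j sigma j th).
    by apply/matrixP => i j; rewrite !mxE rmorphXn.
  rewrite det_Vandermonde; apply/prodf_neq0 => i _; apply/prodf_neq0 => j lt_ij.
  by rewrite !mxE subr_eq0 (inj_eq inj_th) -val_eqE gtn_eqF.
by rewrite (emx_change DA) det_mulmx mulf_eq0 negb_or unitmxE unitfE => /andP[].
Qed.

Lemma vbasis_mult_mx x (i : 'I_n) : (vbasis {:K})`_i * x =
  \sum_j passmx.mxof (vbasis {:K}) (vbasis {:K}) (amulr x) i j *: (vbasis {:K})`_j.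
Proof.
have -> : (vbasis {:K})`_i * x = amulr x (vbasis {:K})`_i by rewrite lfunE.
rewrite -[LHS](passmx.rVofK (vbasisP {:K})).
rewrite (@passmx.rVof_app _ _ _ _ _ (vbasisP {:K})) passmx.rVofE ?vbasisP // -rowE.
by rewrite /passmx.vecof; apply: eq_bigr => j _; rewrite mxE.
Qed.

Lemma sigma_trace x : ratC (field_trace x) = \sum_j sigma j x.
Proof.
have E := emx_mul (b := fun i => (vbasis {:K})`_i) (vbasis_mult_mx x).
rewrite /field_trace -trace_map_mx.
set A := map_mx _ _ in E *; have u := emx_vbasis_unit.
rewrite -[A](mulmxK u) E mxtrace_mulC mulmxA mulVmx // mul1mx mxtrace_diag.
by apply: eq_bigr => j _; rewrite mxE.
Qed.

Lemma family_disc_emx b : ratC (family_disc b) = \det (emx b) ^+ 2.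
Proof.
rewrite /family_disc -det_map_mx expr2 -{2}(det_tr (emx b)) -det_mulmx; congr (\det _).
apply/matrixP => i j; rewrite !mxE [LHS]sigma_trace; apply: eq_bigr => k _.
by rewrite !mxE rmorphM.
Qed.

Lemma emx_unit b : family_disc b != 0 -> emx b \in unitmx.
Proof.
by rewrite -(fmorph_eq0 (ratr : {rmorphism rat -> C})) /= family_disc_emx expf_eq0 /= unitmxE unitfE.
Qed.

Lemma sigma_norm b x (A : 'M[rat]_n) : family_disc b != 0 ->
  (forall i, b i * x = \sum_j A i j *: b j) -> ratC (\det A) = \prod_j sigma j x.
Proof.
move=> /emx_unit u DA; have E := emx_mul DA.
rewrite -det_map_mx -[map_mx _ _](mulmxK u) E !det_mulmx mulrAC -det_mulmx mulmxV //.
by rewrite det1 mul1r det_diag; apply: eq_bigr => j _; rewrite mxE.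
Qed.

Lemma sigma_char_poly b x (A : 'M[rat]_n) : family_disc b != 0 ->
  (forall i, b i * x = \sum_j A i j *: b j) ->
  map_poly ratC (char_poly A) = \prod_j ('X - (sigma j x)%:P).
Proof.
move=> /emx_unit u DA; have E := emx_mul DA.
rewrite (map_char_poly (ratr : {rmorphism rat -> C})) /= /char_poly.
set B := map_mx _ A in E *.
have uP : map_mx polyC (emx b) \in unitmx by rewrite map_unitmx.
have -> : char_poly_mx B = map_mx polyC (emx b) *m
     char_poly_mx (diag_mx (\row_j sigma j x)) *m invmx (map_mx polyC (emx b)).
  apply: (canRL (mulmxK uP)); rewrite /char_poly_mx mulmxBl mulmxBr -!map_mxM -E.
  by rewrite scalar_mxC.
rewrite !det_mulmx mulrAC -det_mulmx mulmxV // det1 mul1r.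
have -> : char_poly_mx (diag_mx (\row_j sigma j x)) = diag_mx (\row_j ('X - (sigma j x)%:P)).
  apply/matrixP => i j; rewrite !mxE; case: (eqVneq i j) => [->|_]; rewrite ?mulr1n //.
  by rewrite !mulr0n subrr.
by rewrite det_diag; apply: eq_bigr => j _; rewrite mxE.
Qed.

Definition conj_inv w := forall i j, (forall x, (sigma i x)^*%C = sigma j x) -> w i = w j.

Definition eform w x : R := \sum_j w j * cabs (sigma j x) ^+ 2.

(** The real part serves to land in [R]: for conjugation-invariant weights the sum is already real,
    by [gramE]. *)
Definition gram w b : 'M[R]_n :=
  \matrix_(k, l) complex.Re (\sum_j (w j)%:C%C * sigma j (b k) * (sigma j (b l))^*%C).

Lemma eform_ge0 w x : (forall j, 0 <= w j) -> 0 <= eform w x.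
Proof. by move=> w0; apply: sumr_ge0 => j _; rewrite mulr_ge0 ?sqr_ge0. Qed.

(** Conjugation permutes the embeddings and preserves the weights, so it fixes every entry of the
    matrix on the right. *)
Lemma gramE w b : conj_inv w -> map_mx (real_complex R) (gram w b) =
  emx b *m diag_mx (\row_j (w j)%:C%C) *m (map_mx conjc (emx b))^T.
Proof.
move=> cw; have [_ /fin_all_exists[s sP]] := sigmaP.
have injs : injective s.
  move=> i j sij; have [[th inj_th] _] := sigmaP; apply: inj_th => /=.
  by apply: (can_inj (@conjcK R)); rewrite !sP sij.
apply/matrixP => k l; rewrite !mxE.
have DE : (emx b *m diag_mx (\row_j (w j)%:C%C) *m (map_mx conjc (emx b))^T) k l =
   \sum_j (w j)%:C%C * sigma j (b k) * (sigma j (b l))^*%C.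
  rewrite mxE; apply: eq_bigr => j _; rewrite mul_mx_diag !mxE; congr (_ * _).
  exact: mulrC.
move: DE; rewrite mxE => ->; apply: RRe_real.
set S := \sum_j _; apply/CrealP; rewrite -[X in X = _]/(conjc S).
rewrite rmorph_sum [RHS](reindex_inj injs); apply: eq_bigr => j _.
transitivity (((w j)%:C)^*%C * (sigma j (b k))^*%C * ((sigma j (b l))^*%C)^*%C).
  by rewrite -[LHS]/(conjc _) !(rmorphM (conjc : {rmorphism C -> C})).
by rewrite conjc_real !sP -(cw _ _ (sP j)).
Qed.
End EmbeddingTheory.

Section GramTheory.
Variable R : realType.
Variable K : fieldExtType rat.
Local Notation C := R[i].
Local Notation n := (\dim {:K}).
Variable sigma : 'I_n -> {rmorphism K -> C}.
Hypothesis sigmaP : is_embeddings sigma.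
Implicit Types (b : 'I_n -> K) (x : K) (w : 'I_n -> R).
Local Notation rC := (real_complex R).

Lemma qform_gram w b (v : 'rV[R]_n) : conj_inv sigma w ->
  qform (gram sigma w b) v =
  \sum_j w j * cabs ((map_mx rC v *m emx sigma b) 0 j) ^+ 2.
Proof.
move=> cw; apply: (@complexI R); rewrite rmorph_sum /= /qform.
have -> : ((v *m gram sigma w b *m v^T) 0 0)%:C%C =
   (map_mx rC (v *m gram sigma w b *m v^T)) 0 0 by rewrite !mxE.
rewrite !map_mxM (gramE sigmaP b cw) !mulmxA.
set u := map_mx rC v *m _.
have -> : u *m diag_mx (\row_j (w j)%:C%C) *m (map_mx conjc (emx sigma b))^T *m map_mx rC v^T =
    u *m diag_mx (\row_j (w j)%:C%C) *m (map_mx conjc u)^T.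
  rewrite -mulmxA -[map_mx _ v^T]map_trmx -trmx_mul; congr (_ *m _^T).
  rewrite /u (map_mxM (conjc : {rmorphism C -> C})) /=; congr (_ *m _).
  by apply/matrixP => i j; rewrite !mxE /= oppr0.
rewrite mxE; apply: eq_bigr => j _; rewrite mul_mx_diag !mxE rmorphM /= sqr_cabs.
by rewrite mulrCA mulrA.
Qed.

Lemma posdef_gram w b : conj_inv sigma w -> (forall j, 0 < w j) ->
  family_disc b != 0 -> posdef (gram sigma w b).
Proof.
move=> cw w0 nzb; split=> [|v nzv].
  apply: (map_mx_inj (f := rC)).
  rewrite -map_trmx (gramE sigmaP b cw) trmx_mul trmxK trmx_mul tr_diag_mx mulmxA.
  have E : map_mx conjc (map_mx rC (gram sigma w b)) = map_mx rC (gram sigma w b).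
    by apply/matrixP => i j; rewrite !mxE /= oppr0.
  rewrite (gramE sigmaP b cw) in E; rewrite -[RHS]E.
  rewrite !(map_mxM (conjc : {rmorphism C -> C})) /= -[map_mx _ _^T]map_trmx; congr (_ *m _ *m _^T).
    by apply/matrixP => i j; rewrite !mxE rmorphMn /= oppr0.
  by apply/matrixP => i j; rewrite !mxE conjcK.
rewrite qform_gram //; set u := _ *m _.
have nzu : u != 0.
  apply: contraNneq nzv => u0; apply/eqP; apply: (map_mx_inj (f := rC)).
  by rewrite map_mx0 -[LHS](mulmxK (emx_unit sigmaP nzb)) -/u u0 mul0mx.
have [j nzj] : exists j, u 0 j != 0 by apply/rV0Pn.
rewrite (bigD1 j) //= ltr_pwDl ?mulr_gt0 ?exprn_gt0 ?cabs_gt0 //.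
by apply: sumr_ge0 => i _; rewrite mulr_ge0 ?sqr_ge0 // ltW.
Qed.

Lemma det_gram w b : conj_inv sigma w ->
  \det (gram sigma w b) = (\prod_j w j) * `|ratr (family_disc b)|.
Proof.
move=> cw; apply: (@complexI R); rewrite -[LHS](det_map_mx rC) (gramE sigmaP b cw).
rewrite !det_mulmx det_tr det_diag mulrAC mulrC rmorphM /=; congr (_ * _).
  by rewrite rmorph_prod; apply: eq_bigr => j _; rewrite mxE.
rewrite (det_map_mx (conjc : {rmorphism C -> C})) -sqr_cabs -cabsX.
rewrite -(family_disc_emx sigmaP) -cabs_real; congr ((cabs _)%:C)%C.
by rewrite -(fmorph_eq_rat (rC \o ratr)).
Qed.

Definition zcomb b (z : 'I_n -> int) : K := \sum_i b i *~ z i.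

Lemma qform_gram_int w b (z : 'rV[int]_n) : conj_inv sigma w ->
  qform (gram sigma w b) (map_mx intr z) = eform sigma w (zcomb b (z 0)).
Proof.
move=> cw; rewrite qform_gram //; apply: eq_bigr => j _; congr (_ * cabs _ ^+ 2).
rewrite mxE rmorph_sum; apply: eq_bigr => i _; rewrite !mxE [RHS]rmorphMz.
by rewrite -[RHS]mulrzr [RHS]mulrC; congr (_ * _); rewrite -[LHS]/(rC _) rmorph_int.
Qed.

Lemma gram_diag w b j : conj_inv sigma w -> gram sigma w b j j = eform sigma w (b j).
Proof.
move=> cw; rewrite -qform_delta.
have -> : 'e_j = map_mx intr ('e_j : 'rV[int]_n) :> 'rV[R]_n by rewrite map_delta_mx.
rewrite qform_gram_int //; congr eform; rewrite /zcomb (bigD1 j) //= big1.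
  by rewrite !mxE !eqxx addr0.
by move=> k /negPf nk; rewrite !mxE nk andbF.
Qed.

Lemma coord_bound w b (z : 'I_n -> int) i : conj_inv sigma w -> (forall j, 0 < w j) ->
  family_disc b != 0 ->
  (z i)%:~R ^+ 2 * ((\prod_j w j) * `|ratr (family_disc b)|) * eform sigma w (b i) <=
  eform sigma w (zcomb b z) * \prod_j eform sigma w (b j).
Proof.
move=> cw w0 nzb; have pG := posdef_gram cw w0 nzb.
have := posdef_coord (map_mx intr (\row_i z i)) i pG.
rewrite gram_diag // det_gram // qform_gram_int //.
rewrite (eq_bigr _ (fun j _ => gram_diag b j cw)) !mxE.
by congr (_ <= eform _ _ _ * _); apply: eq_bigr => j _; rewrite mxE.
Qed.

Lemma hadamard_eform w b : conj_inv sigma w -> (forall j, 0 < w j) ->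
  family_disc b != 0 ->
  (\prod_j w j) * `|ratr (family_disc b)| <= \prod_j eform sigma w (b j).
Proof.
move=> cw w0 nzb; have /det_posdef/andP[_] := posdef_gram cw w0 nzb.
by rewrite det_gram // (eq_bigr _ (fun j _ => gram_diag b j cw)).
Qed.

Lemma reduced_basis w b : conj_inv sigma w -> (forall j, 0 < w j) ->
  family_disc b != 0 -> exists2 U : 'M[int]_n, U \in unitmx &
  \prod_i eform sigma w (zcomb b (U i)) <=
  (4 / 3) ^+ (n * n) * ((\prod_j w j) * `|ratr (family_disc b)|).
Proof.
move=> cw w0 nzb; have [U uU leU] := hermite_reduction (posdef_gram cw w0 nzb).
exists U => //; rewrite -det_gram //; apply: le_trans leU.
apply: ler_prod => i _; rewrite eform_ge0 => [|j]; last exact: ltW.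
rewrite congr_diag -map_row qform_gram_int // le_eqVlt; apply/orP; left.
by apply/eqP; congr eform; apply: eq_bigr => j _; rewrite mxE.
Qed.
End GramTheory.

(** * Ideals with a principal square *)

Section Norm.
Variable K : fieldExtType rat.
Local Notation n := (\dim {:K}).
Local Notation OK := (ring_of_integers K).
Implicit Types (b : 'I_n -> K) (x y : K).

Definition field_norm x : rat :=
  \det (passmx.mxof (vbasis {:K}) (vbasis {:K}) (amulr x)).

Lemma basis_mult_mx b x : family_disc b != 0 ->
  exists A : 'M[rat]_n, forall i, b i * x = \sum_j A i j *: b j.
Proof.
move=> nzb; have bB := family_disc_basis nzb.
exists (\matrix_(i, j) coord [tuple b i | i < n] j (b i * x)) => i.
rewrite {1}(coord_basis bB (memvf (b i * x))); apply: eq_bigr => j _.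
by rewrite mxE nth_mktuple.
Qed.

Section WithEmbeddings.
Variables (R : realType) (sigma : 'I_n -> {rmorphism K -> R[i]}).
Hypothesis sigmaP : is_embeddings sigma.

Lemma sigma_field_norm x : ratr (field_norm x) = \prod_j sigma j x.
Proof.
exact: (sigma_norm sigmaP (family_disc_vbasis K) (vbasis_mult_mx x)).
Qed.

Lemma field_norm_mxE b x (A : 'M[rat]_n) : family_disc b != 0 ->
  (forall i, b i * x = \sum_j A i j *: b j) -> \det A = field_norm x.
Proof.
move=> nzb DA; apply: (fmorph_inj (ratr : {rmorphism rat -> R[i]})) => /=.
by rewrite (sigma_norm sigmaP nzb DA) sigma_field_norm.
Qed.

Lemma field_normM x y : field_norm (x * y) = field_norm x * field_norm y.
Proof.
apply: (fmorph_inj (ratr : {rmorphism rat -> R[i]})); rewrite rmorphM /= !sigma_field_norm.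
by rewrite -big_split; apply: eq_bigr => j _; rewrite rmorphM.
Qed.

Lemma field_norm_eq0 x : (field_norm x == 0) = (x == 0).
Proof.
rewrite -(fmorph_eq0 (ratr : {rmorphism rat -> R[i]})) /= sigma_field_norm.
apply/eqP/eqP => [/eqP|->].
  by rewrite prodf_seq_eq0 => /hasP[j _]; rewrite /= fmorph_eq0 => /eqP.
have n0 : (0 < n)%N by rewrite adim_gt0.
by rewrite (bigD1 (Ordinal n0)) //= rmorph0 mul0r.
Qed.

Lemma abs_field_norm x : `|ratr (field_norm x)| = \prod_j cabs (sigma j x) :> R.
Proof.
rewrite -cabs_prod -sigma_field_norm -cabs_real; congr cabs.
by rewrite -(fmorph_eq_rat (real_complex R \o ratr)).
Qed.

Lemma int_mult_mx b x : integral_basis b -> OK x ->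
  exists2 Z : 'M[int]_n, (forall i, b i * x = zcomb b (Z i)) &
    (\det Z)%:~R = field_norm x.
Proof.
move=> bP Ox; have [_ bI] := bP.
have /choice[z zP] (i : 'I_n) : exists z : 'I_n -> int, b i * x = zcomb b z.
  by apply/bI/OK_mul => //; exact: integral_basis_OK.
exists (\matrix_(i, j) z i j).
  by move=> i; rewrite zP; apply: eq_bigr => j _; rewrite mxE.
rewrite -det_map_mx; apply: field_norm_mxE (integral_basis_disc_neq0 bP) _ => i.
by rewrite zP; apply: eq_bigr => j _; rewrite !mxE scaler_int.
Qed.

Lemma field_norm_int x : OK x -> exists k : int, field_norm x = k%:~R.
Proof.
have [b bP] := integral_basis_ex K.
by move=> /(int_mult_mx bP)[Z _ <-]; exists (\det Z).
Qed.

(** For the integral matrix Z of multiplication by [x], det(1 + XZ) is an integral polynomial with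
    value 1 at 0; it is evaluated at [p]. *)
Lemma field_norm_cong1 x (p : nat) : OK x ->
  exists k : int, field_norm (1 + x *+ p) = (1 + k * p%:Z)%:~R.
Proof.
have [b bP] := integral_basis_ex K.
move=> /(int_mult_mx bP)[Z ZP _].
have D : field_norm (1 + x *+ p) = (\det (1%:M + p%:Z *: Z))%:~R.
  rewrite -det_map_mx; apply/esym/(field_norm_mxE (integral_basis_disc_neq0 bP)) => i.
  rewrite mulrDr mulr1 mulrnAr ZP.
  rewrite (eq_bigr (fun j => ((i == j)%:R : rat) *: b j + b j *~ Z i j *+ p)).
    rewrite big_split /= sumrMnl; congr (_ + _).
    rewrite (bigD1 i) //= eqxx scale1r big1 ?addr0 //.
    by move=> j /negPf nj; rewrite eq_sym nj scale0r.
  move=> j _; rewrite !mxE -scaler_int rmorphD rmorphM /= scalerDl.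
  congr (_ + _); first by case: (_ == _).
  by rewrite -scalerA [LHS]scaler_int.
rewrite D.
suff [k Dk] : exists k : int, \det (1%:M + p%:Z *: Z) = 1 + k * p%:Z by exists k; rewrite Dk.
pose q := \det (1%:M + 'X *: map_mx polyC Z : 'M[{poly int}]_n).
have Dq : \det (1%:M + p%:Z *: Z) = q.[p%:Z].
  rewrite -[q.[_]]/(horner_eval p%:Z q) -det_map_mx; congr (\det _).
  apply/matrixP => i j; rewrite !mxE /= /horner_eval !hornerE.
  by case: (_ == _); rewrite !hornerE.
have q0 : q.[0] = 1.
  rewrite -[q.[_]]/(horner_eval 0 q) -det_map_mx -[RHS](det1 _ n); congr (\det _).
  apply/matrixP => i j; rewrite !mxE /= /horner_eval !hornerE.
  by case: (_ == _); rewrite !hornerE.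
have : root (q - 1) 0 by rewrite rootE !hornerE q0 subrr.
move=> /factor_theorem[u Du]; exists u.[p%:Z].
by rewrite Dq -(subrK 1 q) Du !hornerE ?subr0 ?oppr0 ?addr0 addrC.
Qed.
End WithEmbeddings.
End Norm.

(** * Local generators of an ideal with principal square *)

Section LocalPrincipal.
Variable K : fieldExtType rat.
Local Notation n := (\dim {:K}).
Local Notation OK := (ring_of_integers K).
Implicit Types (x y u : K).

Lemma OKN x : OK x -> OK (- x).
Proof. by move=> Ox; rewrite -mulN1r; apply: OK_mul => //; rewrite -[-1]/(1 *~ -1); apply: OK_mulrz; exact: OK1. Qed.

Lemma OKB x y : OK x -> OK y -> OK (x - y).
Proof. by move=> Ox Oy; apply: OK_add => //; exact: OKN. Qed.

Lemma OKX x k : OK x -> OK (x ^+ k).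
Proof.
by move=> Ox; elim: k => [|k IHk]; [exact: OK1 | rewrite exprS; exact: OK_mul].
Qed.

Variable p : nat.
Hypothesis p_gt0 : (0 < p)%N.

Definition pmul x := exists2 z, OK z & x = z *+ p.

Lemma pmul0 : pmul 0.
Proof. by exists 0; [exact: OK0 | rewrite mul0rn]. Qed.

Lemma pmulD x y : pmul x -> pmul y -> pmul (x + y).
Proof.
by move=> [z Oz ->] [t Ot ->]; exists (z + t); [exact: OK_add | rewrite mulrnDl].
Qed.

Lemma pmulM x y : OK x -> pmul y -> pmul (x * y).
Proof. by move=> Ox [z Oz ->]; exists (x * z); [exact: OK_mul | rewrite mulrnAr]. Qed.

Lemma pmulN x : pmul x -> pmul (- x).
Proof. by move=> [z Oz ->]; exists (- z); [exact: OKN | rewrite mulNrn]. Qed.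

(** Coordinates modulo [p] on an integral basis take finitely many values. *)
Lemma pigeonhole_powers u : OK u ->
  exists i d, (0 < d)%N /\ pmul (u ^+ (i + d) - u ^+ i).
Proof.
move=> Ou; have [b bP] := integral_basis_ex K; have [_ bI] := bP.
have /choice[z zP] (k : nat) : exists z : 'I_n -> int, u ^+ k = \sum_i b i *~ z i.
  by apply/bI; exact: OKX.
have ltp (k : nat) (i : 'I_n) : (`|(z k i %% p)%Z| < p)%N.
  by have := ltz_pmod (z k i) (_ : 0 < p%:Z); have := modz_ge0 (z k i) (_ : p%:Z != 0); lia.
pose M := #|{ffun 'I_n -> 'I_p}|.
pose f (k : 'I_M.+1) : {ffun 'I_n -> 'I_p} := [ffun i => Ordinal (ltp k i)].
have [injf|] := boolP (injectiveb f).
  by have := leq_card f (injectiveP _ injf); rewrite card_ord ltnn.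
have key (k l : 'I_M.+1) : f k = f l -> pmul (u ^+ l - u ^+ k).
  move=> /ffunP fkl; pose q i := ((z l i - z k i) %/ p)%Z.
  exists (\sum_i b i *~ q i); first by apply: OK_sum; exact: integral_basis_OK.
  rewrite !zP -sumrB -sumrMnl; apply: eq_bigr => i _.
  rewrite -mulrzBr -[LHS]/(_ *~ _) pmulrn -mulrzA; congr (_ *~ _).
  have /(congr1 val) := fkl i; rewrite !ffunE /= => E; apply/esym/divzK.
  have := modz_ge0 (z k i) (_ : p%:Z != 0); have := modz_ge0 (z l i) (_ : p%:Z != 0).
  have := divz_eq (z k i) p; have := divz_eq (z l i) p => E1 E2 h1 h2.
  apply/dvdzP; exists ((z l i %/ p)%Z - (z k i %/ p)%Z); lia.
move=> /injectivePn[k [l nkl fkl]].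
wlog lt_kl : k l nkl fkl / (k < l)%N.
  move=> H; have [lt_kl|lt_lk|/val_inj E] := ltngtP k l.
  - exact: (H k l).
  - by apply: (H l k) => //; rewrite eq_sym.
  - by rewrite E eqxx in nkl.
exists k, (l - k)%N; rewrite subn_gt0; split=> //.
by rewrite subnKC ?(ltnW lt_kl) //; exact: key.
Qed.

(** The exponent is a multiple of the period [d] and at least the preperiod [i], so doubling it
    changes nothing modulo [p]; [i.+1] in place of [i] keeps it positive. *)
Lemma idempotent_power u : OK u -> exists2 N, (0 < N)%N & pmul (u ^+ N * u ^+ N - u ^+ N).
Proof.
move=> Ou; have [i [d [d0 Hi]]] := pigeonhole_powers Ou.
have Hm m : (i <= m)%N -> pmul (u ^+ (m + d) - u ^+ m).
  move=> le_im; rewrite -(subnK le_im) -addnA.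
  rewrite (exprD u (m - i) (i + d)) (exprD u (m - i) i) -mulrBr.
  by apply: pmulM => //; exact: OKX.
have Hk m k : (i <= m)%N -> pmul (u ^+ (m + k * d) - u ^+ m).
  move=> le_im; elim: k => [|k IHk]; first by rewrite mul0n addn0 subrr; exact: pmul0.
  have := pmulD (Hm (m + k * d)%N (leq_trans le_im (leq_addr _ _))) IHk.
  by rewrite addrA subrK mulSn -addnA [(k * d + d)%N]addnC.
exists (i.+1 * d)%N; first by rewrite muln_gt0.
by rewrite -exprD; apply: Hk; rewrite (leq_trans (leqnSn i)) // leq_pmulr.
Qed.

Lemma nilpotentD x y k l : OK x -> OK y -> pmul (x ^+ k) -> pmul (y ^+ l) ->
  pmul ((x + y) ^+ (k + l)).
Proof.
move=> Ox Oy xk yl; rewrite exprDn.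
elim/big_ind: _ => [||i _]; [exact: pmul0 | exact: pmulD |].
rewrite -mulr_natl; apply: pmulM.
  by rewrite pmulrn; apply: OK_mulrz; exact: OK1.
have [le_li|lt_il] := leqP l i.
  rewrite -(subnK le_li) exprD mulrA; apply: pmulM => //.
  by apply: OK_mul; exact: OKX.
have le_k : (k <= k + l - i)%N by lia.
rewrite -(subnK le_k) exprD mulrAC; apply: pmulM => //.
by apply: OK_mul; exact: OKX.
Qed.

Variables (I : set K) (beta : K).
Hypotheses (nzb : beta != 0) (ID : forall x y, I x -> I y -> I (x + y))
  (IM : forall a x, OK a -> I x -> I (a * x)) (I0 : I 0)
  (Ib : forall x y, I x -> I y -> OK (x * y / beta)).

(* The element e is an idempotent modulo p generated by the products already
   treated; making the successive idempotents orthogonal lets their sum be a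
   single product x y / beta. *)
Lemma orthogonal_idempotent (s : seq (K * K)) :
  (forall q, q \in s -> I q.1 /\ I q.2) ->
  exists x y e, [/\ I x, I y & OK e] /\
   [/\ pmul (e * e - e), pmul (x * y / beta - e) &
    exists2 m, (0 < m)%N & forall q, q \in s -> pmul (((1 - e) * (q.1 * q.2 / beta)) ^+ m)].
Proof.
elim: s => [|[a b] s IHs] sI.
  exists 0, 0, 0; split; split=> //; first exact: OK0.
  - by rewrite mul0r subrr; exact: pmul0.
  - by rewrite mul0r mul0r subrr; exact: pmul0.
  - by exists 1%N.
have [q sq|x [y [e [[Ix Iy Oe] [ee xye [m m0 mP]]]]]] := IHs.
  by apply: sI; rewrite inE sq orbT.
have [/= Ia Ib'] := sI _ (mem_head _ _).
pose u := a * b / beta; have Ou : OK u by exact: Ib.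
have [N N0 NP] := idempotent_power Ou; set g := u ^+ N in NP.
have Og : OK g by exact: OKX.
have O1e : OK (1 - e) by apply: OKB => //; exact: OK1.
have O1g : OK (1 - g) by apply: OKB => //; exact: OK1.
have OuN : OK (u ^+ N.-1) by exact: OKX.
pose f := (1 - e) * g; have Of : OK f by exact: OK_mul.
(* The cross terms of the product contain e f, which vanishes modulo p. The other two reduce to e
   and f, because x y / beta is congruent to e and u^(N-1) (a b / beta) is g. *)
exists (e * x + f * a), (e * y + f * u ^+ N.-1 * b), (e + f); split; split.
- by apply: ID; apply: IM.
- by apply: ID; apply: IM => //; exact: OK_mul.
- exact: OK_add.
- have -> : (e + f) * (e + f) - (e + f) =
     ((1 - g) * (1 - g)) * (e * e - e) + (1 - e) * (g * g - g) by rewrite /f; ring.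
  by apply: pmulD; apply: pmulM => //; exact: OK_mul.
- have ug : u ^+ N.-1 * (a * b / beta) = g by rewrite -/u -exprSr prednK.
  have -> : (e * x + f * a) * (e * y + f * u ^+ N.-1 * b) / beta - (e + f) =
     (e * e) * (x * y / beta - e) + (e + 1) * (e * e - e) +
     (g * (u ^+ N.-1 * (x * b / beta) + a * y / beta)) * (- (e * e - e)) +
     ((g * g * g) * (e * e - e) + ((1 - e) * (g + 1)) * (g * g - g)).
    transitivity (e * e * (x * y / beta) +
      e * f * (u ^+ N.-1 * (x * b / beta) + a * y / beta) +
      f * f * (u ^+ N.-1 * (a * b / beta)) - (e + f)); first by ring.
    by rewrite ug /f; ring.
  apply: pmulD; [apply: pmulD; [apply: pmulD|] | apply: pmulD].
  - by apply: pmulM => //; exact: OK_mul.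
  - by apply: pmulM => //; apply: OK_add => //; exact: OK1.
  - apply: pmulM; last exact: pmulN.
    apply: OK_mul => //; apply: OK_add; last exact: Ib.
    by apply: OK_mul => //; exact: Ib.
  - by apply: pmulM => //; do 2![apply: OK_mul => //].
  - apply: pmulM => //; apply: OK_mul => //; apply: OK_add => //; exact: OK1.
exists (maxn m N); first by rewrite leq_max m0.
(* The factor 1 - e keeps the earlier products nilpotent; the factor 1 - g makes the new one
   nilpotent, since (1 - g) u^N vanishes modulo p. *)
have De : 1 - (e + f) = (1 - e) * (1 - g) by rewrite /f; ring.
have up (v : K) k : OK v -> (k <= maxn m N)%N -> pmul (v ^+ k) -> pmul (v ^+ maxn m N).
  by move=> Ov le_k vk; rewrite -(subnK le_k) exprD; apply: pmulM => //; exact: OKX.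
move=> q; rewrite inE De => /predU1P[->|sq] /=.
  apply: (up _ N); rewrite ?leq_maxr //; first by do 2![apply: OK_mul => //].
  rewrite -/u exprMn -/g [((1 - e) * _) ^+ _]exprMn -(prednK N0) [(1 - g) ^+ _]exprS.
  have -> : (1 - e) ^+ N.-1.+1 * ((1 - g) * (1 - g) ^+ N.-1) * g =
      ((1 - e) ^+ N.-1.+1 * (1 - g) ^+ N.-1) * - (g * g - g) by ring.
  by apply: pmulM; [apply: OK_mul; exact: OKX | exact: pmulN].
have [Iq1 Iq2] : I q.1 /\ I q.2 by apply: sI; rewrite inE sq orbT.
have Oq : OK (q.1 * q.2 / beta) by exact: Ib.
apply: (up _ m); rewrite ?leq_maxl //; first by do 2![apply: OK_mul => //].
rewrite mulrAC exprMn mulrC; apply: pmulM; first exact: OKX.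
exact: mP.
Qed.

(** Dividing the expression of beta by beta writes 1 - e as a sum of elements (1 - e) q1 q2 / beta,
    all nilpotent modulo [p]. An idempotent that is nilpotent vanishes, so x y / beta is congruent
    to 1. Thus x generates the ideal locally at p, with y / beta as local inverse. *)
Lemma locally_principal :
  (exists2 s : seq (K * K), (forall q, q \in s -> I q.1 /\ I q.2) &
     beta = \sum_(q <- s) q.1 * q.2) ->
  exists x y z, [/\ I x, I y, OK z & x * y / beta = 1 + z *+ p].
Proof.
move=> [s sI Db]; have [x [y [e [[Ix Iy Oe] [ee xye [m m0 mP]]]]]] := orthogonal_idempotent sI.
suff [z Oz Dz] : pmul (1 - e).
  have [t Ot Dt] := xye; exists x, y, (t - z); split=> //; first exact: OKB.
  by rewrite mulrnBl -Dz -Dt; ring.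
have O1e : OK (1 - e) by apply: OKB => //; exact: OK1.
have [k] : exists k, pmul ((1 - e) ^+ k.+1).
  have -> : 1 - e = \sum_(q <- s) (1 - e) * (q.1 * q.2 / beta).
    by rewrite -mulr_sumr -mulr_suml -Db divff // mulr1.
  elim: s sI mP {Db} => [|q s IHs] sI mP.
    by exists 0%N; rewrite big_nil expr1; exact: pmul0.
  have [r sr|r sr|k kP] := IHs.
  - by apply: sI; rewrite inE sr orbT.
  - by apply: mP; rewrite inE sr orbT.
  have [Iq1 Iq2] := sI _ (mem_head _ _).
  exists (m + k)%N; rewrite big_cons -addnS; apply: nilpotentD => //.
  - by apply: OK_mul => //; exact: Ib.
  - rewrite big_seq; apply: (big_ind OK); [exact: OK0 | exact: OK_add |].
    move=> r sr; have [|Ir1 Ir2] := sI r; first by rewrite inE sr orbT.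
    by apply: OK_mul => //; exact: Ib.
  by apply: mP; rewrite mem_head.
elim: k => [|k IHk kP]; first by rewrite expr1.
apply: IHk; rewrite -[_ ^+ _](subrK ((1 - e) ^+ k.+2)); apply: pmulD => //.
have -> : (1 - e) ^+ k.+1 - (1 - e) ^+ k.+2 = (1 - e) ^+ k * - (e * e - e).
  by rewrite !exprS; ring.
by apply: pmulM; [exact: OKX | exact: pmulN].
Qed.
End LocalPrincipal.

(** The factors X and Y have valuation 0 at p, so the two equations bound the valuations of [a] and
    [b] by each other. *)
Lemma eq_of_local_units (a b : nat) : (0 < a)%N -> (0 < b)%N ->
  (forall p, prime p -> exists X Y U W : nat,
     [/\ ~~ (p %| X), ~~ (p %| Y), X * a = b * U & Y * b = a * W])%N -> a = b.
Proof.
move=> a0 b0 H; apply: eqn_from_log => // p.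
have [pp|] := boolP (prime p); last by move=> np; rewrite [logn p a]lognE [logn p b]lognE (negPf np).
have [X [Y [U [W [pX pY E1 E2]]]]] := H p pp.
have X0 : (0 < X)%N by case: X pX {E1} => //; rewrite dvdn0.
have Y0 : (0 < Y)%N by case: Y pY {E2} => //; rewrite dvdn0.
have U0 : (0 < U)%N by rewrite -(ltn_pmul2l b0) muln0 -E1 muln_gt0 X0.
have W0 : (0 < W)%N by rewrite -(ltn_pmul2l a0) muln0 -E2 muln_gt0 Y0.
have lX : logn p X = 0%N by rewrite lognE pp X0 /= (negPf pX).
have lY : logn p Y = 0%N by rewrite lognE pp Y0 /= (negPf pY).
have := congr1 (logn p) E1; have := congr1 (logn p) E2.
by rewrite !lognM // lX lY; lia.
Qed.

(** * The index of an ideal with principal square *)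

Section SquareIdeal.
Variable K : fieldExtType rat.
Local Notation n := (\dim {:K}).
Local Notation OK := (ring_of_integers K).

Lemma zcomb_in (L : set K) (c : 'I_n -> K) z : L 0 ->
  (forall x y, L x -> L y -> L (x + y)) -> (forall a x, OK a -> L x -> L (a * x)) ->
  (forall i, L (c i)) -> L (zcomb c z).
Proof.
move=> L0 LD LM Lc; apply: (big_ind L) => // i _.
rewrite -mulrzr mulrC; apply: LM => //.
by rewrite -[_%:~R]/(1 *~ _); apply: OK_mulrz; exact: OK1.
Qed.

Lemma zcomb_delta (c : 'I_n -> K) i : zcomb c (fun j => (j == i)%:R) = c i.
Proof.
rewrite /zcomb (bigD1 i) //= eqxx big1 ?addr0 // => j /negPf->.
by rewrite mulr0z.
Qed.

Variables (R : realType) (sigma : 'I_n -> {rmorphism K -> R[i]}).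
Hypothesis sigmaP : is_embeddings sigma.

(** A family in [L] whose discriminant is nonzero and minimal in absolute value is a basis: an
    element with a non-integral coordinate, reduced to its fractional parts, could replace a basis
    vector and would multiply the discriminant by the square of a number strictly between 0 and
    1. *)
Lemma ideal_zbasis (L : set K) :
  (forall x y, L x -> L y -> L (x + y)) -> (forall a x, OK a -> L x -> L (a * x)) ->
  (forall x, L x -> OK x) -> (exists2 a, L a & a != 0) ->
  exists2 c : 'I_n -> K, family_disc c != 0 &
    forall x, L x <-> exists z : 'I_n -> int, x = zcomb c z.
Proof.
move=> LD LM LO [a La nza].
have L0 : L 0 by rewrite -(mul0r a); apply: LM => //; exact: OK0.
pose P m := `[< exists c : 'I_n -> K, [/\ forall i, L (c i), family_disc c != 0 &
                             `|family_disc c| = m%:R] >].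
have exP c : (forall i, L (c i)) -> family_disc c != 0 ->
    exists2 m, P m & `|family_disc c| = m%:R.
  move=> Lc nzc; have /natrP[m Dm] := natr_norm_int (family_disc_int (fun i => LO _ (Lc i))).
  by exists m => //; apply/asboolP; exists c.
have exPm : exists m, P m.
  have [b bP] := integral_basis_ex K.
  have [A DA] := basis_mult_mx a (integral_basis_disc_neq0 bP).
  have [||m Pm _] := exP (fun i => b i * a); last by exists m.
    by move=> i; apply: LM => //; exact: integral_basis_OK.
  rewrite (family_disc_change DA) mulf_neq0 ?integral_basis_disc_neq0 // expf_neq0 //.
  by rewrite (field_norm_mxE sigmaP (integral_basis_disc_neq0 bP) DA) (field_norm_eq0 sigmaP).
case: (ex_minnP exPm) => m /asboolP[c [Lc nzc Dm]] minP; exists c => // x.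
split=> [Lx|[z ->]]; last exact: (zcomb_in _ L0 LD LM Lc).
have cB := family_disc_basis nzc; set B := [tuple c i | i < n] in cB.
pose q i := coord B i x.
have Dx : x = \sum_i q i *: c i.
  by rewrite {1}(coord_basis cB (memvf x)); apply: eq_bigr => i _; rewrite nth_mktuple.
exists (fun i => Num.floor (q i)).
rewrite {1}Dx; apply: eq_bigr => k _; rewrite -scaler_int floorK //.
pose t i := q i - (Num.floor (q i))%:~R.
have [t0|nzt] := eqVneq (t k) 0.
  by rewrite -(subrK (Num.floor (q k))%:~R (q k)) -/(t k) t0 add0r rpred_int.
pose y := \sum_i t i *: c i.
have Ly : L y.
  have -> : y = x + zcomb c (fun i => - Num.floor (q i)).
    rewrite Dx -big_split; apply: eq_bigr => i _.
    by rewrite /= -scaler_int -scalerDl rmorphN.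
  by apply: (LD _ _ Lx); exact: (zcomb_in _ L0 LD LM Lc).
pose c' i := if i == k then y else c i.
have Dc' : family_disc c' = t k ^+ 2 * family_disc c.
  have -> : t k = (\row_j t j) 0 k by rewrite mxE.
  rewrite -det_row_replace; apply: family_disc_change => i; rewrite /c'.
  have [-> | ne_ik] := eqVneq i k.
    by apply: eq_bigr => j _; rewrite !mxE eqxx.
  rewrite (bigD1 i) //= big1 => [|j ne_ji].
    by rewrite mxE (negPf ne_ik) eqxx scale1r addr0.
  by rewrite mxE (negPf ne_ik) eq_sym (negPf ne_ji) scale0r.
have [i||m' /minP le_mm' Dm'] := exP c'.
- by rewrite /c'; case: eqP.
- by rewrite Dc' mulf_neq0 // expf_neq0.
have : m'%:R < m%:R :> rat.
  have t_ge0 : 0 <= t k by rewrite subr_ge0 floor_le.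
  have t_lt1 : t k < 1 by rewrite ltrBlDl -[X in _ + X]/(1%:~R) -intrD floorD1_gt.
  rewrite -Dm' -Dm Dc' normrM gtr_pMl ?normr_gt0 //.
  by rewrite ger0_norm ?sqr_ge0 // expr_lt1.
by rewrite ltr_nat ltnNge le_mm'.
Qed.

Lemma det_emx_zcomb (b c : 'I_n -> K) (A : 'M[int]_n) : (forall i, c i = zcomb b (A i)) ->
  \det (emx sigma c) = (\det A)%:~R * \det (emx sigma b).
Proof.
move=> DA; rewrite (@emx_change _ _ sigma b c (map_mx intr A)) ?det_mulmx.
  by rewrite -map_mx_comp (eq_map_mx _ (fun k => rmorph_int _ k)) det_map_mx.
by move=> i; rewrite DA; apply: eq_bigr => j _; rewrite !mxE scaler_int.
Qed.

Lemma det_emx_mul (b : 'I_n -> K) x :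
  \det (emx sigma (fun i => b i * x)) = ratr (field_norm x) * \det (emx sigma b).
Proof.
rewrite (sigma_field_norm sigmaP).
have -> : emx sigma (fun i => b i * x) = emx sigma b *m diag_mx (\row_j sigma j x).
  apply/matrixP => i j; rewrite mul_mx_diag !mxE; exact: rmorphM.
by rewrite det_mulmx mulrC det_diag; congr (_ * _); apply: eq_bigr => j _; rewrite mxE.
Qed.

Variables (I : set K) (beta : K).
Hypotheses (nzb : beta != 0) (ID : forall x y, I x -> I y -> I (x + y))
  (IM : forall a x, OK a -> I x -> I (a * x)) (IO : forall x, I x -> OK x)
  (Ib : forall x y, I x -> I y -> OK (x * y / beta))
  (Is : exists2 s : seq (K * K), (forall q, q \in s -> I q.1 /\ I q.2) &
     beta = \sum_(q <- s) q.1 * q.2).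

(* Up to the sign, N(beta) is the square of the index of I; this is checked one
   prime at a time, I being generated by a single element modulo p. *)
Lemma square_ideal_basis : exists c : 'I_n -> K,
  [/\ family_disc c != 0, forall x, I x <-> exists z : 'I_n -> int, x = zcomb c z,
    `|family_disc c| = `|field_norm beta| * `|(disc K)%:~R| &
    forall g, I g -> exists k : int, `|field_norm (g ^+ 2 / beta)| = (k ^+ 2)%:~R].
Proof.
have [s sI Db] := Is.
have nzs : s != [::] by apply: contraNneq nzb => s0; rewrite Db s0 big_nil.
have I0 : I 0.
  case: s nzs sI {Db} => // q s _ /(_ q (mem_head _ _))[Iq _].
  by rewrite -(mul0r q.1); apply: IM => //; exact: OK0.
have Ibeta : I beta.
  rewrite Db big_seq; apply: (big_ind I) => // q /sI[Iq1 Iq2].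
  by apply: IM => //; exact: IO.
have Inz : exists2 a, I a & a != 0 by exists beta.
have [c nzc cI] := ideal_zbasis ID IM IO Inz.
have [w wP Dw] := disc_spec K; have [_ wI] := wP.
have nzw := integral_basis_disc_neq0 wP.
have Ic i : I (c i) by apply/cI; exists (fun j => (j == i)%:R); rewrite zcomb_delta.
have inO (f : 'I_n -> K) : (forall i, OK (f i)) -> exists A : 'M[int]_n, forall i, f i = zcomb w (A i).
  move=> Of; have /choice[z zP] (i : 'I_n) : exists z : 'I_n -> int, f i = zcomb w z by apply/wI.
  by exists (\matrix_(i, j) z i j) => i; rewrite zP; apply: eq_bigr => j _; rewrite mxE.
have inI (f : 'I_n -> K) : (forall i, I (f i)) -> exists A : 'M[int]_n, forall i, f i = zcomb c (A i).
  move=> If; have /choice[z zP] (i : 'I_n) : exists z : 'I_n -> int, f i = zcomb c z by apply/cI.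
  by exists (\matrix_(i, j) z i j) => i; rewrite zP; apply: eq_bigr => j _; rewrite mxE.
(* |det A| is the index of [I] in the ring of integers. *)
have [A DA] := inO c (fun i => IO (Ic i)).
have DcA := det_emx_zcomb DA.
have nzM : \det (emx sigma w) != 0.
  by have := emx_unit sigmaP nzw; rewrite unitmxE unitfE.
have nzA : \det A != 0.
  by have := emx_unit sigmaP nzc; rewrite unitmxE unitfE DcA mulf_eq0 intr_eq0 negb_or => /andP[].
have ratI : injective (ratr : rat -> R[i]) by exact: fmorph_inj.
(* The multiples of g lie in [I], so the index of [I] divides the norm of g. *)
have NI g : I g -> exists X : int, field_norm g = (X * \det A)%:~R.
  move=> Ig; have [i|X DX] := inI (fun i => w i * g).
    by apply: IM => //; exact: integral_basis_OK.
  exists (\det X); apply/ratI/(mulIf nzM).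
  by rewrite -det_emx_mul (det_emx_zcomb DX) DcA ratr_int rmorphM mulrA.
(* Multiplication by g / beta maps [I] into the ring of integers. *)
have NIb g : I g -> exists Y : int, field_norm (g / beta) * (\det A)%:~R = Y%:~R.
  move=> Ig; have [i|Y DY] := inO (fun i => c i * (g / beta)).
    by rewrite mulrA; apply: Ib.
  exists (\det Y); apply/ratI/(mulIf nzM).
  by rewrite rmorphM /= !ratr_int -mulrA -DcA -det_emx_mul (det_emx_zcomb DY).
have [B DB] : exists B : int, field_norm beta = B%:~R.
  exact: (field_norm_int sigmaP (IO Ibeta)).
have nzB : B != 0.
  by rewrite -(intr_eq0 rat) -DB (field_norm_eq0 sigmaP).
have main : (`|\det A| ^ 2 = `|B|)%N.
  (* The integers X = N(x) / det A and Y = N(y / beta) det A have product N(x y / beta), congruent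
     to 1 modulo p, so both are prime to p. The integral norms of x^2 / beta and y^2 / beta give the
     two equations. *)
  apply: eq_of_local_units; rewrite ?expn_gt0 ?absz_gt0 ?nzA // => p pp.
  have [x [y [z [Ix Iy Oz Dxy]]]] := locally_principal (prime_gt0 pp) nzb ID IM I0 Ib Is.
  have [X DX] := NI x Ix; have [Y DY] := NIb y Iy.
  have [k Dk] := field_norm_cong1 sigmaP p Oz.
  have XY : X * Y = 1 + k * p%:Z.
    apply: (@intr_inj rat); rewrite -Dk -Dxy -mulrA (field_normM sigmaP) DX rmorphM /= -DY.
    by rewrite rmorphM /=; ring.
  have [U DU] := field_norm_int sigmaP (Ib Ix Ix).
  have [W DW] := field_norm_int sigmaP (Ib Iy Iy).
  have E1 : X ^+ 2 * \det A ^+ 2 = B * U.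
    apply: (@intr_inj rat); rewrite [RHS]rmorphM /= -DB -DU -(field_normM sigmaP).
    by rewrite [beta * _]mulrC divfK // (field_normM sigmaP) DX -!rmorphM /=; congr _%:~R; ring.
  have E2 : Y ^+ 2 * B = \det A ^+ 2 * W.
    apply: (@intr_inj rat); rewrite rmorphM rmorphXn [RHS]rmorphM rmorphXn /= -DY -DB -DW exprMn.
    rewrite mulrAC [in RHS]mulrC; congr (_ * _); rewrite expr2 -!(field_normM sigmaP).
    by congr field_norm; rewrite mulrCA !mulrA divfK // mulrAC.
  exists (`|X| ^ 2)%N, (`|Y| ^ 2)%N, `|U|%N, `|W|%N.
  have pXY : ~~ (p %| `|(X * Y)%R|)%N.
    apply/negP; rewrite XY -[p]/(`|p%:Z|%N) -dvdzE => /dvdzP[q Dq].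
    have : (p%:Z %| 1)%Z by apply/dvdzP; exists (q - k); rewrite mulrBl -Dq addrK.
    by rewrite dvdzE dvdn1; case: (p) pp => [|[]].
  split.
  - by apply: contra pXY; rewrite Euclid_dvdX // abszM => /andP[pX _]; rewrite dvdn_mulr.
  - by apply: contra pXY; rewrite Euclid_dvdX // abszM => /andP[pX _]; rewrite dvdn_mull.
  - by rewrite -!abszX -!abszM E1.
  - by rewrite -!abszX -!abszM E2.
have nB : `|field_norm beta| = (\det A)%:~R ^+ 2 :> rat.
  rewrite DB -intr_norm -rmorphXn /= -abszE -main; congr _%:~R.
  by rewrite -[RHS]ger0_norm ?sqr_ge0 // -abszE abszX.
exists c; split=> //.
  have -> : family_disc c = (\det A)%:~R ^+ 2 * family_disc w.
    rewrite -det_map_mx; apply: family_disc_change => i.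
    by rewrite DA; apply: eq_bigr => j _; rewrite !mxE scaler_int.
  by rewrite Dw normrM nB ger0_norm ?sqr_ge0.
(* N(g) is X det A and |N(beta)| is (det A)^2, which leaves X^2. *)
move=> g Ig; have [X DX] := NI g Ig; exists X.
have nzN : `|field_norm beta| != 0 by rewrite normr_eq0 (field_norm_eq0 sigmaP).
apply: (mulIf nzN); rewrite -normrM -(field_normM sigmaP) divfK //.
rewrite expr2 (field_normM sigmaP) DX nB -expr2 ger0_norm ?sqr_ge0 //.
by rewrite rmorphM exprMn rmorphXn.
Qed.
End SquareIdeal.

(** * Counting algebraic integers *)

Lemma size_by_coords (T V : eqType) n (f : 'I_n -> T -> V) (N : 'I_n -> nat)
    (e : seq 'I_n) (s : seq T) :
  uniq s ->
  (forall x y, x \in s -> y \in s -> (forall i, i \in e -> f i x = f i y) -> x = y) ->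
  (forall i, size (undup (map (f i) s)) <= N i)%N ->
  (size s <= \prod_(i <- e) N i)%N.
Proof.
elim: e s => [|i e IHe] s us inj_s sN.
  rewrite big_nil; case: s us inj_s {sN} => [|x [|y s]] //= /andP[xy _] inj_s.
  have E : x = y by apply: inj_s; rewrite ?inE ?eqxx ?orbT.
  by rewrite E mem_head in xy.
rewrite big_cons mulnC.
apply: leq_trans (leq_mul (leqnn _) (sN i)).
apply: (@size_fibers _ _ (f i)) => [x sx|b]; first by rewrite mem_undup map_f.
apply: IHe.
- by rewrite filter_uniq.
- move=> x y; rewrite !mem_filter => /andP[/eqP fx sx] /andP[/eqP fy sy] H.
  by apply: inj_s => // j; rewrite inE => /predU1P[->|]; [rewrite fx fy | exact: H].
move=> j; apply: leq_trans (sN j); apply: uniq_leq_size; first exact: undup_uniq.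
move=> v; rewrite !mem_undup => /mapP[x]; rewrite mem_filter => /andP[_ sx] ->.
exact: map_f.
Qed.

Section IntegerCount.
Variables (K : fieldExtType rat) (R : realType).
Local Notation n := (\dim {:K}).
Local Notation OK := (ring_of_integers K).
Variable sigma : 'I_n -> {rmorphism K -> R[i]}.
Hypothesis sigmaP : is_embeddings sigma.

Definition sqnorm (x : K) : R := eform sigma (fun=> 1) x.

(* Locked, since arithmetic tactics would otherwise try to evaluate [disc]. *)
Definition abs_disc : R := locked (`|disc K|%:~R).

Lemma abs_discE : abs_disc = `|disc K|%:~R.
Proof. by rewrite /abs_disc -lock. Qed.

Definition hermite_const (m : nat) : R := (4 / 3) ^+ (m * m).

Lemma hermite_const_ge1 m : 1 <= hermite_const m.
Proof. by apply: exprn_ege1; lra. Qed.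

Lemma abs_disc_ge1 : 1 <= abs_disc.
Proof.
rewrite abs_discE -[1]/(1%:~R) ler_int; have := disc_neq0 K; lia.
Qed.

Lemma sqnorm_mul x y : sqnorm (x * y) <= sqnorm x * sqnorm y.
Proof.
rewrite /sqnorm /eform mulr_suml; apply: ler_sum => j _; rewrite !mul1r.
rewrite rmorphM cabsM exprMn ler_wpM2l ?sqr_ge0 // (bigD1 j) //= mul1r lerDl.
by apply: sumr_ge0 => k _; rewrite mulr_ge0 ?sqr_ge0.
Qed.

Lemma cabs_le_sqnorm x j T : 0 <= T -> sqnorm x <= T ^+ 2 -> cabs (sigma j x) <= T.
Proof.
move=> T0 xT; rewrite -(@ler_pXn2r _ 2) ?nnegrE ?cabs_ge0 //; apply: le_trans xT.
rewrite /sqnorm /eform (bigD1 j) //= mul1r lerDl.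
by apply: sumr_ge0 => k _; rewrite mulr_ge0 ?sqr_ge0.
Qed.

Lemma zcomb_change (b : 'I_n -> K) (U : 'M[int]_n) z :
  zcomb (fun i => zcomb b (U i)) z = zcomb b (fun j => \sum_i z i * U i j).
Proof.
rewrite /zcomb (eq_bigr (fun i => \sum_j b j *~ (z i * U i j))).
  by rewrite exchange_big; apply: eq_bigr => j _; rewrite mulrz_sumr.
by move=> i _; rewrite mulrz_suml; apply: eq_bigr => j _; rewrite -mulrzA mulrC.
Qed.

Lemma zcomb_unimodular (b : 'I_n -> K) (U : 'M[int]_n) z : U \in unitmx ->
  exists z', zcomb b z = zcomb (fun i => zcomb b (U i)) z'.
Proof.
move=> uU; exists (fun i => (\row_j z j *m invmx U) 0 i); rewrite zcomb_change.
apply: eq_bigr => j _; congr (_ *~ _).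
have /rowP/(_ j) := mulmxKV uU (\row_j z j); rewrite !mxE => <-.
by apply: eq_bigr.
Qed.

(** The last bound is [coord_bound] on a basis whose values have product at most a constant times D:
    the discriminant cancels, as if the basis were orthogonal up to a constant. *)
Lemma reduced_integral_basis : exists b : 'I_n -> K,
  [/\ forall i, OK (b i), family_disc b != 0,
      forall x, OK x -> exists z, x = zcomb b z,
      abs_disc <= \prod_i sqnorm (b i) <= hermite_const n * abs_disc &
      forall z i, (z i)%:~R ^+ 2 * sqnorm (b i) <= hermite_const n * sqnorm (zcomb b z)].
Proof.
have [b0 b0P Db0] := disc_spec K; have [_ b0I] := b0P.
have c1 : conj_inv sigma (fun=> 1) by [].
have w0 (j : 'I_n) : 0 < 1 :> R by [].
have nzb0 := integral_basis_disc_neq0 b0P.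
have p1 : \prod_(j < n) (1 : R) = 1 by exact: big1_eq.
have [U uU leU] := reduced_basis sigmaP c1 w0 nzb0.
pose b i := zcomb b0 (U i).
have aD : `|ratr (family_disc b0)| = abs_disc :> R.
  by rewrite abs_discE Db0 ratr_int -intr_norm.
have dU : (\det U) ^+ 2 = 1.
  by move: uU; rewrite unitmxE qualifE /= => /orP[]/eqP->.
have Db : family_disc b = family_disc b0.
  rewrite (@family_disc_change _ b0 b (map_mx intr U)).
    by rewrite det_map_mx -rmorphXn /= dU mul1r.
  by move=> i; apply: eq_bigr => j _; rewrite mxE scaler_int.
have nzb : family_disc b != 0 by rewrite Db.
rewrite p1 mul1r aD in leU.
have had := hadamard_eform sigmaP c1 w0 nzb; rewrite p1 mul1r Db aD in had.
exists b; split=> //.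
- by move=> i; apply: OK_sum; exact: integral_basis_OK.
- by move=> x /b0I[z ->]; rewrite -/(zcomb b0 z); have [z' ->] := zcomb_unimodular b0 z uU; exists z'.
- by apply/andP; split.
move=> z i; have := coord_bound sigmaP z i c1 w0 nzb; rewrite p1 mul1r Db aD.
have D0 : 0 < abs_disc := lt_le_trans ltr01 abs_disc_ge1.
move=> H; rewrite -(ler_pM2r D0) mulrAC; apply: le_trans H _.
rewrite [leRHS]mulrAC mulrC ler_wpM2r //.
by apply: eform_ge0 => j.
Qed.

(* The matrix of i-th coordinates of the products b_k b_l is invertible, so some
   permutation s makes the i-th coordinate of every b_k b_(s k) nonzero; hence
   |b_i|^2 is O(|b_k|^2 |b_(s k)|^2) for all k. *)
Lemma sqnorm_basis_bound b : (forall i, OK (b i)) -> family_disc b != 0 ->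
  (forall x, OK x -> exists z, x = zcomb b z) ->
  \prod_i sqnorm (b i) <= hermite_const n * abs_disc ->
  (forall z i, (z i)%:~R ^+ 2 * sqnorm (b i) <= hermite_const n * sqnorm (zcomb b z)) ->
  forall i, sqnorm (b i) ^+ n <= hermite_const n ^+ n.+2 * abs_disc ^+ 2.
Proof.
move=> Ob nzb bO leP coordb i; set H := hermite_const n in leP coordb *.
have H0 : 0 <= H by rewrite (le_trans ler01) // hermite_const_ge1.
have q0 k : 0 <= sqnorm (b k) by apply: eform_ge0.
pose l (x : K) : rat := coord [tuple b k | k < n] i x.
have bB := family_disc_basis nzb.
have lz z : l (zcomb b z) = (z i)%:~R.
  rewrite /l /zcomb linear_sum (bigD1 i) //= -scaler_int linearZ /=.
  have bt k : b k = [tuple b k | k < n]`_k by rewrite nth_mktuple.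
  rewrite {1}bt coord_free ?(basis_free bB) // eqxx mulr1 big1 ?addr0 // => k nki.
  rewrite -scaler_int linearZ /= {1}bt coord_free ?(basis_free bB) //.
  by rewrite [X in _ * (nat_of_bool X)%:R](_ : _ = false) ?mulr0 //; exact: (negPf nki).
pose B : 'M[rat]_n := \matrix_(k, m) l (b k * b m).
(* A kernel vector gives a nonzero x with l(x y) = 0 for all y; but y = b_i / x gives l(b_i) = 1. *)
have nzB : \det B != 0.
  apply/negP => /det0P[v nzv vB0].
  pose x := \sum_k v 0 k *: b k.
  have nzx : x != 0.
    apply: contraNneq nzv => x0; apply/eqP/rowP => k; rewrite mxE.
    have /freeP/(_ (fun k => v 0 k)) := basis_free bB; apply.
    by rewrite -[RHS]x0; apply: eq_bigr => m _; rewrite nth_mktuple.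
  have lx0 y : l (x * y) = 0.
    rewrite /l (coord_basis bB (memvf y)) mulr_sumr linear_sum big1 // => m _.
    rewrite -scalerAr linearZ /= nth_mktuple mulr_suml linear_sum /=.
    have /rowP/(_ m) := vB0; rewrite !mxE => E.
    rewrite (_ : \sum_k _ = 0) ?mulr0 // -[RHS]E; apply: eq_bigr => k _.
    by rewrite mxE -scalerAl linearZ.
  have := lx0 (x^-1 * b i); rewrite mulVKf //.
  by rewrite -(zcomb_delta b i) lz eqxx => /eqP; rewrite oner_eq0.
have [s sB] : exists s : 'S_n, forall k, B k (s k) != 0.
  apply: contrapT => nos; case/negP: nzB; apply/eqP; rewrite /determinant big1 // => s _.
  have [k Bk] : exists k, B k (s k) == 0.
    apply: contrapT => nok; apply: nos; exists s => k; apply/negP => Bk; apply: nok.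
    by exists k.
  by rewrite (bigD1 k) //= (eqP Bk) mul0r mulr0.
have step k : sqnorm (b i) <= H * (sqnorm (b k) * sqnorm (b (s k))).
  have [z Dz] := bO _ (OK_mul (Ob k) (Ob (s k))).
  apply: le_trans (_ : H * sqnorm (b k * b (s k)) <= _); last first.
    by rewrite ler_wpM2l // sqnorm_mul.
  rewrite Dz; apply: le_trans (coordb z i); rewrite ler_peMl //.
  have := sB k; rewrite mxE Dz lz intr_eq0 => nzz.
  rewrite -rmorphXn /= -[1]/(1%:~R) ler_int; nia.
(* As [s] is a permutation, the product over k is H^n times the square of the product of all values,
   which is at most (H D)^2. *)
apply: le_trans (_ : \prod_(k < n) (H * (sqnorm (b k) * sqnorm (b (s k)))) <= _).
  rewrite -{1}(card_ord n) -prodr_const; apply: ler_prod => k _; rewrite q0 /=; exact: step.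
rewrite big_split /= prodr_const card_ord big_split /=.
have -> : \prod_i sqnorm (b (s i)) = \prod_i sqnorm (b i).
  by rewrite [RHS](reindex_inj (@perm_inj _ s)).
have -> : H ^+ n.+2 = H ^+ n * H ^+ 2 by rewrite -exprD addn2.
rewrite -expr2 -mulrA -exprMn.
rewrite ler_wpM2l ?(exprn_ge0 n H0) // ler_pXn2r ?nnegrE //; first exact: prodr_ge0.
by rewrite mulr_ge0 // (le_trans ler01) // abs_disc_ge1.
Qed.

Definition count_const (m : nat) : R := (4 * hermite_const m ^+ m.+2) ^+ m.

(** On a reduced basis the [i]-th coordinate is O(T / r_i), with r_i the length of b_i, and the
    product of the r_i is at least sqrt D. Since r_i is O(D^(1/n)), hence O(T), no coordinate range
    is shorter than 1 and rounding costs only a constant factor. *)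
Lemma integer_count (s : seq K) (T : R) : uniq s -> 0 < T -> abs_disc <= T ^+ n ->
  (forall x, x \in s -> OK x /\ sqnorm x <= T ^+ 2) ->
  (size s)%:R * Num.sqrt abs_disc <= count_const n * T ^+ n.
Proof.
have M24 (x : R) : 1 <= x -> 2 * x + 2 <= 4 * x by lra.
move=> us T0 DT sT.
have [b [Ob nzb bO /andP[leDP leP] coordb]] := reduced_integral_basis.
have qn := sqnorm_basis_bound Ob nzb bO leP coordb.
have D1 := abs_disc_ge1; have n0 : (0 < n)%N by rewrite adim_gt0.
have D0 := lt_le_trans ltr01 D1.
pose q i := sqnorm (b i).
have q0 i : 0 < q i.
  have : 0 <= q i by apply: eform_ge0.
  rewrite le_eqVlt => /orP[/eqP qi0|//].
  by move: (lt_le_trans D0 leDP); rewrite (bigD1 i) //= -/(q i) -qi0 mul0r ltxx.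
have H1 := hermite_const_ge1 n; set H := hermite_const n in leP coordb qn H1 *.
pose c := H ^+ n.+2; have c1 : 1 <= c by exact: exprn_ege1.
have c0 := lt_le_trans ltr01 c1; have cT0 : 0 < c * T by rewrite mulr_gt0.
pose r i := Num.sqrt (q i).
have r0 i : 0 < r i by rewrite sqrtr_gt0.
have r2 i : r i ^+ 2 = q i by rewrite sqr_sqrtr // ltW.
have rT i : r i <= c * T.
  rewrite -(@ler_pXn2r _ 2) ?nnegrE ?(ltW (r0 _)) ?(ltW cT0) // r2.
  rewrite -(@ler_pXn2r _ n) ?nnegrE ?(ltW (q0 _)) ?exprn_ge0 ?(ltW cT0) //.
  apply: le_trans (qn i) _; rewrite -/c -exprM [leRHS]exprMn [T ^+ (2 * n)]exprM [c ^+ (2 * n)]exprM.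
  apply: ler_pM.
  - by rewrite (le_trans ler01).
  - by rewrite sqr_ge0.
  - by rewrite -(exprM c 2 n); apply: (ler_eXnr _ c1); rewrite muln_gt0.
  by rewrite exprAC; rewrite ler_pXn2r // nnegrE ?exprn_ge0 // ltW.
pose M i := c * T / r i.
have M1 i : 1 <= M i by rewrite ler_pdivlMr // mul1r.
have /choice[z zP] x : exists z : 'I_n -> int, OK x -> x = zcomb b z.
  have [/bO[z Dz]|nOx] := pselect (OK x); first by exists z.
  by exists (fun=> 0).
have zM x i : x \in s -> `|(z x i)%:~R| <= M i :> R.
  move=> /sT[Ox xT]; rewrite ler_pdivlMr //.
  rewrite -(@ler_pXn2r _ 2) ?nnegrE ?(ltW cT0) ?(mulr_ge0 (normr_ge0 _) (ltW (r0 _))) //.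
  rewrite exprMn r2 real_normK ?num_real //; apply: le_trans (coordb (z x) i) _.
  rewrite -(zP x Ox) exprMn; apply: ler_pM => //; first exact: le_trans ler01 H1.
    by apply: eform_ge0.
  by rewrite -exprM; apply: ler_eXnr => //; rewrite muln_gt0.
pose N i := Num.truncn (4 * M i).
have NM i : (N i)%:R <= 4 * M i < (N i).+1%:R.
  by apply: truncn_itv; rewrite mulr_ge0 // (le_trans ler01).
have size_s : (size s <= \prod_i N i)%N.
  apply: (@size_by_coords _ _ _ (fun i x => z x i)) => // [x y sx sy E|i].
    rewrite (zP x (sT x sx).1) (zP y (sT y sy).1); apply: eq_bigr => i _.
    by rewrite (E i) // mem_index_enum.
  rewrite -ltnS -(ltr_nat R); have /andP[_] := NM i; apply: le_lt_trans.
  apply: le_trans (_ : 2 * M i + 2 <= _); last exact: M24.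
  apply: (@size_int_interval _ _ 0); rewrite ?undup_uniq //; first exact: le_trans ler01 (M1 i).
  by move=> t; rewrite mem_undup => /mapP[x sx ->]; rewrite subr0 zM.
have Nle : (size s)%:R <= (4 * (c * T)) ^+ n / \prod_i r i.
  apply: le_trans (_ : \prod_i (N i)%:R <= _); first by rewrite -natr_prod ler_nat.
  rewrite -prodfV -[X in _ ^+ X](card_ord n) -prodr_const -big_split /=.
  apply: ler_prod => i _; rewrite ler0n -mulrA.
  by have /andP[] := NM i.
have sD : Num.sqrt abs_disc <= \prod_i r i.
  have P0 : 0 <= \prod_i r i by apply: prodr_ge0 => i _; exact: ltW.
  rewrite -[leRHS]ger0_norm // -sqrtr_sqr ler_sqrt ?sqr_ge0 // -prodrXl.
  by rewrite (eq_bigr q).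
apply: le_trans (ler_pM _ _ Nle sD) _; rewrite ?sqrtr_ge0 //.
rewrite divfK; last by apply/prodf_neq0 => i _; rewrite gt_eqF.
by rewrite mulrA exprMn.
Qed.

(* Translating s by the integers 0, ..., T covers each point at most M times and
   stays in a ball of radius O(T). *)
Lemma line_count (s : seq K) (T : R) (M : nat) : uniq s -> 1 <= T -> abs_disc <= T ^+ n ->
  (forall x, x \in s -> OK x /\ sqnorm x <= T ^+ 2) ->
  (forall a : K, (size [seq x <- s | `[< exists t : int, x = (a + t%:~R)%R >]] <= M)%N) ->
  (size s)%:R * T * Num.sqrt abs_disc <= M%:R * (count_const n * (n.*2.+2%:R * T) ^+ n).
Proof.
move=> us T1 DT sT sM; have T0 := lt_le_trans ltr01 T1.
have n0 : (0 < n)%N by rewrite adim_gt0.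
pose N := Num.truncn T.
have /andP[NT TN] : N%:R <= T < N.+1%:R by apply: truncn_itv; exact: ltW.
pose P := allpairs pair s (iota 0 N.+1).
pose f (p : K * nat) : K := p.1 + p.2%:R.
have uP : uniq P.
  by apply: allpairs_uniq => //; [exact: iota_uniq | move=> [? ?] [? ?]].
have sP : (size P <= M * size (undup (map f P)))%N.
  apply: (@size_fibers _ _ f) => [p Pp|y]; first by rewrite mem_undup map_f.
  apply: leq_trans (sM y).
  rewrite -(size_map fst); apply: uniq_leq_size.
    rewrite map_inj_in_uniq ?filter_uniq // => -[x t] [x' t'] /=.
    rewrite !mem_filter => /andP[/eqP <- _] /andP[/eqP /= + _] E; rewrite /f /= -E.
    move=> /addrI/(congr1 (sigma (Ordinal n0)))/eqP.
    by rewrite !rmorph_nat eqr_nat => /eqP ->.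
  move=> x /mapP[[x' t]]; rewrite mem_filter => /andP[/eqP fy Pp] ->; rewrite mem_filter /=.
  have /allpairsP[[u v] [/= su _ [Ex Et]]] := Pp; rewrite Ex su andbT.
  apply/asboolP; exists (- (v%:Z)); move: fy; rewrite /f /= Ex Et => <-.
  by rewrite rmorphN /= -pmulrn addrK.
have cnt : (size (undup (map f P)))%:R * Num.sqrt abs_disc <=
    count_const n * (n.*2.+2%:R * T) ^+ n.
  apply: integer_count; first exact: undup_uniq.
  - by rewrite mulr_gt0 // ltr0n.
  - apply: le_trans DT _; rewrite ler_pXn2r ?nnegrE ?mulr_ge0 ?(ltW T0) // ?adim_gt0 //.
    by rewrite ler_peMl ?(ltW T0) // ler1n.
  move=> y; rewrite mem_undup => /mapP[p /allpairsP[q [sx + ->]] ->].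
  rewrite mem_iota add0n ltnS /f /=; case: q sx => x t /= sx tN.
  have [Ox xT] := sT x sx; split.
    by apply: OK_add => //; rewrite pmulrn; apply: OK_mulrz; exact: OK1.
  have tT : t%:R <= T by apply: le_trans NT; rewrite ler_nat.
  apply: le_trans (_ : \sum_(j < n) (2 * T) ^+ 2 <= _).
    apply: ler_sum => j _.
    rewrite mul1r ler_pXn2r ?nnegrE ?cabs_ge0 ?(mulr_ge0 (ler0n _ 2) (ltW T0)) //.
    rewrite rmorphD rmorph_nat; apply: le_trans (cabsD _ _) _.
    have -> : cabs (t%:R : R[i]) = t%:R.
      by rewrite -[t%:R : R[i]](rmorph_nat (real_complex R)) cabs_real ger0_norm.
    by rewrite mulr_natl mulr2n lerD // cabs_le_sqnorm // ltW.
  rewrite sumr_const card_ord -[leLHS]mulr_natl !exprMn mulrA ler_wpM2r ?sqr_ge0 //.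
  by rewrite -!natrX -natrM ler_nat; move: n; clear; nia.
have Ns : size P = (size s * N.+1)%N by rewrite size_allpairs size_iota.
apply: le_trans (_ : (size P)%:R * Num.sqrt abs_disc <= _).
  rewrite ler_wpM2r ?sqrtr_ge0 // Ns natrM ler_wpM2l //; exact: ltW.
apply: le_trans (_ : (M * size (undup (map f P)))%:R * Num.sqrt abs_disc <= _).
  by rewrite ler_wpM2r ?sqrtr_ge0 // ler_nat.
by rewrite natrM -mulrA ler_wpM2l.
Qed.
End IntegerCount.

Lemma count_const_ge0 (R : realType) m : 0 <= count_const R m.
Proof.
rewrite /count_const exprn_ge0 // mulr_ge0 // exprn_ge0 //.
exact: le_trans ler01 (hermite_const_ge1 _ _).
Qed.

(** * Counting along cosets of the rational integers *)

Section CosetCount.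
Variables (K : fieldExtType rat) (R : realType).
Local Notation n := (\dim {:K}).
Local Notation OK := (ring_of_integers K).
Variable sigma : 'I_n -> {rmorphism K -> R[i]}.
Hypothesis sigmaP : is_embeddings sigma.

(** At x = g^2 / beta this is the value at g of the quadratic form with weights 1 / |sigma_j beta|;
    hence moduli in place of their squares. *)
Definition abssum (x : K) : R := \sum_j cabs (sigma j x).

Lemma cabs_le_abssum x j : cabs (sigma j x) <= abssum x.
Proof.
by rewrite /abssum (bigD1 j) //= lerDl; apply: sumr_ge0 => k _; exact: cabs_ge0.
Qed.

Lemma abssum_ge0 x : 0 <= abssum x.
Proof. by apply: sumr_ge0 => k _; exact: cabs_ge0. Qed.

Lemma sqnorm_le_abssum x : sqnorm sigma x <= abssum x ^+ 2.
Proof.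
rewrite expr2 {1}/abssum mulr_suml; apply: ler_sum => j _.
by rewrite mul1r expr2 ler_wpM2l ?cabs_ge0 // cabs_le_abssum.
Qed.

Lemma coset_ints (s : seq K) (a : K) : uniq s -> exists ts : seq int,
  [/\ uniq ts, size ts = size [seq x <- s | `[< exists t : int, x = a + t%:~R >]] &
    forall t, t \in ts -> a + t%:~R \in s].
Proof.
move=> us; have /choice[f fP] x : exists t : int,
    (exists t' : int, x = a + t'%:~R) -> x = a + t%:~R.
  have [[t Dx]|nt] := pselect (exists t' : int, x = a + t'%:~R); first by exists t.
  by exists 0.
exists (map f [seq x <- s | `[< exists t : int, x = a + t%:~R >]]); split.
- rewrite map_inj_in_uniq ?filter_uniq // => x y.
  rewrite !mem_filter => /andP[/asboolP/fP Dx _] /andP[/asboolP/fP Dy _] E.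
  by rewrite Dx Dy E.
- by rewrite size_map.
move=> t /mapP[x]; rewrite mem_filter => /andP[/asboolP/fP Dx sx] ->.
by rewrite -Dx.
Qed.

Lemma sigma_int j (t : int) : sigma j t%:~R = (t%:~R : R)%:C%C.
Proof. by rewrite rmorph_int; apply/esym; exact: (rmorph_int (real_complex R) t). Qed.

(** The real part of one conjugate confines each coset to an interval of half-length L. The box size
    [T] is kept apart from L, because the lattice count needs it to be at least D^(1/n). *)
Lemma count_small (s : seq K) (L T : R) : uniq s -> 1 <= L -> L <= T ->
  abs_disc K R <= T ^+ n -> (forall x, x \in s -> OK x /\ abssum x <= L) ->
  (size s)%:R * T * Num.sqrt (abs_disc K R) <=
    4 * L * (count_const R n * (n.*2.+2%:R * T) ^+ n).
Proof.
have L4 (x : R) : 1 <= x -> 2 * x + 2 <= 4 * x by lra.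
move=> us L1 LT DT sL; have n0 : (0 < n)%N by rewrite adim_gt0.
have L0 := le_trans ler01 L1.
have T1 := le_trans L1 LT.
pose M := Num.truncn (4 * L).
have /andP[ML LM] : M%:R <= 4 * L < M.+1%:R by apply: truncn_itv; rewrite mulr_ge0.
have B0 : 0 <= count_const R n * (n.*2.+2%:R * T) ^+ n.
  apply: mulr_ge0; first exact: count_const_ge0.
  by apply: exprn_ge0; apply: mulr_ge0 => //; exact: le_trans ler01 T1.
apply: le_trans (_ : M%:R * (count_const R n * (n.*2.+2%:R * T) ^+ n) <= _); last first.
  exact: ler_wpM2r.
apply: (line_count sigmaP) => // [x sx|a].
  have [Ox xL] := sL x sx; split=> //; apply: le_trans (sqnorm_le_abssum x) _.
  rewrite ler_pXn2r ?nnegrE ?abssum_ge0 ?(le_trans ler01 T1) //.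
  exact: le_trans LT.
have [ts [uts <- tsP]] := coset_ints a us.
rewrite -ltnS -(ltr_nat R); apply: le_lt_trans LM.
apply: le_trans (L4 _ L1); pose j := Ordinal n0.
apply: (@size_int_interval _ ts (- complex.Re (sigma j a))) => // t /tsP /sL[_ tL].
rewrite opprK; apply: le_trans tL; apply: le_trans (cabs_le_abssum _ j).
rewrite rmorphD sigma_int [sigma _ a + _]addrC /=; move: (ler_cabs_Re (t%:~R%:C%C + sigma j a)).
by case: (sigma j a).
Qed.

(** On the coset of a the norm of a + t is F(t), with F the characteristic polynomial of -a, whose
    roots are the -sigma_i(a). Translation by t does not affect distinctness of the conjugates, so F
    is separable as soon as the coset meets [s]. *)
Lemma count_square (C : R) (s : seq K) (y : R) : 0 <= C -> square_values_bound n C ->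
  uniq s -> 1 <= y -> abs_disc K R <= (y ^+ (4 * n.+2)) ^+ n ->
  (forall x, x \in s -> [/\ OK x, abssum x <= y ^+ (4 * n.+2),
     injective (fun j => sigma j x) &
     exists k : int, `|field_norm x| = (k ^+ 2)%:~R]) ->
  (size s)%:R * y ^+ (4 * n.+2) * Num.sqrt (abs_disc K R) <=
    C * y ^+ (4 * n.+2).-1 * (count_const R n * (n.*2.+2%:R * y ^+ (4 * n.+2)) ^+ n).
Proof.
move=> C0 CP us y1 DT sP; have n0 : (0 < n)%N by rewrite adim_gt0.
have y0 := le_trans ler01 y1.
set T := y ^+ (4 * n.+2); set W := y ^+ _.-1.
have T1 : 1 <= T by exact: exprn_ege1.
have W0 : 0 <= W by exact: exprn_ge0.
pose M := Num.truncn (C * W).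
have /andP[ML LM] : M%:R <= C * W < M.+1%:R by apply: truncn_itv; rewrite mulr_ge0.
have B0 : 0 <= count_const R n * (n.*2.+2%:R * T) ^+ n.
  apply: mulr_ge0; first exact: count_const_ge0.
  by apply: exprn_ge0; apply: mulr_ge0 => //; exact: le_trans ler01 T1.
apply: le_trans (_ : M%:R * (count_const R n * (n.*2.+2%:R * T) ^+ n) <= _); last first.
  exact: ler_wpM2r.
apply: (line_count sigmaP) => // [x sx|a].
  have [Ox xL _ _] := sP x sx; split=> //; apply: le_trans (sqnorm_le_abssum x) _.
  by rewrite ler_pXn2r ?nnegrE ?abssum_ge0 ?(le_trans ler01 T1).
have [ts [uts <- tsP]] := coset_ints a us.
case: ts uts tsP => [|t0 ts'] // uts tsP; set ts := t0 :: ts' in uts tsP *.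
rewrite -ltnS -(ltr_nat R); apply: le_lt_trans LM.
have nze := family_disc_vbasis K.
pose A := passmx.mxof (vbasis {:K}) (vbasis {:K}) (amulr (- a)).
pose F := map_poly (ratr : rat -> R) (char_poly A).
have DF : map_poly (real_complex R) F = \prod_i ('X + (sigma i a)%:P).
  rewrite /F -map_poly_comp (eq_map_poly (fmorph_eq_rat (real_complex R \o ratr))).
  rewrite (sigma_char_poly sigmaP nze (vbasis_mult_mx (- a))).
  by apply: eq_bigr => j _; rewrite rmorphN polyCN opprK.
have inja : injective (fun j => sigma j a).
  have [_ _ inj0 _] := sP _ (tsP t0 (mem_head _ _)).
  by move=> i j E; apply: inj0; rewrite /= !rmorphD !sigma_int E.
apply: (CP F (fun j => sigma j a)) => //.
- by rewrite size_map_poly size_char_poly.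
- rewrite -(separable_map (real_complex R)) DF.
  have -> : \prod_i ('X + (sigma i a)%:P) =
      \prod_(r <- [seq - sigma i a | i <- enum 'I_n]) ('X - r%:P).
    by rewrite big_map big_enum; apply: eq_bigr => i _; rewrite polyCN opprK.
  rewrite separable_prod_XsubC map_inj_uniq ?enum_uniq // => i j /oppr_inj; exact: inja.
- move=> t st; have [_ _ _ [k Dk]] := sP _ (tsP t st); exists k.
  rewrite -rmorphXn /= -(ratr_int R) -Dk ratr_norm (abs_field_norm sigmaP).
  rewrite -cabs_real -horner_map /= DF horner_prod cabs_prod.
  by apply: eq_bigr => i _; rewrite hornerD hornerX hornerC rmorphD sigma_int [sigma _ a + _]addrC.
move=> t i st; have [_ tL _ _] := sP _ (tsP t st).
apply: le_trans tL; apply: le_trans (cabs_le_abssum _ i).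
by rewrite rmorphD sigma_int [sigma _ a + _]addrC.
Qed.
End CosetCount.

(** * Two-torsion classes *)

Section TorsionClasses.
Local Open Scope classical_set_scope.
Local Open Scope ring_scope.
Variable K : fieldExtType rat.
Local Notation n := (\dim {:K}).
Local Notation OK := (ring_of_integers K).

Definition square_ideal (I : set K) (beta : K) :=
  [/\ beta != 0, forall x y, I x -> I y -> I (x + y),
      forall a x, OK a -> I x -> I (a * x), forall x, I x -> OK x &
      ideal_mul I I = [set beta * y | y in OK]].

Lemma square_ideal_div I beta x y : square_ideal I beta -> I x -> I y ->
  OK (x * y / beta).
Proof.
move=> [nzb _ _ _ Ib] Ix Iy.
have : ideal_mul I I (x * y).
  exists [:: (x, y)]; last by rewrite big_seq1.
  by move=> p; rewrite inE => /eqP->.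
by rewrite Ib => -[z Oz <-]; rewrite mulrC mulKf.
Qed.

Lemma square_ideal_sum I beta : square_ideal I beta ->
  exists2 s : seq (K * K), (forall q, q \in s -> I q.1 /\ I q.2) &
     beta = \sum_(q <- s) q.1 * q.2.
Proof.
move=> [nzb _ _ _ Ib]; have : ideal_mul I I beta.
  by rewrite Ib; exists 1; [exact: OK1 | rewrite mulr1].
by move=> [s sI ->]; exists s.
Qed.

Lemma ideal_class_scale (d : K) (I : set K) : d != 0 ->
  ideal_class [set d * u | u in I] = ideal_class I.
Proof.
move=> nzd; apply/seteqP; split=> _ [x nzx ->].
  exists (x * d); first by rewrite mulf_neq0.
  apply/seteqP; split=> [_ [_ [u Iu <-] <-]|_ [u Iu <-]]; first by exists u => //; rewrite mulrA.
  by exists (d * u); [exists u | rewrite mulrA].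
exists (x / d); first by rewrite mulf_neq0 ?invr_eq0.
apply/seteqP; split=> [_ [u Iu <-]|_ [_ [u Iu <-] <-]].
  by exists (d * u); [exists u | rewrite mulrA divfK].
by exists u => //; rewrite mulrA divfK.
Qed.

(** Clearing denominators makes the ideal integral within its class. *)
Lemma class_group2_square (c : set (set K)) : class_group2 K c ->
  exists I beta, square_ideal I beta /\ c = ideal_class I.
Proof.
move=> [[I0 [_ ID0 IM0 [d [_ nzd] Id]] <-] I2].
pose I := [set d * u | u in I0].
have DI : ideal_class I = ideal_class I0 by exact: ideal_class_scale.
rewrite -DI class_mulE in I2.
have : ideal_class (ideal_mul I I) (ideal_mul I I).
  by exists 1; [exact: oner_neq0 | rewrite image_mul1].
rewrite I2 => -[beta nzb Ibeta]; exists I, beta; split=> //; split=> //.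
- move=> _ _ [x Ix <-] [y Iy <-]; exists (x + y); [exact: ID0 | exact: mulrDr].
- by move=> a _ Oa [x Ix <-]; exists (a * x); [exact: IM0 | rewrite mulrCA].
- by move=> _ [x Ix <-]; exact: Id.
Qed.

Lemma OK_sqr v : OK (v ^+ 2) -> OK v.
Proof.
move=> Ov; apply: (@integral_root_monic _ _ (intr : {rmorphism int -> K}) v ('X^2 - (v ^+ 2)%:P)).
- by rewrite monicE lead_coefDl ?lead_coefXn // size_polyN size_polyXn (leq_ltn_trans (size_polyC_leq1 _)).
- by rewrite rootE !hornerE subrr.
apply/integral_poly => i; rewrite coefB coefXn coefC.
by apply: OKB; [case: (i == 2) | case: (i == 0%N)] => //; [exact: OK1 | exact: OK0 | exact: OK0].
Qed.

(** Put J = (g1/b1) I1 and J' = (g2/b2) I2, both with square (alpha). For u in J and w in J' the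
    square of u w / alpha is (u^2/alpha)(w^2/alpha), which is integral, so u w / alpha is integral
    too. Writing alpha as a sum of products of elements of J' then puts u into J'; the converse is
    symmetric. *)
Lemma square_root_class I1 b1 I2 b2 g1 g2 :
  square_ideal I1 b1 -> square_ideal I2 b2 -> I1 g1 -> I2 g2 -> g1 != 0 -> g2 != 0 ->
  g1 ^+ 2 / b1 = g2 ^+ 2 / b2 -> ideal_class I1 = ideal_class I2.
Proof.
suff sub I b I' b' g g' : square_ideal I b -> square_ideal I' b' -> I g -> I' g' ->
    g != 0 -> g' != 0 -> g ^+ 2 / b = g' ^+ 2 / b' ->
    [set g / b * u | u in I] `<=` [set g' / b' * u | u in I'].
  move=> S1 S2 Ig1 Ig2 nz1 nz2 E.
  have nzb1 : b1 != 0 by case: S1.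
  have nzb2 : b2 != 0 by case: S2.
  rewrite -(@ideal_class_scale (g1 / b1) I1) ?mulf_neq0 ?invr_eq0 //.
  rewrite -(@ideal_class_scale (g2 / b2) I2) ?mulf_neq0 ?invr_eq0 //.
  congr ideal_class; apply/seteqP; split; first exact: sub E.
  by apply: sub (esym E).
move=> S S' Ig Ig' nzg nzg' E _ [u Iu <-].
have [nzb ID IM IO _] := S; have [nzb' ID' IM' IO' _] := S'.
have [s sI Db'] := square_ideal_sum S'.
pose al := g ^+ 2 / b; have nzal : al != 0 by rewrite mulf_neq0 ?expf_neq0 ?invr_eq0.
pose v q := (g / b * u) * (g' / b' * q) / al.
have Ov q : I' q -> OK (v q).
  move=> I'q; apply: OK_sqr.
  have -> : v q ^+ 2 = (u * u / b) * (q * q / b').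
    transitivity ((g ^+ 2 / b) * (g' ^+ 2 / b') * (u * u / b) * (q * q / b') / al ^+ 2).
      by rewrite /v; field; rewrite nzal nzb nzb'.
    by rewrite -E -/al; field; rewrite nzal nzb nzb'.
  by apply: OK_mul; [exact: (square_ideal_div S) | exact: (square_ideal_div S')].
exists (\sum_(q <- s) v q.1 * q.2).
  rewrite big_seq; apply: (big_ind I').
  - by rewrite -(mul0r g'); apply: IM' => //; exact: OK0.
  - exact: ID'.
  by move=> q /sI[Iq1 Iq2]; apply: IM' => //; exact: Ov.
rewrite mulr_sumr; transitivity (\sum_(q <- s) (g / b * u) * (g' / b') ^+ 2 / al * (q.1 * q.2)).
  by apply: eq_bigr => q _; rewrite /v; ring.
rewrite -mulr_sumr -Db'.
have -> : al = g' ^+ 2 / b' by [].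
by field; rewrite nzb nzb' nzg'.
Qed.
End TorsionClasses.

(** * Elements g with g^2 / beta small or with distinct conjugates *)

Section SmallGenerators.
Variables (K : fieldExtType rat) (R : realType).
Local Notation n := (\dim {:K}).
Local Notation OK := (ring_of_integers K).
Variable sigma : 'I_n -> {rmorphism K -> R[i]}.
Hypothesis sigmaP : is_embeddings sigma.

(** With s_j a square root of sigma_j(1/b), equality of two conjugates means that s_i sigma_i(g) and
    s_j sigma_j(g) agree up to sign. On the sums of c_k t^k these are polynomials in t, no two of
    them proportional because the matrix of conjugates of [c] is invertible. The product of their
    sums and differences over at most n^2 pairs has degree at most 2n^3, so some t up to that bound
    is not a root. *)
Lemma distinct_squares (b : K) (c : 'I_n -> K) : b != 0 -> family_disc c != 0 ->
  exists2 t : nat, (t <= 2 * n ^ 3)%N &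
    injective (fun j => sigma j ((\sum_k c k *+ t ^ k) ^+ 2 / b)).
Proof.
move=> nzb nzc; pose s j := sqrtC (sigma j b^-1).
have s2 j : s j ^+ 2 = sigma j b^-1 by exact: sqrtCK.
have nzs j : s j != 0 by rewrite -sqrf_eq0 s2 fmorph_eq0 invr_eq0.
pose L j : {poly R[i]} := \sum_(k < n) (s j * sigma j (c k)) *: 'X^k.
have Lt j (t : nat) : (L j).[t%:R] = s j * sigma j (\sum_k c k *+ t ^ k).
  rewrite horner_sum rmorph_sum mulr_sumr; apply: eq_bigr => k _.
  by rewrite hornerZ hornerXn rmorphMn -natrX mulr_natr mulrnAr.
have sL j : (size (L j) <= n)%N.
  apply: leq_trans (size_sum _ _ _) _; apply/bigmax_leqP => k _.
  by rewrite (leq_trans (size_scale_leq _ _)) // size_polyXn.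
have nzL i j (e : R[i]) : i != j -> L i != e *: L j.
  move=> nij; apply/eqP => E; pose v : 'cV[R[i]]_n := s i *: delta_mx i 0 - (e * s j) *: delta_mx j 0.
  have v0 : emx sigma c *m v = 0.
    apply/matrixP => k o; rewrite ord1 !mxE (bigD1 i) //= (bigD1 j) 1?eq_sym //= big1 ?addr0.
      rewrite !mxE !eqxx (negPf nij) eq_sym (negPf nij) !mulr0 subr0 sub0r !mulr1 mulrN.
      have := congr1 (fun p : {poly R[i]} => p`_k) E; rewrite coefZ.
      have Lk l : (L l)`_k = s l * sigma l (c k).
        rewrite coef_sum (bigD1 k) //= coefZ coefXn eqxx mulr1 big1 ?addr0 // => m nmk.
        by rewrite coefZ coefXn [X in _ * (nat_of_bool X)%:R](_ : _ = false) ?mulr0 // eq_sym; exact: (negPf nmk).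
      by rewrite !Lk => Ek; rewrite [sigma i _ * _]mulrC Ek; ring.
    move=> l /andP[nli nlj]; by rewrite !mxE (negPf nli) (negPf nlj) /= !mulr0 subr0 mulr0.
  have := mulKmx (emx_unit sigmaP nzc) v; rewrite v0 mulmx0 => /matrixP/(_ i 0).
  rewrite !mxE !eqxx (negPf nij) mulr0 subr0 mulr1 => /eqP.
  by rewrite eq_sym (negPf (nzs i)).
pose P (p : 'I_n * 'I_n) := p.1 != p.2.
pose F (p : 'I_n * 'I_n) := (L p.1 - L p.2) * (L p.1 + L p.2).
pose W := \prod_(p | P p) F p.
have nzW : W != 0.
  apply/prodf_neq0 => -[i j] /= nij; rewrite mulf_neq0 //.
    by rewrite subr_eq0 -[L j]scale1r nzL.
  by rewrite addr_eq0 -scaleN1r nzL.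
have sF p : (size (F p) <= 2 * n)%N.
  apply: leq_trans (size_polyMleq _ _) _.
  have h1 : (size (L p.1 - L p.2)%R <= n)%N.
    by rewrite (leq_trans (size_polyD _ _)) // size_polyN geq_max !sL.
  have h2 : (size (L p.1 + L p.2)%R <= n)%N.
    by rewrite (leq_trans (size_polyD _ _)) // geq_max !sL.
  by rewrite (leq_trans (leq_pred _)) // (leq_trans (leq_add h1 h2)) // mul2n addnn.
have sW : (size W <= (2 * n ^ 3).+1)%N.
  apply: leq_trans (size_prod_leq _ _) _; apply: leq_trans (leq_subr _ _) _; rewrite ltnS.
  apply: leq_trans (_ : \sum_(p | P p) 2 * n <= _)%N; first exact: leq_sum.
  rewrite sum_nat_const (leq_trans (leq_mul (max_card _) (leqnn _))) // card_prod card_ord.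
  by rewrite !expnS expn0 muln1; apply: eq_leq; ring.
have [t tn Wt] : exists2 t : nat, (t <= 2 * n ^ 3)%N & ~~ root W t%:R.
  apply: contrapT => nt.
  have allW : all (root W) [seq t%:R | t <- iota 0 (2 * n ^ 3).+1].
    apply/allP => _ /mapP[t + ->]; rewrite mem_iota add0n ltnS => tn.
    by apply/negPn/negP => Wt; apply: nt; exists t.
  have uW : uniq [seq t%:R : R[i] | t <- iota 0 (2 * n ^ 3).+1].
    by rewrite map_inj_uniq ?iota_uniq // => u v /eqP; rewrite eqr_nat => /eqP.
  have := max_poly_roots nzW allW uW; rewrite size_map size_iota.
  by rewrite ltnNge sW.
exists t => // i j E; apply/eqP; apply: contraNT Wt => nij.
rewrite rootE horner_prod (bigD1 (i, j)) //= hornerM !hornerD hornerN !Lt -subr_sqr !exprMn !s2.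
move: E; rewrite /= !(rmorphM, rmorphXn) /= => E.
by rewrite [_ * sigma i _ ^+ 2]mulrC [_ * sigma j _ ^+ 2]mulrC E subrr mul0r.
Qed.

(** With N = 2m^3 the bound for t, a conjugate of the sum of c_k t^k is at most m N^m times the
    bound for the conjugates of the c_k; this is squared, summed over m embeddings and multiplied by
    the constant of Hermite reduction. *)
Definition comb_const (m : nat) : R :=
  m%:R * (m%:R * (2 * m ^ 3)%:R ^+ m) ^+ 2 * hermite_const R m.

(** The weights 1 / |sigma_j beta| have product 1 / |N(beta)|, which cancels the square of the index
    of I and leaves D. If all vectors of a reduced basis have values above L, each value is O(D /
    L^(n-1)), because the other n - 1 factors of the product exceed L. *)
Lemma small_or_primitive_root (I : set K) (beta : K) (L : R) :
  square_ideal I beta -> 0 < L ->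
  (exists2 g, I g /\ g != 0 & abssum sigma (g ^+ 2 / beta) <= L) \/
  (exists2 g, I g /\ g != 0 & abssum sigma (g ^+ 2 / beta) <=
       comb_const n * (abs_disc K R / L ^+ n.-1) /\
     injective (fun j => sigma j (g ^+ 2 / beta))).
Proof.
move=> S L0; have [nzb ID IM IO _] := S.
have [c [nzc cI Dc _]] := square_ideal_basis sigmaP nzb ID IM IO
  (fun x y => square_ideal_div S) (square_ideal_sum S).
pose w j := (cabs (sigma j beta))^-1.
have w0 j : 0 < w j by rewrite invr_gt0 cabs_gt0 fmorph_eq0.
have cw : conj_inv sigma w.
  by move=> i j E; rewrite /w -E cabsJ.
have wE g : eform sigma w g = abssum sigma (g ^+ 2 / beta).
  apply: eq_bigr => j _; rewrite rmorphM rmorphXn fmorphV cabsM cabsX cabsV.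
  exact: mulrC.
have [U uU leU] := reduced_basis sigmaP cw w0 nzc.
pose c' i := zcomb c (U i).
have Ic' i : I (c' i) by apply/cI; exists (U i).
have nzc' : family_disc c' != 0.
  rewrite (@family_disc_change _ c c' (map_mx intr U)).
    rewrite mulf_neq0 // expf_neq0 // det_map_mx intr_eq0.
    by move: uU; rewrite unitmxE; apply: contraTneq => ->; rewrite unitr0.
  by move=> i; apply: eq_bigr => j _; rewrite mxE scaler_int.
have DD : (\prod_j w j) * `|ratr (family_disc c)| = abs_disc K R.
  rewrite -ratr_norm Dc rmorphM /= !ratr_norm (abs_field_norm sigmaP) prodfV mulrA.
  rewrite mulVf ?mul1r ?abs_discE ?ratr_int ?intr_norm //.
  by apply/prodf_neq0 => j _; rewrite gt_eqF // cabs_gt0 fmorph_eq0.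
rewrite DD in leU.
have n0 : (0 < n)%N by rewrite adim_gt0.
have frc' := basis_free (family_disc_basis nzc').
have nz_c' i : c' i != 0.
  by apply: (free_not0 frc'); apply/tnthP; exists i; rewrite tnth_mktuple.
have [[i Li]|allL] := pselect (exists i, eform sigma w (c' i) <= L).
  by left; exists (c' i); rewrite -?wE.
right; pose E := hermite_const R n * (abs_disc K R / L ^+ n.-1).
have cE i : eform sigma w (c' i) <= E.
  rewrite /E mulrA ler_pdivlMr ?exprn_gt0 //; apply: le_trans leU.
  rewrite (bigD1 i) //= ler_wpM2l //; first by apply: eform_ge0 => j; exact: ltW.
  have -> : L ^+ n.-1 = \prod_(j < n | j != i) L.
    rewrite prodr_const; congr (_ ^+ _).
    by have := cardC1 i; rewrite card_ord /= => <-; apply: eq_card => j; rewrite !inE.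
  apply: ler_prod => j _; rewrite ltW //= ltW // ltNge; apply/negP => Lj.
  by apply: allL; exists j.
have [t tn inj_t] := distinct_squares nzb nzc'.
exists (\sum_k c' k *+ t ^ k).
  split.
    have I0 : I 0 by rewrite -(mul0r (c' (Ordinal n0))); apply: IM => //; exact: OK0.
    apply: (big_ind I) => // k _; rewrite -mulr_natl; apply: IM => //.
    by rewrite pmulrn; apply: OK_mulrz; exact: OK1.
  apply/eqP => g0; have /freeP/(_ (fun k => (t ^ k)%:R)) := frc'.
  have -> : \sum_(k < n) (t ^ k)%:R *: [tuple c' k | k < n]`_k = 0.
    by rewrite -[RHS]g0; apply: eq_bigr => k _; rewrite nth_mktuple scaler_nat.
  move=> /(_ erefl (Ordinal n0))/eqP; rewrite pnatr_eq0 expn_eq0 /=.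
  by rewrite andbF.
split=> //; rewrite -wE.
have E0 : 0 <= E.
  rewrite /E mulr_ge0 ?(le_trans ler01 (hermite_const_ge1 _ _)) //.
  by rewrite divr_ge0 ?exprn_ge0 ?(le_trans ler01 (abs_disc_ge1 _ _)) // ltW.
pose N := (2 * n ^ 3)%N.
rewrite /comb_const -mulrA -/E -/N.
apply: le_trans (_ : \sum_(j < n) (n%:R * N%:R ^+ n) ^+ 2 * E <= _); last first.
  by rewrite sumr_const card_ord -[leLHS]mulr_natl mulrA.
apply: ler_sum => j _.
pose r := Num.sqrt (E * cabs (sigma j beta)).
have b0 : 0 < cabs (sigma j beta) by rewrite cabs_gt0 fmorph_eq0.
have r2 : r ^+ 2 = E * cabs (sigma j beta) by rewrite sqr_sqrtr // mulr_ge0 // ltW.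
have ck k : cabs (sigma j (c' k)) <= r.
  rewrite -(@ler_pXn2r _ 2) ?nnegrE ?cabs_ge0 ?sqrtr_ge0 // r2.
  rewrite -ler_pdivrMr // mulrC; apply: le_trans (cE k).
  rewrite /eform (bigD1 j) //= lerDl; apply: sumr_ge0 => l _.
  by rewrite mulr_ge0 ?sqr_ge0 // ltW.
have gr : cabs (sigma j (\sum_k c' k *+ t ^ k)) <= n%:R * N%:R ^+ n * r.
  rewrite rmorph_sum; apply: le_trans (cabs_sum _ _ _) _.
  apply: le_trans (_ : \sum_(k < n) N%:R ^+ n * r <= _); last first.
    by rewrite sumr_const card_ord -[leLHS]mulr_natl mulrA.
  apply: ler_sum => k _; rewrite rmorphMn -mulr_natl cabsM.
  have -> : cabs ((t ^ k)%:R : R[i]) = (t ^ k)%:R.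
    by rewrite -[(t ^ k)%:R : R[i]](rmorph_nat (real_complex R)) cabs_real ger0_norm.
  apply: ler_pM => //; first exact: cabs_ge0.
  have N0 : (0 < N)%N by rewrite muln_gt0 expn_gt0 n0.
  rewrite -natrX ler_nat; apply: (@leq_trans (N ^ k)); last first.
    by rewrite leq_pexp2l // ltnW.
  by case: (val k) => [|m]; rewrite ?expn0 // leq_exp2r.
rewrite mulrC ler_pdivrMr // -mulrA -r2 -exprMn ler_pXn2r ?nnegrE ?cabs_ge0 //.
by rewrite !mulr_ge0 ?exprn_ge0 ?sqrtr_ge0.
Qed.
End SmallGenerators.

(** An infinite set has finite subsets of every size, so a bound on duplicate-free lists also rules
    out the infinite value. *)
Lemma counting_le (T : choiceType) (R : realType) (X : set T) (M : R) :
  (forall s : seq T, uniq s -> (forall x, x \in s -> X x) -> (size s)%:R <= M) ->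
  (@counting_measure.counting T R X <= M%:E)%E.
Proof.
move=> XM; rewrite /counting_measure.counting.
have [finX|infX] := asboolP (finite_set X).
  rewrite lee_fin; apply: XM; first exact: finmap.fset_uniq.
  by move=> x; rewrite in_fset_set // inE.
have [k Mk] : exists k : nat, M < k%:R.
  by exists (Num.bound `|M|); apply: le_lt_trans (ler_norm M) _; rewrite archi_boundP.
have [B BX kB] := infinite_set_fset k infX.
have /lt_le_trans/(_ (XM _ (finmap.fset_uniq B) BX)) : M < (size (finmap.enum_fset B))%:R.
  by apply: lt_le_trans Mk _; rewrite ler_nat.
by rewrite ltxx.
Qed.

(** * Counting the 2-torsion classes *)

Section TorsionBound.
Local Open Scope classical_set_scope.
Local Open Scope ring_scope.
Variables (K : fieldExtType rat) (R : realType).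
Local Notation n := (\dim {:K}).
Local Notation m := (4 * n.+2)%N.
Local Notation D := (abs_disc K R).

(** One element g^2 / beta is chosen for each class, injectively by [square_root_class]. The small
    ones are counted in the box of size [T0], where a coset contributes O(L) in place of O(T0); the
    others in the box of size y^m, where it contributes O(y^(m-1)). *)
Lemma torsion_count (C L T0 y : R) (cs : seq (set (set K))) :
  0 <= C -> square_values_bound n C -> 1 <= L -> L <= T0 -> D <= T0 ^+ n ->
  1 <= y -> D <= (y ^+ m) ^+ n -> comb_const R n * (D / L ^+ n.-1) <= y ^+ m ->
  uniq cs -> (forall c, c \in cs -> class_group2 K c) ->
  (size cs)%:R <=
    4 * L * (count_const R n * (n.*2.+2%:R * T0) ^+ n) / (T0 * Num.sqrt D) +
    C * y ^+ m.-1 * (count_const R n * (n.*2.+2%:R * y ^+ m) ^+ n) / (y ^+ m * Num.sqrt D).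
Proof.
move=> C0 CP L1 LT DT y1 Dy Ly ucs csP.
have [sigma sigmaP] := embeddings_exist R K.
have L0 := lt_le_trans ltr01 L1; have T0_gt0 := lt_le_trans L0 LT.
have ym0 : 0 < y ^+ m by rewrite exprn_gt0 // (lt_le_trans ltr01).
have D0 : 0 < D := lt_le_trans ltr01 (abs_disc_ge1 K R).
have sD0 : 0 < Num.sqrt D by rewrite sqrtr_gt0.
pose root (c : set (set K)) (x : K) := exists (I : set K) beta g, [/\ square_ideal I beta, c = ideal_class I,
   I g /\ g != 0 & x = g ^+ 2 / beta].
pose small x := abssum sigma x <= L.
pose large x := abssum sigma x <= y ^+ m /\ injective (fun j => sigma j x).
have /choice[f fP] (c : set (set K)) : exists x : K, class_group2 K c -> root c x /\ (small x \/ large x).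
  have [c2|nc] := pselect (class_group2 K c); last by exists 0.
  have [I [beta [S Dc]]] := class_group2_square c2.
  have [[g gI gL]|[g gI [gL ginj]]] := small_or_primitive_root sigmaP S L0.
    by exists (g ^+ 2 / beta) => _; split; [exists I, beta, g | left].
  exists (g ^+ 2 / beta) => _; split; first by exists I, beta, g.
  by right; split=> //; exact: le_trans Ly.
have rootOK c x : root c x -> ring_of_integers K x /\ exists k : int, `|field_norm x| = (k ^+ 2)%:~R.
  move=> [I [beta [g [S _ [Ig _] ->]]]]; split.
    by rewrite expr2; exact: (square_ideal_div S).
  have [nzb ID IM IO _] := S.
  have [_ [_ _ _ H]] := square_ideal_basis sigmaP nzb ID IM IO
    (fun x y => square_ideal_div S) (square_ideal_sum S).
  exact: H.
pose s := map f cs.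
have us : uniq s.
  rewrite map_inj_in_uniq // => c d cs_c cs_d E.
  have [[I [b [g [S Ec [Ig nzg] Eg]]]] _] := fP c (csP c cs_c).
  have [[J [b' [h [S' Ed [Jh nzh] Eh]]]] _] := fP d (csP d cs_d).
  by rewrite Ec Ed; apply: (square_root_class S S' Ig Jh nzg nzh); rewrite -Eg -Eh.
have sP x : x \in s -> exists2 c, root c x & small x \/ large x.
  by move=> /mapP[c cc ->]; have [] := fP c (csP c cc); exists c.
pose A := [seq x <- s | `[< small x >]]; pose B := [seq x <- s | ~~ `[< small x >]].
have -> : (size cs)%:R = (size A)%:R + (size B)%:R :> R.
  by rewrite -natrD !size_filter -(size_map f) -(count_predC (fun x => `[< small x >])).
apply: lerD.
  rewrite ler_pdivlMr ?mulr_gt0 // [leLHS]mulrA; apply: (count_small sigmaP) => //.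
    by rewrite filter_uniq.
  move=> x; rewrite mem_filter => /andP[/asboolP xL /sP[c /rootOK[Ox _] _]].
  by split.
rewrite ler_pdivlMr ?(mulr_gt0 ym0 sD0) // [leLHS]mulrA; apply: (count_square sigmaP) => //.
  by rewrite filter_uniq.
move=> x; rewrite mem_filter => /andP[/asboolP nL /sP[c /rootOK[Ox Nx] [//|[xT xi]]]].
by split.
Qed.
End TorsionBound.

(** * Choice of the exponents *)

Section PowerBound.
Variables (R : realType) (n : nat).
Hypothesis n_gt0 : (0 < n)%N.
Local Notation m := (4 * n.+2)%N.

(* The count of square values saves a factor D^(1/(m n)), and the exponent
   1/n + (n-1) tau of the box costs D^(n (n-1) tau); with tau = 1/(m n^3) a
   factor of at least D^tau remains. *)
Definition saving : R := (m%:R * n%:R ^+ 3)^-1.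

Lemma saving_gt0 : 0 < saving.
Proof. by rewrite invr_gt0 mulr_gt0 ?exprn_gt0 ?ltr0n // muln_gt0. Qed.

Lemma comb_const_ge1 : 1 <= comb_const R n.
Proof.
have n1 : 1 <= n%:R :> R by rewrite ler1n.
have N1 : 1 <= (2 * n ^ 3)%:R :> R by rewrite ler1n muln_gt0 expn_gt0 n_gt0.
apply: mulr_ege1; last exact: hermite_const_ge1.
by apply: mulr_ege1 => //; apply: exprn_ege1; apply: mulr_ege1 => //; exact: exprn_ege1.
Qed.

Variables (C D : R).
Hypotheses (C_ge0 : 0 <= C) (D_ge1 : 1 <= D).
Let P (x : R) := D `^ x.
Let L := P (n%:R^-1 - saving).
Let T0 := P n%:R^-1.
(** D^u is D / L^(n-1), which governs the conjugates in the second case. The factor [comb_const] in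
    [y] appears in y^m to the power m, which covers the single factor required. *)
Let u : R := n%:R^-1 + (n%:R - 1) * saving.
Let y := comb_const R n * P (u / m%:R).

Let PD a b : P (a + b) = P a * P b.
Proof. by rewrite /P powRD //; apply/implyP => _; rewrite gt_eqF // (lt_le_trans ltr01). Qed.

Let PX a k : P a ^+ k = P (a * k%:R).
Proof. by rewrite /P powRrM powR_mulrn // powR_ge0. Qed.

Let P_gt0 a : 0 < P a.
Proof. by rewrite powR_gt0 // (lt_le_trans ltr01). Qed.

Let PV a : (P a)^-1 = P (- a).
Proof. by rewrite /P powRN. Qed.

Let le_P a b : a <= b -> P a <= P b.
Proof. exact: ler_powR. Qed.

Let P0 : P 0 = 1. Proof. exact: powRr0. Qed.
Let P1 : P 1 = D. Proof. by rewrite /P powRr1 // (le_trans ler01). Qed.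

Let nr_gt0 : 0 < n%:R :> R. Proof. by rewrite ltr0n. Qed.
Let nr_ge1 : 1 <= n%:R :> R. Proof. by rewrite ler1n. Qed.
Let mr_gt0 : 0 < m%:R :> R. Proof. by rewrite ltr0n. Qed.

Let savingE : saving * m%:R * n%:R ^+ 3 = 1.
Proof. by rewrite -mulrA mulVf // gt_eqF // mulr_gt0 ?exprn_gt0. Qed.

Let saving_le : saving <= n%:R^-1.
Proof.
rewrite /saving lef_pV2 ?posrE ?mulr_gt0 ?exprn_gt0 // exprS mulrCA ler_peMr ?(ltW nr_gt0) //.
by apply: mulr_ege1; [rewrite ler1n | apply: exprn_ege1].
Qed.

Let u_ge : n%:R^-1 <= u.
Proof. by rewrite lerDl mulr_ge0 ?subr_ge0 // ltW // saving_gt0. Qed.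

Let u_ge0 : 0 <= u.
Proof. by apply: le_trans u_ge; rewrite invr_ge0 ltW. Qed.

Let L1 : 1 <= L. Proof. by rewrite -[leLHS]P0 le_P // subr_ge0. Qed.
Let LT : L <= T0. Proof. by rewrite le_P // gerBl ltW // saving_gt0. Qed.
Let DT : D <= T0 ^+ n. Proof. by rewrite PX mulVf ?gt_eqF // P1. Qed.
Let y1 : 1 <= y.
Proof.
apply: mulr_ege1; first exact: comb_const_ge1.
by rewrite -[leLHS]P0; apply: le_P; apply: divr_ge0; [exact: u_ge0 | exact: ler0n].
Qed.
Let ymE : y ^+ m = comb_const R n ^+ m * P u.
Proof. by rewrite exprMn PX divfK // gt_eqF. Qed.

Let Pu_le : P u <= y ^+ m.
Proof. by rewrite ymE ler_peMl ?(ltW (P_gt0 _)) // exprn_ege1 // comb_const_ge1. Qed.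

Let Dy : D <= (y ^+ m) ^+ n.
Proof.
apply: le_trans DT _; rewrite ler_pXn2r ?nnegrE ?(ltW (P_gt0 _)) //.
  by apply: le_trans Pu_le; exact: le_P.
by rewrite exprn_ge0 // (le_trans ler01).
Qed.

Let Ly : comb_const R n * (D / L ^+ n.-1) <= y ^+ m.
Proof.
rewrite ymE PX -{1}P1 PV -PD.
have -> : 1 + - ((n%:R^-1 - saving) * n.-1%:R) = u.
  have -> : n.-1%:R = n%:R - 1 :> R by rewrite -[in RHS](prednK n_gt0) -natr1 addrK.
  by rewrite /u; field; rewrite gt_eqF.
rewrite ler_wpM2r ?(ltW (P_gt0 _)) //.
by apply: ler_eXnr; rewrite ?comb_const_ge1.
Qed.

Let cc := count_const R n.

(** The equation displays the constant as independent of [D], since the theorem fixes it before the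
    field. *)
Lemma power_bound : exists2 c : R, (c = 4 * (cc * n.*2.+2%:R ^+ n) +
     C * (cc * n.*2.+2%:R ^+ n) * comb_const R n ^+ (m * n)) & [/\ 1 <= L, L <= T0, D <= T0 ^+ n,
  [/\ 1 <= y, D <= (y ^+ m) ^+ n & comb_const R n * (D / L ^+ n.-1) <= y ^+ m] &
    4 * L * (cc * (n.*2.+2%:R * T0) ^+ n) / (T0 * Num.sqrt D) +
    C * y ^+ m.-1 * (cc * (n.*2.+2%:R * y ^+ m) ^+ n) / (y ^+ m * Num.sqrt D)
   <= c * D `^ (1 / 2 - saving)].
Proof.
eexists; first reflexivity; split=> //.
have cc0 : 0 <= cc by exact: count_const_ge0.
have ccn0 : 0 <= cc * n.*2.+2%:R ^+ n by rewrite mulr_ge0 // exprn_ge0.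
have sq : Num.sqrt D = P 2^-1 by rewrite /P powR12_sqrt // (le_trans ler01).
rewrite sq [leRHS]mulrDl; apply: lerD.
  rewrite exprMn PX mulVf ?gt_eqF // invfM !PV.
  rewrite (_ : 4 * L * (cc * (n.*2.+2%:R ^+ n * P 1)) * (P (- n%:R^-1) * P (- 2^-1)) =
     4 * (cc * n.*2.+2%:R ^+ n) * (L * P 1 * P (- n%:R^-1) * P (- 2^-1))); last by ring.
  apply: ler_wpM2l; first by rewrite mulr_ge0.
  by rewrite /L -!PD; apply: le_P; lra.
have yy : y ^+ m = y * y ^+ m.-1 by rewrite -exprS.
have y0 : 0 < y by exact: lt_le_trans ltr01 y1.
have W0 : 0 < y ^+ m.-1 by rewrite exprn_gt0.
have -> : C * y ^+ m.-1 * (cc * (n.*2.+2%:R * y ^+ m) ^+ n) / (y ^+ m * P 2^-1) =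
   C * (cc * n.*2.+2%:R ^+ n) * ((y ^+ m) ^+ n * y^-1 * P (- 2^-1)).
  have alg (e b a z p N : R) : b != 0 -> z != 0 -> p != 0 ->
      C * b * (e * (N * a)) / (z * b * p) = C * (e * N) * (a * z^-1 * p^-1).
    by move=> nzb nzz nzp; field; rewrite nzb nzz nzp.
  rewrite -PV -(alg _ (y ^+ m.-1)) ?gt_eqF // -yy; congr (_ * (_ * _) / _).
  exact: exprMn.
rewrite -[leRHS]mulrA; apply: ler_wpM2l; first by rewrite mulr_ge0.
rewrite ymE exprMn -exprM PX.
apply: le_trans (_ : comb_const R n ^+ (m * n) * P (u * n%:R) * P (- (u / m%:R)) * P (- 2^-1) <= _).
  rewrite ler_wpM2r ?(ltW (P_gt0 _)) // ler_wpM2l //.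
    by rewrite mulr_ge0 ?(ltW (P_gt0 _)) // exprn_ge0 // (le_trans ler01) // comb_const_ge1.
  rewrite -PV lef_pV2 ?posrE // ler_peMl ?(ltW (P_gt0 _)) //; exact: comb_const_ge1.
rewrite -!mulrA -!PD ler_wpM2l ?exprn_ge0 ?(le_trans ler01 comb_const_ge1) // le_P //.
(* With tau the saving, the exponent is n u - u/m - 1/2. Here n u is 1 + n(n-1) tau and u/m is at
   least n^2 tau, so the exponent is at most 1/2 - n tau. *)
have e1 : u * n%:R = 1 + (n%:R - 1) * (n%:R * saving) by rewrite /u; field; rewrite gt_eqF.
have e2 : saving * n%:R ^+ 2 <= u / m%:R.
  apply: le_trans (_ : n%:R^-1 / m%:R <= _); last by rewrite ler_pM2r ?invr_gt0.
  rewrite ler_pdivlMr // -[leRHS]mul1r ler_pdivlMr // -[leRHS]savingE.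
  by rewrite le_eqVlt; apply/orP; left; apply/eqP; ring.
have s0 := saving_gt0.
rewrite e1; move: e2 s0 nr_ge1; move: (u / m%:R) saving (n%:R) => a t N e2 s0 N1.
nra.
Qed.
End PowerBound.

Theorem theorem1p1 (R : realType) (n : nat) (hn : (0 < n)%N) :
  exists2 delta : R, 0 < delta &
    forall eps : R, 0 < eps ->
      exists2 c : R, 0 < c &
        forall K : fieldExtType rat, \dim {:K} = n ->
          (h2 R K <= (c * (`|disc K|%:~R `^ (1 / 2 - delta + eps)))%:E)%E.
Proof.
have [C C0 CP] := @square_values R n hn.
exists (saving R n); first exact: saving_gt0.
move=> eps eps0.
pose N : R := count_const R n * n.*2.+2%:R ^+ n.
pose c : R := 4 * N + C * N * comb_const R n ^+ (4 * n.+2 * n).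
have N0 : 0 <= N by rewrite mulr_ge0 ?count_const_ge0 ?exprn_ge0.
have c0 : 0 <= c.
  apply: addr_ge0; first exact: mulr_ge0.
  apply: mulr_ge0; first exact: mulr_ge0.
  apply: exprn_ge0.
  exact: le_trans ler01 (comb_const_ge1 R hn).
(* Adding 1 to the nonnegative [c] makes the constant positive. *)
exists (c + 1); first by rewrite ltr_wpDl.
move=> K dimK; subst n; apply: counting_le => s us sP.
have D1 := abs_disc_ge1 K R.
have [c' Dc' [L1 LT DT [y1 Dy Ly] le_c']] := power_bound hn C0 D1.
apply: le_trans (torsion_count C0 CP L1 LT DT y1 Dy Ly us sP) _.
apply: le_trans le_c' _; rewrite Dc' -/N -/c -abs_discE.
apply: ler_pM; rewrite ?powR_ge0 //; first by rewrite lerDl.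
by apply: ler_powR => //; rewrite lerDl ltW.
Qed.
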